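(* Let $1\le p\le q\le\infty$, $q\ge2$. Let $\hat\sigma$ be a Borel measure on $\hat{\mathbb S}$ for which there exist constants $C_{\hat\sigma}\ge1$ and $0<\underline\delta\le\bar\delta<\infty$ such that for every dyadic triangle $S\subseteq\hat{\mathbb S}$ $$C_{\hat\sigma}^{-1}\hat\nu(S)^{1/\underline\delta}\le\hat\sigma(S)\ \text{ if }0<\mathrm{diam}(S)<1,\qquad C_{\hat\sigma}^{-1}\hat\nu(S)^{1/\bar\delta}\le\hat\sigma(S)\ \text{ if }\mathrm{diam}(S)\ge1 .$$ Then $$\Vert u\Vert_{L^q(\hat\nu)}\le C\sum_{i=1,2}\hat{\mathcal E}(u)^{a_i/2}\,\Vert u\Vert_{L^p(\hat\sigma)}^{1-a_i},\qquad u\in\mathcal F(\hat{\mathbb S}),$$ where $$a_1=\Big[\frac{1/(p\underline\delta)-1/q}{1/(p\underline\delta)+1/(2\delta_s)}\Big]^+,\qquad a_2=\Big[\frac{1/(p\bar\delta)-1/q}{1/(p\bar\delta)+1/(2\delta_s)}\Big]^+,$$ and $C>0$ is a constant depending only on $C_{\hat\sigma}$. Moreover, if there exists a sequence $\{S_m\}_{m\in\mathbb Z}$ of dyadic triangles such that $\lim_{m\to-\infty}\mathrm{diam}(S_m)=0$, $\lim_{m\to\infty}\mathrm{diam}(S_m)=\infty$ and $$\frac1{\underline\delta}=\lim_{m\to-\infty}\frac{\log\hat\sigma(S_m)}{\log\hat\nu(S_m)},\qquad\frac1{\bar\delta}=\lim_{m\to\infty}\frac{\log\hat\sigma(S_m)}{\log\hat\nu(S_m)},$$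 then the pair $(a_1,a_2)$ is optimal in the following sense: if $$\Vert u\Vert_{L^q(\hat\nu)}\le C\sum_{i=1}^N\hat{\mathcal E}(u)^{b_i/2}\,\Vert u\Vert_{L^p(\hat\sigma)}^{1-b_i},\qquad u\in\mathcal F(\hat{\mathbb S}),$$ for some $N\in\mathbb N_+$, constants $b_i\in[0,1]$ ($1\le i\le N$) and $C>0$ independent of $u$, then $\min_ib_i\le a_2\le a_1\le\max_ib_i$.
   Context: Conventions: $1/\infty=0$, $[t]^+=\max(t,0)$, $\mathrm{diam}$ is the Euclidean diameter, and $\delta_s>0$ is defined by $1/\delta_s=\log 5/\log 3-1$. Compact gasket: let $\mathbf F_1(x)=\frac12x$, $\mathbf F_2(x)=\frac12(x+(1,0))$, $\mathbf F_3(x)=\frac12(x+(\frac12,\frac{\sqrt3}2))$ on $\mathbb R^2$, $\mathrm V_0=\{(0,0),(1,0),(\frac12,\frac{\sqrt3}2)\}$, $\mathrm V_m=\bigcup_{i=1}^3\mathbf F_i(\mathrm V_{m-1})$ for $m\ge1$, and $\mathbb S$ the closure of $\bigcup_m\mathrm V_m$. For a word $w=w_1\cdots w_m\in\{1,2,3\}^m$ put $\mathbf F_w=\mathbf F_{w_1}\circ\cdots\circ\mathbf F_{w_m}$ (identity if $m=0$) and $\mathbb S_w=\mathbf F_w(\mathbb S)$. The Hausdorff measure $\nu$ is the unique Borel probability measure on $\mathbb S$ with $\nu(\mathbb S_w)=3^{-m}$ for every word $w$ of length $m$, $m\ge0$. For a function $u$ on $\bigcup_m\mathrm V_m$ let $\mathcal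 E^{(m)}(u)=\frac12(5/3)^m\sum_{(x,y)}[u(x)-u(y)]^2$, the sum running over ordered pairs of distinct points $x,y$ that lie in a common set $\mathbf F_w(\mathrm V_0)$ with $w$ of length $m$. $\mathcal E^{(m)}(u)$ is non-decreasing in $m$; let $\mathcal E(u)=\lim_m\mathcal E^{(m)}(u)\in[0,\infty]$. Infinite gasket: $\hat{\mathbb S}=\bigcup_{k\ge0}2^k[\mathbb S\cup(-\mathbb S)]$. Let $\{\tau_i\}_{i\in\mathbb Z}$ be an enumeration without repetition of the distinct isometries $x\mapsto 2^k\mathbf F_w(x)$ and $x\mapsto-2^k\mathbf F_w(x)$, where $k\ge0$ and $w$ is a word of length $k$; then $\hat{\mathbb S}=\bigcup_{i\in\mathbb Z}\tau_i(\mathbb S)$ with non-overlapping pieces. The Hausdorff measure $\hat\nu$ on $\hat{\mathbb S}$ is the unique Borel measure with $\hat\nu(\tau_i(A))=\nu(A)$ for all Borel $A\subseteq\mathbb S$ and all $i$. For $u\in C(\hat{\mathbb S})$ let $\hat{\mathcal E}(u)=\sum_{i\in\mathbb Z}\mathcal E[(u\circ\tau_i)|_{\mathbb S}]$. $\mathcal F(\hat{\mathbb S})$ is the completion of $\{u\in C(\hat{\mathbb S})\cap L^2(\hat\nu):\hat{\mathcal E}(u)<\infty\}$ with respect to the norm $\hat{\mathcal E}(\cdot)^{1/2}+\Vert\cdot\Vert_{L^2(\hat\nu)}$; its elements are continuous functions on $\hat{\mathbb S}$ vanishing at infinity. A dyadic triangle is a set of the form $2^m\tau_i(\mathbb S)$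 with $m,i\in\mathbb Z$. *)

(* Defs.v *)
From HB Require Import structures.
From mathcomp Require Import all_boot all_order all_algebra.
From mathcomp Require Import all_classical all_reals all_analysis.

Set Implicit Arguments.
Unset Strict Implicit.
Unset Printing Implicit Defensive.
Import Order.TTheory GRing.Theory Num.Theory.
Import numFieldNormedType.Exports.

Local Open Scope classical_set_scope.
Local Open Scope ring_scope.

(* [R^o] rather than [R] in each factor, so that pairs can be scaled by [*:]. *)
Notation plane R := (R^o * R^o)%type.

Notation borel_plane R := (g_sigma_algebraType (@open (plane R))).

(* [plane R] carries the max-norm, so the Euclidean metric is spelled out. *)
Definition eucl_dist (R : realType) (x y : plane R) : R :=
  Num.sqrt ((x.1 - y.1) ^+ 2 + (x.2 - y.2) ^+ 2).

Definition diam (R : realType) (A : set (plane R)) : R :=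
  sup [set eucl_dist x y | x in A & y in A].

Section CompactGasket.
Context {R : realType}.

Definition corner (i : 'I_3) : plane R :=
  tnth [tuple (0, 0); (1, 0); (2^-1, Num.sqrt 3 / 2)] i.

Definition F (i : 'I_3) (x : plane R) : plane R := 2^-1 *: (x + corner i).

Definition F_word (w : seq 'I_3) : plane R -> plane R :=
  foldr (fun i g => F i \o g) id w.

Definition V0 : set (plane R) := range corner.

Fixpoint V (m : nat) : set (plane R) :=
  if m is k.+1 then \bigcup_i (F i @` V k) else V0.

Definition gasket : set (plane R) := closure (\bigcup_m V m).

Definition cell (w : seq 'I_3) : set (plane R) := F_word w @` gasket.

Definition is_hausdorff_gasket (nu : probability (borel_plane R) R) : Prop :=
  forall w : seq 'I_3, nu (cell w) = ((3 ^- size w)%:E)%E.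

Definition edges (m : nat) : set (plane R * plane R) :=
  [set e | e.1 <> e.2 /\ exists w : seq 'I_3,
     [/\ size w = m, (F_word w @` V0) e.1 & (F_word w @` V0) e.2]].

Definition energy_approx (m : nat) (u : plane R -> R) : R :=
  2^-1 * (5 / 3) ^+ m * \sum_(e \in edges m) (u e.1 - u e.2) ^+ 2.

Definition energy (u : plane R -> R) : \bar R :=
  limn (fun m => (energy_approx m u)%:E).

End CompactGasket.

Section InfiniteGasket.
Context {R : realType}.
Local Open Scope ereal_scope.

Definition inf_gasket : set (plane R) :=
  \bigcup_(k : nat)
    ((fun x : plane R => ((2 : R) ^+ k *: x)%R) @`
       (gasket `|` ((fun x : plane R => (- x)%R) @` gasket))).

(* The family (tau_i), as the set of its (pairwise distinct) members. *)
Definition isoms : set (plane R -> plane R) :=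
  [set t | exists w : seq 'I_3,
     t = (fun x => ((2 : R) ^+ size w *: F_word w x)%R) \/
     t = (fun x => (- ((2 : R) ^+ size w *: F_word w x))%R)].

Definition dyadic_triangle (A : set (plane R)) : Prop :=
  exists (m : int) (t : plane R -> plane R),
    isoms t /\ A = (fun x : plane R => ((2 : R) ^ m *: x)%R) @` (t @` gasket).

(* Borel measures on [inf_gasket] are represented by the Borel measures on the
   plane that do not charge its complement. *)
Definition concentrated (mu : {measure set (borel_plane R) -> \bar R}) : Prop :=
  mu (~` inf_gasket) = 0.

Definition is_hausdorff_inf_gasket (nu : probability (borel_plane R) R)
    (nuhat : {measure set (borel_plane R) -> \bar R}) : Prop :=
  concentrated nuhat /\
  forall (t : plane R -> plane R) (A : set (borel_plane R)),
    isoms t -> measurable A -> A `<=` gasket -> nuhat (t @` A) = nu A.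

Definition inf_energy (u : plane R -> R) : \bar R :=
  \esum_(t in isoms) energy (u \o t).

(* A function on [inf_gasket] is given by a function on the plane whose values
   outside [inf_gasket] are immaterial: the norm restricts it. *)
Definition Lp_norm (mu : {measure set (borel_plane R) -> \bar R}) (p : \bar R)
    (u : plane R -> R) : \bar R :=
  'N[mu]_p [EFin \o (u \_ inf_gasket : borel_plane R -> R)].

Definition pre_domain (nuhat : {measure set (borel_plane R) -> \bar R})
    (u : plane R -> R) : Prop :=
  [/\ {within inf_gasket, continuous u}, Lp_norm nuhat 2%:E u < +oo
    & inf_energy u < +oo].

Definition domain_norm (nuhat : {measure set (borel_plane R) -> \bar R})
    (u : plane R -> R) : \bar R :=
  inf_energy u `^ 2^-1 + Lp_norm nuhat 2%:E u.

(* The completion of [pre_domain]: a Cauchy sequence is identified with its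
   limit in L^2(nuhat), taken in its continuous version. *)
Definition domain (nuhat : {measure set (borel_plane R) -> \bar R})
    (u : plane R -> R) : Prop :=
  {within inf_gasket, continuous u} /\
  exists u_ : nat -> plane R -> R,
    [/\ forall n, pre_domain nuhat (u_ n),
        forall e : R, (0 < e)%R -> exists N : nat, forall m n : nat,
          (N <= m)%N -> (N <= n)%N ->
          domain_norm nuhat (u_ m \- u_ n)%R < e%:E
      & Lp_norm nuhat 2%:E (u_ n \- u)%R @[n --> \oo] --> 0].

Definition volume_lower_bound
    (nuhat sigma : {measure set (borel_plane R) -> \bar R})
    (Csigma dl du : R) : Prop :=
  forall A : set (plane R), dyadic_triangle A -> A `<=` inf_gasket ->
    ((0 < diam A < 1)%R -> (Csigma^-1)%:E * nuhat A `^ dl^-1 <= sigma A) /\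
    ((1 <= diam A)%R -> (Csigma^-1)%:E * nuhat A `^ du^-1 <= sigma A).

End InfiniteGasket.

Section Exponents.
Context {R : realType}.

Definition delta_s : R := (ln 5 / ln 3 - 1)^-1.

(* [1/p] with [1/oo = 0]. *)
Definition recip (p : \bar R) : R := fine (p^-1)%E.

Definition interp_exponent (p q : \bar R) (d : R) : R :=
  Num.max ((recip p / d - recip q) / (recip p / d + (2 * delta_s)^-1)) 0.

End Exponents.

(* Main.v *)
(* Proof idea. In barycentric coordinates the isometries tau are the maps
   x |-> +-(x + a) with a in a set of lattice points, so for every integer n the
   space is tiled by triangles of size 2^n and mass 3^n.  On such a tile S,
   osc_S u <= c (5/3)^(n/2) E_S(u)^(1/2), hence |u| is at most twice the
   oscillation plus twice the L^p(sigma)-mean over S.  Summing q-th powers (q >= 2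
   and q >= p) gives, with A = E(u)^(1/2) and B the L^p(sigma)-norm of u,
     |u|_q <= K (3^(n beta) A + 3^(- n alpha) B),
     beta = 1/q + 1/(2 delta_s),  alpha = 1/(p delta) - 1/q,
   where delta is the lower exponent for n < 0 and the upper one for n >= 0.
   Taking for n the ceiling of the balancing value costs a factor 3^beta <= 3 only,
   so the constant does not depend on p, q and the exponents.
   Optimality is tested on copies on S_m of a piecewise harmonic tent vanishing at
   the corners: a bound with exponents b_i forces
     1 <= D sum_i 3^(n (k (1 - b_i) / p - b_i / (2 delta_s) - 1/q)),
   with 2^n = diam S_m and k = log sigma(S_m) / log nu(S_m), as n -> -oo or +oo. *)

Require Import Defs.
From HB Require Import structures.
From mathcomp Require Import all_boot all_order all_algebra.
From mathcomp Require Import all_classical all_reals all_analysis.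
From mathcomp Require Import measurable_realfun ess_sup_inf ring lra zify.

Set Implicit Arguments.
Unset Strict Implicit.
Unset Printing Implicit Defensive.
Import Order.TTheory GRing.Theory Num.Theory.
Import numFieldNormedType.Exports.

Local Open Scope classical_set_scope.
Local Open Scope ring_scope.

(** * Geometry of the gasket *)

(** Nothing bounds [sigma] from above: it may have atoms at the points where tiles touch and
    infinite mass on a tile. So tiles are not disjoint up to [sigma]-null sets, and averages over
    them are avoided. The first difficulty is met by splitting the tiles of one size into eight
    classes of pairwise disjoint ones; the second by a dichotomy: either |u(x)| is at most twice the
    oscillation bound of its tile, or |u| >= |u(x)|/2 on the whole tile, and then a lower bound for
    the mass suffices. In the q-th powers only a square of the oscillation, respectively a p-th
    power of u, is kept, since these are the quantities that add up over the tiles; the excess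
    powers are bounded uniformly. An element of the completion is given as an L^2-limit, so its
    energy is not finite by definition. Bounded energy makes the approximating functions
    equicontinuous, L^2-convergence then becomes pointwise, and lower semicontinuity applies. The
    tent has to vanish at the corners so that its extension by zero is continuous and has no energy
    on other tiles. *)

Definition i0 : 'I_3 := @Ordinal 3 0 isT.
Definition i1 : 'I_3 := @Ordinal 3 1 isT.
Definition i2 : 'I_3 := @Ordinal 3 2 isT.

Lemma ord3P (P : 'I_3 -> Prop) : P i0 -> P i1 -> P i2 -> forall i, P i.
Proof.
move=> P0 P1 P2 [[|[|[|//]]] lti].
- by rewrite (_ : Ordinal lti = i0)//; apply: val_inj.
- by rewrite (_ : Ordinal lti = i1)//; apply: val_inj.
- by rewrite (_ : Ordinal lti = i2)//; apply: val_inj.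
Qed.

Lemma sum3E (V : nmodType) (f : 'I_3 -> V) :
  \sum_(i < 3) f i = f i0 + f i1 + f i2.
Proof.
rewrite !big_ord_recl big_ord0 addr0 addrA; congr (_ + _ + _);
  congr f; exact: val_inj.
Qed.

Lemma closed_preimage (T U : topologicalType) (f : T -> U) (D : set U) :
  continuous f -> closed D -> closed (f @^-1` D).
Proof. by move=> /continuous_closedP; apply. Qed.

Section Coordinates.
Context {R : realType}.
Implicit Types (x y : plane R) (i : 'I_3) (k : R).

(* Coordinates in the basis [(1, 0), (1/2, sqrt 3 / 2)]. *)
Definition ct x : R := x.2 * (2 / Num.sqrt 3).
Definition cs x : R := x.1 - ct x / 2.

Lemma sqrt3_neq0 : Num.sqrt 3 != 0 :> R.
Proof. by rewrite gt_eqF// sqrtr_gt0. Qed.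

Lemma ctD x y : ct (x + y) = ct x + ct y. Proof. by rewrite /ct/= mulrDl. Qed.
Lemma csD x y : cs (x + y) = cs x + cs y.
Proof. by rewrite /cs ctD/=; lra. Qed.
Lemma ctZ k x : ct (k *: x) = k * ct x.
Proof. by rewrite /ct/= -[_ *: _]/(_ * _) -mulrA. Qed.
Lemma csZ k x : cs (k *: x) = k * cs x.
Proof. by rewrite /cs ctZ/= -[_ *: _]/(_ * _); lra. Qed.
Definition vec (s t : R) : plane R := (s + t / 2, t * (Num.sqrt 3 / 2)).

Lemma ct_vec s t : ct (vec s t) = t.
Proof. by rewrite /ct/=; field; exact: sqrt3_neq0. Qed.
Lemma cs_vec s t : cs (vec s t) = s.
Proof. by rewrite /cs ct_vec/=; lra. Qed.

Lemma vecK x : vec (cs x) (ct x) = x.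
Proof.
case: x => a b; rewrite /vec /cs /ct /=; congr pair; first by lra.
by field; exact: sqrt3_neq0.
Qed.

Lemma fst_coord x : x.1 = cs x + ct x / 2. Proof. by rewrite -{1}(vecK x). Qed.
Lemma snd_coord x : x.2 = ct x * (Num.sqrt 3 / 2).
Proof. by rewrite -{1}(vecK x). Qed.

Lemma coord_inj x y : cs x = cs y -> ct x = ct y -> x = y.
Proof. by move=> st tt'; rewrite -(vecK x) -(vecK y) st tt'. Qed.

Definition es i : R := (i == 1%N :> nat)%:R.
Definition et i : R := (i == 2%N :> nat)%:R.

Lemma corner_vec i : corner i = vec (es i) (et i) :> plane R.
Proof.
elim/ord3P: i; rewrite /corner (tnth_nth 0)/= /vec /es /et /=; congr pair; lra.
Qed.

Lemma cs_corner i : cs (corner i) = es i. Proof. by rewrite corner_vec cs_vec. Qed.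
Lemma ct_corner i : ct (corner i) = et i. Proof. by rewrite corner_vec ct_vec. Qed.

Lemma cs_F i x : cs (F i x) = (cs x + es i) / 2.
Proof. by rewrite csZ csD cs_corner mulrC. Qed.
Lemma ct_F i x : ct (F i x) = (ct x + et i) / 2.
Proof. by rewrite ctZ ctD ct_corner mulrC. Qed.

Lemma continuous_ct : continuous ct.
Proof.
move=> x; apply: (@continuousM R (plane R) snd (cst _) x); last exact: cvg_cst.
exact: cvg_snd.
Qed.
Lemma continuous_cs : continuous cs.
Proof.
move=> x; apply: (@continuousB _ _ (plane R) fst (fun y => ct y / 2) x).
  exact: cvg_fst.
apply: (@continuousM R (plane R) ct (cst _) x); last exact: cvg_cst.
exact: continuous_ct.
Qed.

Lemma continuous_affine k (a : plane R) :
  continuous (fun x : plane R => k *: (x + a)).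
Proof.
move=> x; apply: (@continuousZr _ _ (plane R) (fun y : plane R => y + a) k x).
by apply: (@continuousD _ _ _ id (cst a) x); [exact: cvg_id|exact: cvg_cst].
Qed.

Lemma closed_affine k (a : plane R) (A : set (plane R)) : k != 0 -> closed A ->
  closed ((fun x : plane R => k *: (x + a)) @` A).
Proof.
move=> k0 cA.
rewrite (_ : _ @` _ = (fun y => k^-1 *: (y + - (k *: a))) @^-1` A); last first.
  apply/seteqP; split=> [_ [x Ax <-]|y Ay] /=.
    by rewrite -scalerBr addrK scalerA mulVf// scale1r.
  by exists (k^-1 *: (y - k *: a)); rewrite // scalerDr scalerA divff// scale1r subrK.
by apply: closed_preimage => //; exact: continuous_affine.
Qed.

Lemma F_continuous i : continuous (@F R i).
Proof. exact: (@continuous_affine 2^-1 (corner i)). Qed.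

Lemma F_corner i : F i (corner i) = corner i :> plane R.
Proof. by apply: coord_inj; rewrite ?cs_F ?ct_F ?cs_corner ?ct_corner; lra. Qed.

Lemma F_inj i : injective (@F R i).
Proof.
by move=> x y xy; apply: coord_inj;
  [have := congr1 cs xy; rewrite !cs_F|have := congr1 ct xy; rewrite !ct_F]; lra.
Qed.

(** The solid triangle spanned by [V0]. Incidence facts are proved for it rather than for the
    gasket, because membership amounts to three linear inequalities that [lra] can use. *)
Definition triangle : set (plane R) :=
  [set x | [/\ 0 <= cs x, 0 <= ct x & cs x + ct x <= 1]].

Lemma closed_triangle : closed triangle.
Proof.
have cst_ : continuous (fun x => cs x + ct x).
  by move=> x; apply: continuousD; [exact: continuous_cs|exact: continuous_ct].
rewrite (_ : triangle = cs @^-1` [set t | 0 <= t] `&` ct @^-1` [set t | 0 <= t]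
   `&` (fun x => cs x + ct x) @^-1` [set t | t <= 1]).
  apply: closedI; [apply: closedI|]; apply: closed_preimage.
  - exact: continuous_cs.
  - exact: closed_ge.
  - exact: continuous_ct.
  - exact: closed_ge.
  - exact: cst_.
  - exact: closed_le.
by apply/seteqP; split=> x /=; [case|case; case].
Qed.

Lemma F_triangle i : F i @` triangle `<=` triangle.
Proof.
move=> _ [x [x1 x2 x3] <-]; rewrite /triangle/= cs_F ct_F.
by elim/ord3P: i; rewrite /es /et/=; split; lra.
Qed.

Lemma corner_triangle i : triangle (corner i).
Proof.
rewrite /triangle/= cs_corner ct_corner.
by elim/ord3P: i; rewrite /es /et/=; split; lra.
Qed.

(** The half-size triangles at corners i and j touch only at the midpoint of the side joining these
    corners. *)
Lemma F_triangle_meet i j x y : i != j -> triangle x -> triangle y ->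
  F i x = F j y -> x = corner j /\ y = corner i.
Proof.
move=> ij [x1 x2 x3] [y1 y2 y3] xy.
have := congr1 cs xy; have := congr1 ct xy; rewrite !cs_F !ct_F => et_ es_.
suff [] : [/\ cs x = es j, ct x = et j, cs y = es i & ct y = et i].
  by split; apply: coord_inj; rewrite ?cs_corner ?ct_corner.
by clear xy; move: ij et_ es_; elim/ord3P: i; elim/ord3P: j; rewrite // /es /et /= => *;
  split; lra.
Qed.

Lemma V_triangle m : V m `<=` triangle.
Proof.
elim: m => [_ [i _ <-]|m IH _ [i _ [x Vx <-]]]; first exact: corner_triangle.
by apply: (@F_triangle i); exists x => //; exact: IH.
Qed.

Lemma V_corner m i : V m (corner i : plane R).
Proof.
by elim: m => [|m IH]; [exists i|exists i => //; exists (corner i); rewrite ?F_corner].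
Qed.

Definition Vstar : set (plane R) := \bigcup_m V m.

Lemma gasket_triangle : gasket `<=` triangle.
Proof.
rewrite (_ : triangle = closure triangle); last first.
  by apply/seteqP; split=> x; [exact: subset_closure|exact: closed_triangle].
by apply: closure_subset => x [m _]; exact: V_triangle.
Qed.

Lemma closed_gasket : closed (@gasket R).
Proof. exact: closed_closure. Qed.

Lemma V_gasket m : V m `<=` @gasket R.
Proof. by move=> x Vx; apply: subset_closure; exists m. Qed.

Lemma corner_gasket i : gasket (corner i : plane R).
Proof. exact: (V_gasket (V_corner 0 i)). Qed.

Lemma F_gasket i x : gasket x -> gasket (F i x : plane R).
Proof.
move=> gx U /(@F_continuous i x) /gx[z [[m _ Vz] Uz]].
by exists (F i z); split=> //; exists m.+1 => //; exists i => //; exists z.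
Qed.

Lemma F_word_gasket w x : gasket x -> gasket (F_word w x : plane R).
Proof. by move=> gx; elim: w => //= i w IH; exact: F_gasket. Qed.

(** Self-similarity. The union of the three images is closed and contains all vertices, hence their
    closure; a vertex of [V0] is in it as a fixed point of its own map. *)
Lemma gasketP x : gasket x -> exists i y, gasket y /\ x = F i y.
Proof.
suff : @gasket R `<=` \bigcup_i (F i @` gasket).
  by move=> /[apply] -[i _ [y gy <-]]; exists i, y.
rewrite [X in _ `<=` X](_ : _ =
   F i0 @` gasket `|` F i1 @` gasket `|` F i2 @` gasket); last first.
  apply/seteqP; split=> z.
    by move=> [i _]; elim/ord3P: i; [left; left|left; right|right].
  by move=> [[|]|] zF; [exists i0|exists i1|exists i2].
set G := (X in _ `<=` X).
have cG : closed G.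
  by do 2?apply: closedU; apply: closed_affine => //;
     rewrite ?invr_neq0//; exact: closed_gasket.
have GE y i : gasket y -> G (F i y).
  by move=> gy; elim/ord3P: i; [left; left|left; right|right]; exists y.
suff VG : Vstar `<=` G by move=> z /(closure_subset VG); exact: cG.
move=> z [[|m] _ /=].
  by move=> [i _ <-]; rewrite -F_corner; apply: GE; exact: corner_gasket.
by move=> [i _ [y Vy <-]]; apply: GE; exact: (V_gasket Vy).
Qed.

End Coordinates.

(** * Lattice vectors of the isometries *)

Definition dbl (a : nat * nat) (i : 'I_3) : nat * nat :=
  ((2 * a.1 + (i == 1%N :> nat))%N, (2 * a.2 + (i == 2%N :> nat))%N).

(** The vector a with 2^|w| F_w(x) = x + a, see [F_wordE]. Prepending [i0] to a word does not change
    it, so words would list isometries repeatedly; indexing by vectors does not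
    ([tau_index_inj]). *)
Definition latw (w : seq 'I_3) : nat * nat := foldl dbl (0, 0)%N w.

Definition Lam : set (nat * nat) := range latw.

Lemma Lam0 : Lam (0, 0)%N. Proof. by exists [::]. Qed.

Lemma Lam_dbl a i : Lam a -> Lam (dbl a i).
Proof. by move=> [w _ <-]; exists (rcons w i); rewrite // /latw foldl_rcons. Qed.

(** The empty word has a parent too, since (0, 0) = dbl (0, 0) i0. Thus refinement has no root and
    all integer scales are on the same footing. *)
Lemma LamP a : Lam a -> exists b i, Lam b /\ a = dbl b i.
Proof.
move=> [w _ <-]; elim/last_ind: w => [|w i _].
  by exists (0, 0)%N, i0; split=> //; exact: Lam0.
by exists (latw w), i; rewrite /latw foldl_rcons; split=> //; exists w.
Qed.

(** The parities of the two coordinates reveal the digit. *)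
Lemma dbl_inj a b i j : dbl a i = dbl b j -> a = b /\ i = j.
Proof.
case: a b => a1 a2 [b1 b2]; elim/ord3P: i; elim/ord3P: j;
  rewrite /dbl /= => -[? ?]; split=> //; try (congr pair; lia); lia.
Qed.

(* [(e, a)] stands for the isometry [x |-> (-1) ^ e (x + a)], see [isomsE]. *)
Definition idx : Type := (bool * (nat * nat))%type.

Definition JL : set idx := [set j | Lam j.2].

Definition sub (j : idx) (i : 'I_3) : idx := (j.1, dbl j.2 i).

Lemma JL_sub j i : JL j -> JL (sub j i).
Proof. exact: Lam_dbl. Qed.

Lemma JLP j : JL j -> exists b i, JL b /\ j = sub b i.
Proof.
by case: j => e a /LamP [b [i [Lb /= ->]]]; exists (e, b), i.
Qed.

Lemma sub_inj a b i j : sub a i = sub b j -> a = b /\ i = j.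
Proof.
case: a b => e a [f b] h; have /= -> := congr1 fst h.
by have /dbl_inj /= [-> ->] := congr1 snd h.
Qed.

(* Tiles of the same color at the same scale are pairwise disjoint. *)
Definition color (j : idx) : bool * (bool * bool) :=
  (j.1, (odd j.2.1, odd j.2.2)).

(** * Tilings of the infinite gasket by triangles of size 2^n *)

Section Tiles.
Context {R : realType}.
Implicit Types (x y : plane R) (j : idx) (n : int).

Definition nvec (a : nat * nat) : plane R := vec a.1%:R a.2%:R.

Lemma nvec_dbl a i : nvec (dbl a i) = 2 *: nvec a + corner i.
Proof.
apply: coord_inj; rewrite ?csD ?ctD ?csZ ?ctZ ?cs_corner ?ct_corner
  ?cs_vec ?ct_vec /dbl/= natrD natrM //.
Qed.

Lemma F_word_rcons w i x : F_word (rcons w i) x = F_word w (F i x).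
Proof. by elim: w => //= k w ->. Qed.

Lemma F_wordE w x : F_word w x = (2 ^- size w) *: (x + nvec (latw w)).
Proof.
elim/last_ind: w x => [|w i IH] x.
  by rewrite /= invr1 scale1r; apply: coord_inj; rewrite ?csD ?ctD ?cs_vec ?ct_vec addr0.
rewrite F_word_rcons IH /latw foldl_rcons -/(latw w) nvec_dbl size_rcons.
rewrite exprS invfM mulrC -scalerA; congr (_ *: _); apply: coord_inj;
  rewrite ?(csD, csZ, ctD, ctZ, cs_F, ct_F, cs_corner, ct_corner); lra.
Qed.

Definition tau j x : plane R := (-1) ^+ j.1 *: (x + nvec j.2).

Lemma cs_tau j x : cs (tau j x) = (-1) ^+ j.1 * (cs x + j.2.1%:R).
Proof. by rewrite csZ csD cs_vec. Qed.
Lemma ct_tau j x : ct (tau j x) = (-1) ^+ j.1 * (ct x + j.2.2%:R).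
Proof. by rewrite ctZ ctD ct_vec. Qed.

Definition phi n j x : plane R := 2 ^ n *: tau j x.

Definition tile n j : set (plane R) := phi n j @` gasket.

Lemma phiE n j x : phi n j x = (2 ^ n * (-1) ^+ j.1) *: (x + nvec j.2).
Proof. by rewrite /phi scalerA. Qed.

Lemma exp2z_neq0 n : (2 : R) ^ n != 0. Proof. by rewrite expfz_neq0. Qed.
Lemma exp2z_gt0 n : 0 < (2 : R) ^ n. Proof. by rewrite exprz_gt0. Qed.

Lemma phi_coef_neq0 n j : (2 : R) ^ n * (-1) ^+ j.1 != 0.
Proof. by rewrite mulf_neq0 ?signr_eq0// exp2z_neq0. Qed.

Lemma phi0 j : phi 0 j = tau j.
Proof. by apply/funext => x; rewrite /phi expr0z scale1r. Qed.

Lemma phi_continuous n j : continuous (phi n j).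
Proof.
rewrite (_ : phi n j = (fun x => (2 ^ n * (-1) ^+ j.1) *: (x + nvec j.2))).
  exact: continuous_affine.
by apply/funext => x; rewrite phiE.
Qed.

Lemma closed_tile n j : closed (tile n j).
Proof.
rewrite /tile (_ : phi n j = (fun x => (2 ^ n * (-1) ^+ j.1) *: (x + nvec j.2))).
  by apply: closed_affine; [exact: phi_coef_neq0|exact: closed_gasket].
by apply/funext => x; rewrite phiE.
Qed.

Lemma exp2zS n : (2 : R) ^ (n + 1) = 2 * 2 ^ n.
Proof. by rewrite expfzDr// expr1z mulrC. Qed.

Lemma phi_F n j i x : phi (n + 1) j (F i x) = phi n (sub j i) x.
Proof.
rewrite !phiE /sub/= nvec_dbl exp2zS -mulrA mulrC.
rewrite -[LHS]scalerA; congr (_ *: _); apply: coord_inj;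
  rewrite ?(csD, csZ, ctD, ctZ, cs_F, ct_F, cs_corner, ct_corner); lra.
Qed.

Lemma tileS n j : tile (n + 1) j = \bigcup_i tile n (sub j i).
Proof.
apply/seteqP; split=> [_ [x /gasketP[i [y [gy ->]]] <-]|_ [i _ [y gy <-]]].
  by exists i => //; exists y; rewrite -?phi_F.
by exists (F i y); [exact: F_gasket|rewrite phi_F].
Qed.

Lemma phi_tau n j x : phi n j x = 2 ^ n *: phi 0 j x.
Proof. by rewrite phi0. Qed.

Lemma isomsE : @isoms R = tau @` JL.
Proof.
have tauE w x : 2 ^+ size w *: F_word w x = x + nvec (latw w) :> plane R.
  by rewrite F_wordE scalerA divff ?scale1r// expf_neq0.
apply/seteqP; split=> [t [w [->|->]]|_ [[e a] [w _ /= wa] <-]].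
- exists (false, latw w); first by exists w.
  by apply/funext => x; rewrite tauE /tau scale1r.
- exists (true, latw w); first by exists w.
  by apply/funext => x; rewrite tauE /tau scaleN1r.
- exists w; case: e; [right|left]; apply/funext => x;
    by rewrite tauE wa /tau/= ?scaleN1r ?scale1r.
Qed.

(** The image of the origin gives the vector once the signs agree; the images of the origin and of
    (1, 0) together exclude opposite signs. *)
Lemma tau_index_inj j k : tau j = tau k -> j = k.
Proof.
move=> jk.
have h x : tau j x = tau k x by rewrite jk.
have := congr1 cs (h (vec 0 0)); have := congr1 ct (h (vec 0 0)).
have := congr1 cs (h (vec 1 0)).
rewrite !cs_tau !ct_tau !cs_vec !ct_vec.
have natr_inj (m p : nat) : m%:R = p%:R :> R -> m = p.
  by move=> /eqP; rewrite eqr_nat => /eqP.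
case: j k {jk h} => [e [a b]] [f [c d]] /=.
have [<-|] := eqVneq e f.
  have s0 := negbT (signr_eq0 R e).
  move=> /(mulfI s0) _ /(mulfI s0) h1 /(mulfI s0) h2.
  have /natr_inj -> : a%:R = c%:R :> R by exact: (addrI _ h2).
  by have /natr_inj -> : b%:R = d%:R :> R by exact: (addrI _ h1).
by case: e; case: f => // _; rewrite !(expr0, expr1) !(mul1r, mulN1r) => *; exfalso; lra.
Qed.

Lemma dyadic_triangleP (A : set (plane R)) :
  dyadic_triangle A <-> exists n j, JL j /\ A = tile n j.
Proof.
split=> [[n [t [+ ->]]]|[n [j [Lj ->]]]].
  rewrite isomsE => -[j Lj <-]; exists n, j; split=> //.
  by rewrite /tile image_comp.
by exists n, (tau j); rewrite isomsE /tile image_comp; split=> //; exists j.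
Qed.

Definition tiling n : set (plane R) := \bigcup_(j in JL) tile n j.

Lemma tilingS n : tiling (n + 1) = tiling n.
Proof.
apply/seteqP; split=> x [j Lj].
  by rewrite tileS => -[i _ tx]; exists (sub j i) => //; exact: JL_sub.
have [b [i [Lb ->]]] := JLP Lj => tx; exists b => //.
by rewrite tileS; exists i.
Qed.

Lemma tilingE n : tiling n = tiling 0.
Proof.
elim/int_rect: n => [//|n IH|n IH].
  by rewrite -[n.+1]addn1 PoszD tilingS.
by rewrite -IH -tilingS -addn1 PoszD opprD subrK.
Qed.

(** The pieces 2^k(gasket) and -2^k(gasket) are the two tiles of size 2^k with vector (0, 0).
    Conversely, the unit tile of a word w lies in such a piece for k = |w|. *)
Lemma inf_gasketE n : inf_gasket = tiling n.
Proof.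
rewrite tilingE; apply/seteqP; split=> [x [k _ [y gy <-]]|_ [j Lj [x gx <-]]].
  rewrite -(tilingE k); case: gy => [gy|[z gz <-]].
    exists (false, (0, 0))%N; first exact: Lam0.
    exists y => //; rewrite phiE mulr1; congr (_ *: _).
    by apply: coord_inj; rewrite ?csD ?ctD ?cs_vec ?ct_vec addr0.
  exists (true, (0, 0))%N; first exact: Lam0.
  exists z => //; rewrite phiE mulrN1 scaleNr -scalerN; congr (_ *: - _).
  by apply: coord_inj; rewrite ?csD ?ctD ?cs_vec ?ct_vec addr0.
case: j Lj => e a [w _ /= <-]; exists (size w) => //.
have gw : gasket (F_word w x : plane R) by exact: F_word_gasket.
exists ((-1) ^+ e *: F_word w x); last first.
  rewrite F_wordE phiE expr0z mul1r !scalerA/=; congr (_ *: _).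
  by rewrite mulrAC divff ?expf_neq0 ?mul1r.
by case: e; [right; exists (F_word w x); rewrite ?scaleN1r|left; rewrite scale1r].
Qed.

Lemma tile_inf_gasket n j : JL j -> tile n j `<=` inf_gasket.
Proof. by move=> Lj x tx; rewrite (inf_gasketE n); exists j. Qed.

Lemma inf_gasket_scale n x : inf_gasket x -> inf_gasket (2 ^ n *: x : plane R).
Proof.
rewrite {1}(inf_gasketE 0) => -[j Lj [y gy <-]]; rewrite -phi_tau.
by apply: (tile_inf_gasket (n := n) Lj); exists y.
Qed.

Lemma natr_lt_succ (a b : nat) : (a < b)%N -> a%:R + 1 <= b%:R :> R.
Proof. by move=> ab; rewrite natr1 ler_nat. Qed.

(** With opposite signs, nonnegative coordinates equal their negatives and all vanish. With equal
    signs the vectors differ by at least 1 in some coordinate, and unit triangles that far apart can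
    share corners only. *)
Lemma tau_meet j k x y : j <> k -> triangle x -> triangle y ->
  tau j x = tau k y -> range corner x /\ range corner y.
Proof.
case: j k => [e [a b]] [f [c d]] jk [x1 x2 x3] [y1 y2 y3] xy.
have := congr1 cs xy; have := congr1 ct xy; rewrite !cs_tau !ct_tau /=.
have jk' : e = f -> a = c -> b = d -> False by move=> ef ac bd; apply: jk; rewrite ef ac bd.
clear jk xy.
have a0 := ler0n R a; have b0 := ler0n R b.
have c0 := ler0n R c; have d0 := ler0n R d.
suff main : (-1) ^+ e * (ct x + b%:R) = (-1) ^+ f * (ct y + d%:R) ->
   (-1) ^+ e * (cs x + a%:R) = (-1) ^+ f * (cs y + c%:R) ->
   (exists i, cs x = es i /\ ct x = et i) /\ (exists i, cs y = es i /\ ct y = et i).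
  move=> /main /[apply] -[[i [? ?]] [k [? ?]]]; split; [exists i|exists k] => //;
    by apply: coord_inj; rewrite ?cs_corner ?ct_corner.
have [ef|ef] := eqVneq e f; last first.
  move=> E1 E2; suff [? ? ? ?] : [/\ cs x = 0, ct x = 0, cs y = 0 & ct y = 0].
    by split; exists i0.
  by move: ef E1 E2; case: e {jk'}; case: f => // _;
    rewrite !(expr0, expr1) !(mul1r, mulN1r) => *; split; lra.
rewrite -ef => /(mulfI (negbT (signr_eq0 _ _))) E2 /(mulfI (negbT (signr_eq0 _ _))) E1.
have E i : i = i0 \/ i = i1 \/ i = i2 by elim/ord3P: i; tauto.
have corn (z : plane R) : (cs z = 0 /\ ct z = 0) \/ (cs z = 1 /\ ct z = 0)
   \/ (cs z = 0 /\ ct z = 1) -> exists i, cs z = es i /\ ct z = et i.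
  by move=> [|[|]]; [exists i0|exists i1|exists i2].
suff [] : ((cs x = 0 /\ ct x = 0) \/ (cs x = 1 /\ ct x = 0)
   \/ (cs x = 0 /\ ct x = 1)) /\ ((cs y = 0 /\ ct y = 0) \/ (cs y = 1 /\ ct y = 0)
   \/ (cs y = 0 /\ ct y = 1)) by split; exact: corn.
case: (ssrnat.ltngtP a c) => [/natr_lt_succ ac|/natr_lt_succ ac|ac].
- case: (ssrnat.ltngtP b d) => [/natr_lt_succ bd|/natr_lt_succ bd|bd]; last 1 first.
  + by subst d; split; [right; left|left]; split; lra.
  + by exfalso; lra.
  + by split; [right; left|right; right]; split; lra.
- case: (ssrnat.ltngtP b d) => [/natr_lt_succ bd|/natr_lt_succ bd|bd]; last 1 first.
  + by subst d; split; [left|right; left]; split; lra.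
  + by split; [right; right|right; left]; split; lra.
  + by exfalso; lra.
- subst c; case: (ssrnat.ltngtP b d) => [/natr_lt_succ bd|/natr_lt_succ bd|bd].
  + by split; [right; right|left]; split; lra.
  + by split; [left|right; right]; split; lra.
  + by case: jk'.
Qed.

(** Equal parities push distinct vectors at least 2 apart in a coordinate, while a unit triangle has
    width 1. *)
Lemma tau_color j k x y : color j = color k -> triangle x -> triangle y ->
  tau j x = tau k y -> j = k.
Proof.
case: j k => [e [a b]] [f [c d]] [/= <- ac bd] [x1 x2 x3] [y1 y2 y3] xy.
have := congr1 cs xy; have := congr1 ct xy; rewrite !cs_tau !ct_tau /=.
move=> /(mulfI (negbT (signr_eq0 _ _))) E2 /(mulfI (negbT (signr_eq0 _ _))) E1.
have par (m p : nat) : odd m = odd p -> (m < p)%N -> m%:R + 2 <= p%:R :> R.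
  by move=> mp mltp; rewrite -natrD ler_nat; lia.
have := (par _ _ ac, par _ _ (esym ac)); have := (par _ _ bd, par _ _ (esym bd)).
clear xy ac bd par => -[bd db] [ac ca]; congr (_, (_, _)).
- by case: (ssrnat.ltngtP a c) => [/ac ?|/ca ?|//]; exfalso; lra.
- by case: (ssrnat.ltngtP b d) => [/bd ?|/db ?|//]; exfalso; lra.
Qed.

Lemma tile_color n j k : color j = color k -> tile n j `&` tile n k !=set0 ->
  j = k.
Proof.
move=> jk [_ [[x gx <-] [y gy /(scalerI (exp2z_neq0 n)) yx]]].
by apply: (tau_color jk _ _ (esym yx)); exact: gasket_triangle.
Qed.

(* The three inequalities define the open half-planes whose boundary lines meet
   the tile in one corner only. *)
Lemma unit_tile_nbhs (e : bool) (a b : nat) x : inf_gasket (x : plane R) ->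
  let y := (-1) ^+ e *: x in
  cs y < a%:R + 1 -> ct y < b%:R + 1 -> a%:R + b%:R < cs y + ct y ->
  tile 0 (e, (a, b)) x.
Proof.
rewrite (inf_gasketE 0) => -[[f [c d]] Lj [z gz <-]] /=.
rewrite phi0; have [z1 z2 z3] := gasket_triangle gz.
rewrite csZ ctZ cs_tau ct_tau !mulrA -!exprD/=.
have a0 := ler0n R a; have b0 := ler0n R b.
have c0 := ler0n R c; have d0 := ler0n R d.
have [<-|] := eqVneq e f; last first.
  by case: e; case: f {Lj} => // _; rewrite -?exprD !(expr0, expr1, mulNr, mul1r, mulN1r, mulrN, opprK) => *; exfalso; lra.
rewrite addnn -signr_odd odd_double expr0 !mul1r => h1 h2 h3.
(* For integers the three strict inequalities become c <= a, d <= b and a + b <= c + d, which force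
   equality. *)
have ca : (c <= a)%N.
  by rewrite leqNgt; apply/negP => /natr_lt_succ ?; lra.
have db : (d <= b)%N.
  by rewrite leqNgt; apply/negP => /natr_lt_succ ?; lra.
have abcd : ~~ (c + d < a + b)%N.
  by apply/negP => /natr_lt_succ; rewrite !natrD => ?; lra.
have [-> ->] : a = c /\ b = d by clear - ca db abcd; split; lia.
by exists z; rewrite // phi0.
Qed.

Lemma eucl_distE x y : eucl_dist x y =
  Num.sqrt ((cs x - cs y) ^+ 2 + (cs x - cs y) * (ct x - ct y) + (ct x - ct y) ^+ 2).
Proof.
have s3 : (Num.sqrt 3 / 2) ^+ 2 = 3 / 4 :> R by rewrite expr_div_n sqr_sqrtr//; lra.
rewrite /eucl_dist !fst_coord !snd_coord; congr Num.sqrt.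
by rewrite -mulrBl [(_ * (Num.sqrt 3 / 2)) ^+ 2]exprMn s3; field.
Qed.

Lemma diam_tile n j : diam (tile n j) = 2 ^ n.
Proof.
have p0 := exp2z_gt0 n.
have dE x y : eucl_dist (phi n j x) (phi n j y) = 2 ^ n * eucl_dist x y.
  rewrite !eucl_distE !phiE !csZ !ctZ !csD !ctD.
  rewrite -[2 ^ n in RHS]gtr0_norm// -sqrtr_sqr -sqrtrM ?sqr_ge0//.
  congr Num.sqrt.
  have -> : ((2 : R) ^ n) ^+ 2 = (2 ^ n * (-1) ^+ j.1) ^+ 2.
    by rewrite exprMn sqrr_sign mulr1.
  ring.
rewrite /diam; apply/eqP; rewrite eq_le; apply/andP; split.
  apply: ge_sup.
    exists (eucl_dist (phi n j (corner i0)) (phi n j (corner i0))).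
    by exists (phi n j (corner i0)); [|exists (phi n j (corner i0))] => //;
       exists (corner i0) => //; exact: corner_gasket.
  move=> _ [_ [x gx <-] [_ [y gy <-] <-]]; rewrite dE ler_piMr ?(ltW p0)//.
  rewrite eucl_distE -[leRHS]sqrtr1 ler_wsqrtr//.
  have [x1 x2 x3] := gasket_triangle gx; have [y1 y2 y3] := gasket_triangle gy.
  set s := cs x - cs y; set t := ct x - ct y.
  have s1 : -1 <= s <= 1 by rewrite /s; lra.
  have t1 : -1 <= t <= 1 by rewrite /t; lra.
  have st1 : -1 <= s + t <= 1 by rewrite /s /t; lra.
  (* If s and t have the same sign, the form is at most (s + t)^2; otherwise it is at most the
     larger of s^2 and t^2. *)
  have [?|?] := leP 0 s; have [?|?] := leP 0 t; nra.
apply: ub_le_sup; last first.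
  exists (phi n j (corner i1)); first by exists (corner i1) => //; exact: corner_gasket.
  exists (phi n j (corner i0)); first by exists (corner i0) => //; exact: corner_gasket.
  rewrite dE eucl_distE !cs_corner !ct_corner /es /et/= !subr0 expr1n mulr0 expr0n/=.
  by rewrite !addr0 sqrtr1 mulr1.
exists (2 ^ n) => _ [_ [x gx <-] [_ [y gy <-] <-]]; rewrite dE ler_piMr ?(ltW p0)//.
rewrite eucl_distE -[leRHS]sqrtr1 ler_wsqrtr//.
have [x1 x2 x3] := gasket_triangle gx; have [y1 y2 y3] := gasket_triangle gy.
set s := cs x - cs y; set t := ct x - ct y.
have s1 : -1 <= s <= 1 by rewrite /s; lra.
have t1 : -1 <= t <= 1 by rewrite /t; lra.
have st1 : -1 <= s + t <= 1 by rewrite /s /t; lra.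
have [?|?] := leP 0 s; have [?|?] := leP 0 t; nra.
Qed.

End Tiles.

(** * Energies *)

Lemma within_continuousP (R : realType) (A : set (plane R)) (u : plane R -> R) :
  {within A, continuous u} <->
  forall x, A x -> forall e : R, 0 < e -> \forall y \near x, A y -> `|u x - u y| < e.
Proof.
rewrite subspace_continuousP; split=> cu x Ax.
  by move=> e e0; have /cvgrPdist_lt /(_ e e0) := cu x Ax.
by apply/cvgrPdist_lt => e e0; exact: cu x Ax e e0.
Qed.

Lemma fsbig_finType (S : Type) (idx0 : S) (op : Monoid.com_law idx0) (T : finType)
    (f : T -> S) :
  \big[op/idx0]_(i \in [set: T]) f i = \big[op/idx0]_i f i.
Proof.
rewrite (fsbigE (enum T)) ?enum_uniq//; last by move=> x _; rewrite mem_enum.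
by rewrite big_enum_cond; apply: eq_bigl => x; rewrite in_setT.
Qed.

Section Energy.
Context {R : realType}.
Implicit Types (u v : plane R -> R) (m : nat) (i j : 'I_3).

Definition sqdiff u (e : plane R * plane R) : R := (u e.1 - u e.2) ^+ 2.

Definition Fpair i (e : plane R * plane R) : plane R * plane R := (F i e.1, F i e.2).

Lemma corner_inj : injective (@corner R).
Proof.
move=> i j ij; have := congr1 cs ij; have := congr1 ct ij.
rewrite !ct_corner !cs_corner /es /et; clear ij.
by elim/ord3P: i; elim/ord3P: j => //= h1 h2; exfalso; lra.
Qed.

Lemma edges_triangle m (e : plane R * plane R) : edges m e -> triangle e.1 /\ triangle e.2.
Proof.
have h w x : V0 x -> triangle (F_word w x : plane R).
  move=> [i _ <-]; elim: w => [|k w IH]; first exact: corner_triangle.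
  by apply: (@F_triangle _ k); exists (F_word w (corner i)).
by move=> [_ [w [_ [x Vx <-] [y Vy <-]]]]; split; exact: h.
Qed.

Lemma edgesS m : @edges R m.+1 =
  Fpair i0 @` edges m `|` Fpair i1 @` edges m `|` Fpair i2 @` edges m.
Proof.
have FE : @edges R m.+1 = \bigcup_i (Fpair i @` edges m).
  apply/seteqP; split=> [[x y] /= [/= xy [w [sw [a Va ax] [b Vb by_]]]]|].
    case: w sw ax by_ => [//|i w] /= [sw] ax by_.
    exists i => //; exists (F_word w a, F_word w b); last by rewrite /Fpair/= -ax -by_.
    split=> /=; first by move=> ab; apply: xy; rewrite -ax -by_ /= ab.
    by exists w; split=> //; [exists a|exists b].
  move=> _ [i _ [[x y] [/= xy [w [sw [a Va ax] [b Vb by_]]]] <-]].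
  split=> /=; first by move=> /F_inj.
  by exists (i :: w); split; [rewrite /= sw|exists a; rewrite //= ax|exists b; rewrite //= by_].
rewrite FE; apply/seteqP; split=> e.
  by move=> [i _]; elim/ord3P: i; [left; left|left; right|right].
by move=> [[|]|] eF; [exists i0|exists i1|exists i2].
Qed.

Lemma edges0 : @edges R 0 `<=` (fun p => (corner p.1, corner p.2)) @` [set: 'I_3 * 'I_3].
Proof.
by move=> [x y] [/= _ [w [/size0nil -> [_ [i _ <-] /= <-] [_ [j _ <-] /= <-]]]]; exists (i, j).
Qed.

Lemma finite_edges m : finite_set (@edges R m).
Proof.
elim: m => [|m IH]; first exact: sub_finite_set edges0 (finite_image _ _).
by rewrite edgesS !finite_setU; split; [split|]; apply: finite_image.
Qed.

Lemma Fpair_inj i : injective (Fpair i).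
Proof.
move=> [a b] [c d] e; have /F_inj /= -> := congr1 fst e.
by have /F_inj /= -> := congr1 snd e.
Qed.

(** Two half-size cells share a single point, so an edge lying in both would have equal
    endpoints. *)
Lemma Fpair_disjoint m i j e : i != j -> (Fpair i @` edges m) e ->
  (Fpair j @` edges m) e -> False.
Proof.
move=> ij [[a b] Eab <-] [[c d] Ecd e']; have /= ac := congr1 fst e'; have /= bd := congr1 snd e'.
have [ta tb] := edges_triangle Eab; have [tc td] := edges_triangle Ecd.
have [aj _] := F_triangle_meet ij ta tc (esym ac).
have [bj _] := F_triangle_meet ij tb td (esym bd).
by case: Eab => /= + _; apply; move: aj bj => /= -> ->.
Qed.

Lemma energy_approxS m u :
  energy_approx m.+1 u = 5 / 3 * \sum_(i < 3) energy_approx m (u \o F i).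
Proof.
have FE i : \sum_(e \in Fpair i @` edges m) sqdiff u e =
            \sum_(e \in edges m) sqdiff (u \o F i) e.
  by rewrite fsbig_image// => x y _ _; exact: Fpair_inj.
have fin i : finite_set (Fpair i @` edges m) by apply: finite_image; exact: finite_edges.
have d01 : Fpair i0 @` edges m `&` Fpair i1 @` edges m `<=` set0.
  by move=> e [h1 h2]; apply: (Fpair_disjoint _ h1 h2).
have d2 : (Fpair i0 @` edges m `|` Fpair i1 @` edges m) `&` Fpair i2 @` edges m
    `<=` set0.
  by move=> e [[|] h1 h2]; apply: (Fpair_disjoint _ h1 h2).
have fin01 : finite_set (Fpair i0 @` edges m `|` Fpair i1 @` edges m).
  by rewrite finite_setU.
have SE : \sum_(e \in edges m.+1) sqdiff u e =
    \sum_(e \in edges m) sqdiff (u \o F i0) e +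
    \sum_(e \in edges m) sqdiff (u \o F i1) e +
    \sum_(e \in edges m) sqdiff (u \o F i2) e.
  by rewrite edgesS fsbigU0// fsbigU0// !FE.
rewrite sum3E /energy_approx exprS -/(sqdiff u).
transitivity (2^-1 * (5 / 3 * (5 / 3) ^+ m) * \sum_(e \in edges m.+1) sqdiff u e) => //.
rewrite SE /sqdiff/=; ring.
Qed.

Lemma energy_approx0 u : energy_approx 0 u =
  2^-1 * \sum_(i < 3) \sum_(j < 3) (u (corner i) - u (corner j)) ^+ 2.
Proof.
rewrite /energy_approx expr0 mulr1; congr (_ * _).
rewrite -/(sqdiff u) pair_big/= (fsbig_widen _ _ _ edges0); last first.
  move=> _ [[[i j] _ <-] /= nE]; rewrite /sqdiff /=.
  have [->|ij] := eqVneq i j; first by rewrite subrr expr0n.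
  exfalso; apply: nE; split=> [/= /corner_inj|]; first exact/eqP.
  by exists [::]; split=> //; [exists (corner i); [exists i|]|exists (corner j); [exists j|]].
rewrite fsbig_image; last first.
  move=> [i j] [k l] _ _ e; have /corner_inj /= -> := congr1 fst e.
  by have /corner_inj /= -> := congr1 snd e.
exact: fsbig_finType.
Qed.

Lemma F_corner_sym i j : F i (corner j) = F j (corner i) :> plane R.
Proof. by apply: coord_inj; rewrite ?cs_F ?ct_F ?cs_corner ?ct_corner addrC. Qed.

Lemma energy_approx01 u : energy_approx 0 u <= energy_approx 1 u.
Proof.
rewrite energy_approxS sum3E !energy_approx0 !sum3E /= !F_corner.
rewrite (F_corner_sym i1 i0) (F_corner_sym i2 i0) (F_corner_sym i2 i1).
set a := u (corner i0); set b := u (corner i1); set c := u (corner i2).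
set x := u (F i0 (corner i1)); set y := u (F i0 (corner i2)).
set z := u (F i1 (corner i2)).
rewrite -subr_ge0.
(* The minimum over [x, y, z] is attained at the harmonic extension. *)
pose p := x - (2 * a + 2 * b + c) / 5; pose q := y - (2 * a + 2 * c + b) / 5.
pose r := z - (2 * b + 2 * c + a) / 5.
rewrite [X in 0 <= X](_ : _ = 5 / 3 * (2 * (p ^+ 2 + q ^+ 2 + r ^+ 2) +
  ((p - q) ^+ 2 + (p - r) ^+ 2 + (q - r) ^+ 2))); last by rewrite /p /q /r; field.
apply: mulr_ge0; first by rewrite divr_ge0.
by rewrite addr_ge0 ?mulr_ge0// ?addr_ge0// ?addr_ge0// sqr_ge0.
Qed.

Lemma energy_approx_le m u : energy_approx m u <= energy_approx m.+1 u.
Proof.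
elim: m u => [|m IH] u; first exact: energy_approx01.
rewrite energy_approxS [leRHS]energy_approxS ler_wpM2l ?divr_ge0//.
by apply: ler_sum => i _; exact: IH.
Qed.

Lemma energy_approx_ge0 m u : 0 <= energy_approx m u.
Proof.
rewrite /energy_approx mulr_ge0 ?mulr_ge0 ?exprn_ge0 ?divr_ge0//.
by apply: fsumr_ge0 => e _; exact: sqr_ge0.
Qed.

Local Open Scope ereal_scope.

Lemma energy_approx_nondecreasing u :
  nondecreasing_seq (fun m => (energy_approx m u)%:E).
Proof. by apply/nondecreasing_seqP => m; rewrite lee_fin energy_approx_le. Qed.

Lemma energy_cvg u : (energy_approx m u)%:E @[m --> \oo] --> energy u.
Proof. exact: ereal_nondecreasing_is_cvgn (energy_approx_nondecreasing u). Qed.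

Lemma energy_ge m u : (energy_approx m u)%:E <= energy u.
Proof.
rewrite /energy (cvg_lim _ (ereal_nondecreasing_cvgn (energy_approx_nondecreasing u)))//.
by apply: ereal_sup_ubound; exists m.
Qed.

Lemma energy_le u e : (forall m, (energy_approx m u)%:E <= e) -> energy u <= e.
Proof. by move=> ue; apply: lime_le; [exact: energy_cvg|exact: nearW]. Qed.

Lemma energy_ge0 u : 0 <= energy u.
Proof. by apply: le_trans (energy_ge 0 u); rewrite lee_fin energy_approx_ge0. Qed.

Lemma energy_self u : energy u = (5 / 3)%:E * \sum_(i < 3) energy (u \o F i).
Proof.
have h := @energy_cvg u; rewrite -cvg_shiftS in h.
apply: (cvg_unique _ h) => //; rewrite sum3E.
rewrite [X in X @ _](_ : _ = (fun m => (5 / 3)%:E *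
  ((energy_approx m (u \o F i0))%:E + (energy_approx m (u \o F i1))%:E +
   (energy_approx m (u \o F i2))%:E))); last first.
  by apply/funext => m /=; rewrite energy_approxS sum3E -!EFinD -EFinM.
apply: cvgeZl => //; apply: cvgeD; last exact: energy_cvg.
  by rewrite ge0_adde_def ?inE ?adde_ge0 ?energy_ge0.
by apply: cvgeD; rewrite ?ge0_adde_def ?inE ?energy_ge0//; exact: energy_cvg.
Qed.

Lemma edges_gasket m (e : plane R * plane R) : edges m e -> gasket e.1 /\ gasket e.2.
Proof.
have h w x : V0 x -> gasket (F_word w x : plane R).
  by move=> [i _ <-]; apply: F_word_gasket; exact: corner_gasket.
by move=> [_ [w [_ [x Vx <-] [y Vy <-]]]]; split; exact: h.
Qed.

Lemma eq_energy_approx m u v : {in @gasket R, u =1 v} ->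
  energy_approx m u = energy_approx m v.
Proof.
move=> uv; rewrite /energy_approx; congr (_ * _)%R; apply: eq_fsbigr => e.
by rewrite inE => /edges_gasket[g1 g2]; rewrite !uv ?inE.
Qed.

Lemma eq_energy u v : {in @gasket R, u =1 v} -> energy u = energy v.
Proof.
move=> uv; rewrite /energy.
suff -> : (fun m => (energy_approx m u)%:E) = (fun m => (energy_approx m v)%:E) by [].
by apply/funext => m; rewrite (eq_energy_approx m uv).
Qed.

Lemma energy_cst k : energy (fun _ : plane R => k) = 0.
Proof.
apply/eqP; rewrite eq_le energy_ge0 andbT; apply: energy_le => m.
rewrite lee_fin /energy_approx fsbig1 ?mulr0// => e _.
by rewrite subrr expr0n.
Qed.

Lemma energy_approxD m u v : (energy_approx m (u \+ v)%R <=
  2 * energy_approx m u + 2 * energy_approx m v)%R.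
Proof.
rewrite /energy_approx; set c := (_ * _ ^+ m)%R.
rewrite [leRHS](_ : _ = c * (2 * (\sum_(e \in edges m) (u e.1 - u e.2) ^+ 2) +
  2 * \sum_(e \in edges m) (v e.1 - v e.2) ^+ 2))%R; last by ring.
rewrite ler_wpM2l ?mulr_ge0 ?exprn_ge0 ?divr_ge0//.
rewrite !(fsbig_finite _ _ (finite_edges m)) !mulr_sumr -big_split/=.
apply: ler_sum => e _.
set a := u _; set b := u _; set a' := v _; set b' := v _.
have := sqr_ge0 (a - b - (a' - b')); nra.
Qed.

Lemma energyD u v : energy (u \+ v)%R <= 2%:E * energy u + 2%:E * energy v.
Proof.
apply: energy_le => m; apply: (@le_trans _ _
  (2 * energy_approx m u + 2 * energy_approx m v)%:E).
  by rewrite lee_fin energy_approxD.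
by rewrite EFinD !EFinM leeD// lee_pmul2l// energy_ge.
Qed.

Local Close Scope ereal_scope.

(* The constant [B = 8] satisfies [r B + 1 + r <= B] for [r = sqrt (3 / 5) <= 7 / 9]. *)
Lemma Vstar_osc k u (e : R) : 0 <= e -> (forall m, energy_approx m u <= e ^+ 2) ->
  forall x, V k x -> `|u x - u (corner i0)| <= 8 * e.
Proof.
move=> + + x Vx; have : exists k, V k x by exists k.
move=> {Vx k} [k Vk].
have edge m v i j (c : R) : 0 <= c -> energy_approx 0 v <= c ^+ 2 ->
    `|v (corner i) - v (corner j)| <= c.
  move=> c0 vc; rewrite -ler_sqr ?nnegrE// -normrX ger0_norm ?sqr_ge0//.
  apply: le_trans vc; rewrite energy_approx0 !sum3E; clear.
  elim/ord3P: i; elim/ord3P: j; set a := v _; set b := v _; set d := v _;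
  have := sqr_ge0 (a - b); have := sqr_ge0 (a - d); have := sqr_ge0 (b - d); nra.
elim: k x Vk u e => [_ [i _ <-]|k IH _ [i _ [y Vy <-]]] u e e0 ue.
  apply: le_trans (edge 0 u i i0 e e0 (ue 0)) _; lra.
pose r : R := Num.sqrt (3 / 5).
have r0 : 0 <= r by exact: sqrtr_ge0.
have r2 : r ^+ 2 = 3 / 5 by rewrite sqr_sqrtr.
have r1 : r <= 7 / 9.
  by rewrite -ler_sqr ?nnegrE// r2; lra.
(* The three cells share 3/5 of the next-level energy, so each of them allows an amplitude smaller
   by the factor [r]. *)
have ueF j m : energy_approx m (u \o F j) <= (r * e) ^+ 2.
  have := ue m.+1; rewrite energy_approxS exprMn r2.
  have h := energy_approx_ge0 m.
  have := h (u \o F i0); have := h (u \o F i1); have := h (u \o F i2).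
  by elim/ord3P: j; rewrite sum3E; lra.
have re0 : 0 <= r * e by rewrite mulr_ge0.
(* The route from [F i y] to [corner i0] passes through [F i (corner i0)] and [corner i]; its legs
   cost 8 r e, r e and e. *)
have h1 := IH _ Vy (u \o F i) _ re0 (ueF i).
have h2 := edge 0 (u \o F i) i0 i _ re0 (ueF i 0).
have h3 := edge 0 u i i0 e e0 (ue 0).
rewrite /= F_corner in h1 h2.
have re : r * e <= 7 / 9 * e by rewrite ler_wpM2r.
move: h1 h2 h3; rewrite !ler_norml.
set a := u (F i y); set b := u (F i (corner i0)); set c := u (corner i).
set d := u (corner i0) => /andP[? ?] /andP[? ?] /andP[? ?].
by apply/andP; split; lra.
Qed.

(** The vertices are dense and u is continuous, so the bound of [Vstar_osc] extends to the gasket.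
    Going through [corner i0] doubles 8 to 16. *)
Lemma gasket_osc u (e : R) : {within @gasket R, continuous u} -> 0 <= e ->
  (energy u <= (e ^+ 2)%:E)%E ->
  forall x y, gasket x -> gasket y -> `|u x - u y| <= 16 * e.
Proof.
move=> cu e0 ue.
have um m : energy_approx m u <= e ^+ 2.
  by rewrite -lee_fin; exact: le_trans (energy_ge m u) ue.
suff h x : gasket x -> `|u x - u (corner i0)| <= 8 * e.
  move=> x y /h hx /h hy; apply: le_trans (ler_distD (u (corner i0)) _ _) _.
  by rewrite [X in _ + X]distrC; lra.
move=> gx; apply/ler_addgt0Pl => d d0.
have [y [[k _ Vy] /= hy]] := gx _ ((within_continuousP _ _).1 cu x gx d d0).
have {}hy := hy (V_gasket Vy).
have := Vstar_osc e0 um Vy.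
move: hy; rewrite !ler_norml ltr_norml => /andP[h3 h4] /andP[h1 h2].
by apply/andP; split; lra.
Qed.

End Energy.

Lemma esumZl (R : realType) (T : choiceType) (I : set T) (a : T -> \bar R) (r : R) :
  0 <= r -> (forall i, (0 <= a i)%E) ->
  (\esum_(i in I) (r%:E * a i) = r%:E * \esum_(i in I) a i)%E.
Proof.
rewrite le_eqVlt => /predU1P[<- _|r0 a0].
  by rewrite mul0e esum1// => i _; rewrite mul0e.
have le_ (b : T -> \bar R) (s : R) : (0 < s)%R -> (forall i, (0 <= b i)%E) ->
    (\esum_(i in I) (s%:E * b i) <= s%:E * \esum_(i in I) b i)%E.
  move=> s0 b0; apply: ge_ereal_sup => _ [X [finX XI] <-].
  rewrite fsbig_finite// -ge0_sume_distrr// lee_pmul2l ?lte_fin//.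
  by apply: esum_ge; exists X; rewrite ?fsbig_finite.
apply/eqP; rewrite eq_le le_//= -(@lee_pmul2l _ r^-1%:E) ?lte_fin ?invr_gt0//.
rewrite muleA -EFinM mulVf ?gt_eqF// mul1e.
apply: le_trans (le_ _ _ _ _) => //; last 2 first.
- by rewrite invr_gt0.
- by move=> i; rewrite mule_ge0// lee_fin ltW.
by apply: le_esum => i _; rewrite muleA -EFinM mulVf ?gt_eqF// mul1e.
Qed.

Section InfEnergy.
Context {R : realType}.
Implicit Types (u v : plane R -> R) (n : int) (j : idx).

(** Every index has exactly one parent ([JLP], [sub_inj]), so the sum can be regrouped by
    parents. *)
Lemma esum_sub (a : idx -> \bar R) : (forall j, 0 <= a j)%E ->
  (\esum_(k in JL) a k = \sum_(i < 3) \esum_(j in JL) a (sub j i))%E.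
Proof.
move=> a0; rewrite -esum_sum//.
transitivity (\esum_(j in JL) \esum_(i in [set: 'I_3]) a (sub j i))%E; last first.
  apply: eq_esum => j _; rewrite esum_fset//; last exact: finite_finset.
  exact: fsbig_finType.
rewrite esum_esum//; apply: reindex_esum; split.
- by move=> [j i] [/= Lj _]; exact: JL_sub.
- by move=> [j i] [k l] _ _ /= /sub_inj[-> ->].
- by move=> k /JLP[b [i [Lb ->]]]; exists (b, i).
Qed.

Definition tile_energy n u : \bar R := (\esum_(j in JL) energy (u \o phi n j))%E.

Lemma tile_energyS n u : tile_energy (n + 1) u = ((5 / 3)%:E * tile_energy n u)%E.
Proof.
rewrite /tile_energy -esumZl//; last by move=> j; exact: energy_ge0.
rewrite [RHS]esum_sub; last by move=> j; rewrite mule_ge0 ?energy_ge0.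
rewrite -esum_sum; last by move=> j i _ _; rewrite mule_ge0 ?energy_ge0.
apply: eq_esum => j _; rewrite energy_self.
rewrite ge0_sume_distrr; last by move=> i _; exact: energy_ge0.
apply: eq_bigr => i _; congr (_ * energy _)%E.
by apply/funext => x /=; rewrite phi_F.
Qed.

Lemma inf_energyE u : inf_energy u = tile_energy 0 u.
Proof.
rewrite /inf_energy isomsE esum_image; last by move=> j k _ _; exact: tau_index_inj.
by apply: eq_esum => j _; rewrite phi0.
Qed.

(** Each doubling of the tiles costs one factor 5/3 by [energy_self]. This is the source of
    (5/3)^(n/2) in the oscillation bounds. *)
Lemma tile_energyE n u : tile_energy n u = (((5 / 3) ^ n)%:E * inf_energy u)%E.
Proof.
have r0 : (5 / 3 : R) != 0 by rewrite gt_eqF// divr_gt0.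
have := tile_energyS^~ u; move: (5 / 3) r0 => r r0 S.
rewrite inf_energyE; elim/int_rect: n => [|n IH|n IH].
- by rewrite expr0z mul1e.
- rewrite -addn1 PoszD S IH muleA -EFinM; congr (_%:E * _)%E.
  by rewrite expfzDr// expr1z mulrC.
- have := S (- (n.+1)%:Z); rewrite -addn1 PoszD opprD subrK IH => E.
  have -> : r ^ (- n%:Z - 1) = r^-1 * r ^ (- n%:Z) by rewrite expfzDr// exprN1 mulrC.
  transitivity ((r^-1)%:E * (r%:E * tile_energy (- n%:Z - 1) u))%E.
    by rewrite muleA -EFinM (mulVf r0) mul1e.
  by rewrite -E muleA -EFinM.
Qed.

Lemma inf_energy_ge0 u : (0 <= inf_energy u)%E.
Proof. by apply: esum_ge0 => t _; exact: energy_ge0. Qed.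

Lemma energy_tile_le n j u : JL j ->
  (energy (u \o phi n j) <= ((5 / 3) ^ n)%:E * inf_energy u)%E.
Proof.
move=> Lj; rewrite -tile_energyE; apply: esum_ge; exists [set j].
  by split => // _ ->.
by rewrite fsbig_set1.
Qed.

Lemma inf_energy_cst k : inf_energy (fun _ : plane R => k) = 0%E.
Proof. by rewrite inf_energyE; apply: esum1 => j _; exact: energy_cst. Qed.

Lemma inf_energyD u v :
  (inf_energy (u \+ v)%R <= 2%:E * inf_energy u + 2%:E * inf_energy v)%E.
Proof.
have e0 w j : (0 <= 2%:E * energy (w \o phi 0 j))%E by rewrite mule_ge0 ?energy_ge0.
rewrite !inf_energyE /tile_energy -!esumZl// ; do ?by move=> j; exact: energy_ge0.
rewrite -esumD//; apply: le_esum => j _; exact: energyD.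
Qed.

Lemma phi_within n j u : JL j -> {within inf_gasket, continuous u} ->
  {within gasket, continuous (u \o phi n j)}.
Proof.
move=> Lj /within_continuousP cu; apply/within_continuousP => x gx e e0.
have px (y : plane R) : gasket y -> inf_gasket (phi n j y).
  by move=> gy; apply: (tile_inf_gasket (n := n) Lj); exists y.
have /(phi_continuous (n := n) (j := j)) N := cu _ (px x gx) e e0.
by apply: (@filterS _ (nbhs x) _ _ _ _ N) => y /= h /px; exact: h.
Qed.

(* A bound for the oscillation of [u] on the tile, see [tile_oscP]. *)
Definition tile_osc n j u : R := 16 * Num.sqrt (fine (energy (u \o phi n j))).

Lemma tile_osc_ge0 n j u : 0 <= tile_osc n j u.
Proof. by rewrite mulr_ge0// sqrtr_ge0. Qed.

Lemma energy_tile_lty n j u : JL j -> (inf_energy u < +oo)%E ->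
  (energy (u \o phi n j) < +oo)%E.
Proof.
move=> Lj uoo; apply: le_lt_trans (energy_tile_le n u Lj) _.
by rewrite lte_mul_pinfty// lee_fin exprz_ge0// divr_ge0.
Qed.

Lemma tile_oscP n j u : JL j -> {within inf_gasket, continuous u} ->
  (inf_energy u < +oo)%E -> forall x y, tile n j x -> tile n j y ->
  `|u x - u y| <= tile_osc n j u.
Proof.
move=> Lj cu uoo _ _ [x gx <-] [y gy <-].
apply: (gasket_osc (u := u \o phi n j)) => //; first exact: phi_within.
have := energy_tile_lty n Lj uoo; have := energy_ge0 (u \o phi n j).
by case: (energy _) => //= r r0 _; rewrite sqr_sqrtr.
Qed.

Lemma tile_osc_sq n j u : JL j -> (inf_energy u < +oo)%E ->
  ((tile_osc n j u ^+ 2)%:E = (16 ^+ 2)%:E * energy (u \o phi n j))%E.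
Proof.
move=> Lj uoo; rewrite /tile_osc exprMn EFinM.
have := energy_tile_lty n Lj uoo; have := energy_ge0 (u \o phi n j).
by case: (energy _) => //= r r0 _; rewrite sqr_sqrtr.
Qed.

Lemma tile_osc_le n j u : JL j -> (inf_energy u < +oo)%E ->
  tile_osc n j u <= 16 * Num.sqrt ((5 / 3) ^ n * fine (inf_energy u)).
Proof.
move=> Lj uoo; rewrite /tile_osc ler_pM2l// ler_wsqrtr//.
have := energy_tile_le n u Lj; have := energy_ge0 (u \o phi n j).
have := energy_tile_lty n Lj uoo; have := inf_energy_ge0 u; move: uoo.
by case: (inf_energy u) => // r _ _; case: (energy _).
Qed.

Lemma energy_approx_cvg m (u_ : nat -> plane R -> R) u :
  (forall x, gasket x -> u_ k x @[k --> \oo] --> u x) ->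
  energy_approx m (u_ k) @[k --> \oo] --> energy_approx m u.
Proof.
move=> uu.
pose X := finmap.enum_fset (fset_set (@edges R m)).
have E v : energy_approx m v =
    2^-1 * (5 / 3) ^+ m * \sum_(e <- X | e \in X) (v e.1 - v e.2) * (v e.1 - v e.2).
  by rewrite /energy_approx (fsbig_finite _ _ (finite_edges m)) big_seq.
rewrite E [X in X @ _ --> _](_ : _ = fun k => 2^-1 * (5 / 3) ^+ m *
  \sum_(e <- X | e \in X) (u_ k e.1 - u_ k e.2) * (u_ k e.1 - u_ k e.2)); last by apply/funext => k.
apply: cvgM; first exact: cvg_cst.
apply: cvg_big; first exact: add_continuous.
move=> e; rewrite /X in_fset_set; last exact: finite_edges.
rewrite inE => /edges_gasket[g1 g2].
by apply: cvgM; apply: cvgB; exact: uu.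
Qed.

(** Lower semicontinuity: finitely many tiles at a finite level give a finite sum of squared
    differences, which is continuous under pointwise convergence, and the energy is the supremum of
    such sums. *)
Lemma inf_energy_fatou (u_ : nat -> plane R -> R) u (M : \bar R) :
  (forall x, inf_gasket x -> u_ k x @[k --> \oo] --> u x) ->
  (\forall k \near \oo, (inf_energy (u_ k) <= M)%E) -> (inf_energy u <= M)%E.
Proof.
move=> uu uM; rewrite inf_energyE; apply: ge_ereal_sup => _ [X [finX XL] <-].
rewrite fsbig_finite//=; set s := finmap.enum_fset (fset_set X).
have sg j x : j \in s -> gasket x -> inf_gasket (phi 0 j x).
  rewrite /s in_fset_set// inE => /XL Lj gx.
  by apply: (tile_inf_gasket (n := 0) Lj); exists x.
have h m : (\sum_(j <- s) (energy_approx m (u \o phi 0 j))%:E <= M)%E.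
  rewrite sumEFin; apply: (@cvge_to_le _ \oo _ _ (fun k =>
     (\sum_(j <- s) energy_approx m (u_ k \o phi 0 j))%:E)).
    apply: cvg_EFin; first by apply: nearW.
    rewrite big_seq [X in X @ _ --> _](_ : _ = fun k =>
      \sum_(j <- s | j \in s) energy_approx m (u_ k \o phi 0 j));
      last by apply/funext => k /=; rewrite big_seq.
    apply: cvg_big; first exact: add_continuous.
    move=> j js; apply: energy_approx_cvg => x gx /=.
    by apply: uu; exact: sg.
  move: uM; apply: filterS => k; apply: le_trans; rewrite -sumEFin inf_energyE.
  apply: esum_ge; exists X; first by split.
  by rewrite fsbig_finite//; apply: lee_sum => j _; exact: energy_ge.
apply: (@cvge_to_le _ \oo _ _ (fun m =>
     (\sum_(j <- s) (energy_approx m (u \o phi 0 j))%:E)%E)).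
  apply: cvg_nnesum => j _; first by apply: nearW => m; rewrite lee_fin energy_approx_ge0.
  exact: energy_cvg.
by apply: nearW.
Qed.

End InfEnergy.

(** * The Hausdorff measures *)

Section Measure.
Context {R : realType}.
Implicit Types (A B : set (borel_plane R)) (n : int) (j : idx).

Lemma closed_borel A : closed (A : set (plane R)) -> measurable A.
Proof.
move=> cA; rewrite -[A]setCK; apply: measurableC; apply: sub_sigma_algebra.
by rewrite /= openC.
Qed.

Lemma measurable_plane_set1 (x : plane R) : measurable ([set x] : set (borel_plane R)).
Proof.
apply: closed_borel; apply: accessible_closed_set1; apply: hausdorff_accessible.
exact: (@norm_hausdorff R (plane R)).
Qed.

Lemma measurable_tile n j : measurable (tile n j : set (borel_plane R)).
Proof. by apply: closed_borel; exact: closed_tile. Qed.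

Lemma measurable_inf_gasket : measurable (inf_gasket : set (borel_plane R)).
Proof.
rewrite (inf_gasketE 0) /tiling bigcup_mkcond.
apply: countable_bigcupT_measurable => [|j]; first exact: countableP.
by case: ifP => // _; exact: measurable_tile.
Qed.

Lemma measurable_inf_gasket_fun (u : plane R -> R) :
  {within inf_gasket, continuous u} ->
  measurable_fun setT (u \_ inf_gasket : borel_plane R -> R).
Proof.
move=> cu; apply/(measurable_restrictT _ measurable_inf_gasket).
apply: (measurability _ (RGenOpens.measurableE R)) => _ [_ [a [b ->] <-]].
have oab : open `]a, b[%classic by exact: interval_open.
have /open_subspaceP [V oV VE] := (continuousP _).1 cu _ oab.
rewrite setIC -VE; apply: measurableI; last exact: measurable_inf_gasket.
exact: sub_sigma_algebra.
Qed.

Lemma gasket_cell m (x : plane R) : gasket x -> exists w, size w = m /\ cell w x.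
Proof.
elim: m x => [|m IH] x gx; first by exists [::]; split=> //; exists x.
have [i [y [/IH[w [sw [z gz zy]]] ->]]] := gasketP gx.
by exists (i :: w); rewrite /= sw; split=> //; exists z; rewrite //= zy.
Qed.

Lemma cell_gasket w : cell w `<=` @gasket R.
Proof. by move=> _ [x gx <-]; exact: F_word_gasket. Qed.

Lemma closed_cell w : closed (@cell R w).
Proof.
rewrite /cell [F_word w](_ : _ = fun x => (2 ^- size w) *: (x + nvec (latw w))).
  by apply: closed_affine; [rewrite invr_neq0// expf_neq0|exact: closed_gasket].
by apply/funext => x; rewrite F_wordE.
Qed.

(** Connects tiles smaller than 1 with the cells, on which [nu] is prescribed. *)
Lemma phi_word m j : JL j -> exists k w, [/\ JL k, size w = m &
  forall x : plane R, phi (- m%:Z) j x = tau k (F_word w x)].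
Proof.
elim: m j => [|m IH] j Lj; first by exists j, [::]; rewrite oppr0 phi0.
have [b [i [Lb ->]]] := JLP Lj.
have [k [w [Lk sw kw]]] := IH b Lb.
exists k, (rcons w i); rewrite size_rcons sw; split=> // x.
by rewrite F_word_rcons -kw -phi_F -addn1 PoszD opprD subrK.
Qed.

Local Open Scope ereal_scope.

Lemma measureU_null (mu : {measure set (borel_plane R) -> \bar R}) A B :
  measurable A -> measurable B -> mu (A `&` B) = 0 -> mu (A `|` B) = mu A + mu B.
Proof.
move=> mA mB AB0.
have -> : A `|` B = A `|` (B `\` A) by rewrite setDE setUIr setUv setIT.
rewrite measureU//; last first.
- by rewrite setDE setIA [A `&` B]setIC -setIA setICr setI0.
- exact: measurableD.
congr (_ + _); rewrite (measureDI mu mB mA) setIC -[LHS]adde0; congr (_ + _).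
exact: esym.
Qed.

Context (nu : probability (borel_plane R) R)
  (nuhat : {measure set (borel_plane R) -> \bar R}).
Context (nuP : is_hausdorff_gasket nu) (nuhatP : is_hausdorff_inf_gasket nu nuhat).

(** The point lies in a cell of mass 3^-m for every m. *)
Lemma nu_point (x : plane R) : gasket x -> nu [set x] = 0.
Proof.
move=> gx; apply/eqP; rewrite eq_le measure_ge0 andbT.
have h m : nu [set x] <= (3 ^- m)%:E.
  have [w [<- wx]] := gasket_cell m gx; rewrite -nuP le_measure ?inE//.
  - exact: measurable_plane_set1.
  - by apply: closed_borel; exact: closed_cell.
  - by move=> _ ->.
apply: (@cvge_to_ge _ \oo _ _ (fun m : nat => ((3 : R) ^- m)%:E)); last by apply: nearW.
apply: cvg_EFin; first by apply: nearW.
rewrite [X in X @ _ --> _](_ : _ = fun m : nat => ((3 : R)^-1 ^+ m)%R).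
  by apply: cvg_expr; rewrite ger0_norm ?invr_ge0// invf_lt1// ltr1n.
by apply/funext => m; rewrite /= exprVn.
Qed.

Lemma nuhat_tau j A : JL j -> measurable A -> A `<=` gasket ->
  nuhat (tau j @` A) = nu A.
Proof. by move=> Lj; apply: (nuhatP.2); rewrite isomsE; exists j. Qed.

Lemma nuhat_point (x : plane R) : inf_gasket x -> nuhat [set x] = 0.
Proof.
rewrite (inf_gasketE 0) => -[j Lj [y gy <-]].
rewrite -(nu_point gy) -(nuhat_tau (j := j))// ?phi0 ?image_set1//.
- exact: measurable_plane_set1.
- by move=> _ ->.
Qed.

(** By [tau_meet] the intersection consists of at most three corners, and points are null. *)
Lemma nuhat_meet n j k : JL j -> JL k -> j <> k ->
  nuhat (tile n j `&` tile n k) = 0.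
Proof.
move=> Lj Lk jk.
have px i : inf_gasket (phi n j (corner i) : plane R).
  by apply: (tile_inf_gasket (n := n) Lj); exists (corner i) => //; exact: corner_gasket.
pose p i : set (borel_plane R) := [set phi n j (corner i)].
have mp i : measurable (p i) by exact: measurable_plane_set1.
have p0 i : nuhat (p i) = 0 by exact: nuhat_point.
have m01 : measurable (p i0 `|` p i1) by exact: measurableU.
have m2 : measurable (p i0 `|` p i1 `|` p i2) by exact: measurableU.
apply/eqP; rewrite eq_le measure_ge0 andbT.
apply: (@le_trans _ _ (nuhat (p i0 `|` p i1 `|` p i2))).
  rewrite le_measure ?inE//; first by apply: measurableI; exact: measurable_tile.
  move=> _ [[x gx <-] [y gy /(scalerI (exp2z_neq0 n)) yx]].
  have [[i _ <-] _] := tau_meet jk (gasket_triangle gx) (gasket_triangle gy) (esym yx).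
  by elim/ord3P: i; [left; left|left; right|right].
have p0_le i : nuhat (p i) <= 0 by rewrite p0.
apply: le_trans (measureU2 _ m01 (mp i2)) _; rewrite -[leRHS]adde0.
apply: leeD; last exact: p0_le.
by apply: le_trans (measureU2 _ (mp i0) (mp i1)) _; rewrite -[leRHS]adde0; apply: leeD; exact: p0_le.
Qed.

Lemma nuhat_tileS n j : JL j ->
  nuhat (tile (n + 1) j) = \sum_(i < 3) nuhat (tile n (sub j i)).
Proof.
move=> Lj; pose T i : set (borel_plane R) := tile n (sub j i).
have mT i : measurable (T i) by exact: measurable_tile.
have T0 i k : i != k -> nuhat (T i `&` T k) = 0.
  move=> ik; apply: nuhat_meet; do ?exact: JL_sub.
  by move=> /sub_inj[_ /eqP]; rewrite (negPf ik).
have -> : tile (n + 1) j = T i0 `|` T i1 `|` T i2.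
  rewrite tileS; apply/seteqP; split=> x.
    by move=> [i _]; elim/ord3P: i; [left; left|left; right|right].
  by move=> [[|]|] xT; [exists i0|exists i1|exists i2].
rewrite sum3E measureU_null//; last first.
- rewrite setIUl measureU_null ?T0 ?adde0//; do ?exact: measurableI.
  apply/eqP; rewrite eq_le measure_ge0 andbT -(T0 i0 i2)// le_measure ?inE//.
  + by apply: measurableI; exact: measurableI.
  + exact: measurableI.
- exact: measurableU.
by rewrite measureU_null// T0.
Qed.

(** Scales n <= 0 are cells of unit tiles; positive scales follow by adding the three thirds, whose
    overlaps are null. *)
Lemma nuhat_tile n j : JL j -> nuhat (tile n j) = ((3 : R) ^ n)%:E.
Proof.
have neg m k : JL k -> nuhat (tile (- m%:Z) k) = ((3 : R) ^ (- m%:Z))%:E.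
  move=> Lk; have [l [w [Ll sw lw]]] := phi_word m Lk.
  rewrite /tile (_ : phi _ _ = tau l \o F_word w); last exact/funext.
  rewrite -image_comp nuhat_tau//; last 2 first.
  - by apply: closed_borel; exact: closed_cell.
  - exact: cell_gasket.
  by rewrite nuP sw exprnN.
elim/int_rect: n j => [|n IH|n IH] j Lj; [exact: (neg 0%N)| |exact: neg].
rewrite -addn1 PoszD nuhat_tileS// sum3E !IH; do ?exact: JL_sub.
by rewrite -!EFinD expfzDr// expr1z; congr _%:E; ring.
Qed.

End Measure.

Section Esum.
Context {R : realType} {T : choiceType}.
Implicit Types (a b : T -> \bar R).
Local Open Scope ereal_scope.

Lemma esum_subset (I J : set T) a : I `<=` J ->
  \esum_(i in I) a i <= \esum_(i in J) a i.
Proof.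
move=> IJ; apply: ge_ereal_sup => _ [X [finX XI] <-]; apply: esum_ge.
by exists X => //; split=> //; exact: subset_trans XI IJ.
Qed.
End Esum.

(** * Integrals over classes of pairwise disjoint tiles *)

Section Colors.
Context {R : realType}.
Implicit Types (mu : {measure set (borel_plane R) -> \bar R}).
Local Open Scope ereal_scope.

Definition JLc c : set idx := [set j | JL j /\ color j = c].

Definition tilesc n c : set (borel_plane R) := \bigcup_(j in JLc c) tile n j.

(** Tiles of one color are truly disjoint, so additivity holds for every measure, including one with
    atoms at the corners. It is applied to [nuhat] and to [sigma]. *)
Lemma integral_tilesc mu n c (g : borel_plane R -> \bar R) :
  measurable_fun setT g -> (forall x, 0 <= g x) ->
  \int[mu]_(x in tilesc n c) g x = \esum_(j in JLc c) \int[mu]_(x in tile n j) g x.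
Proof.
move=> mg g0.
(* The tiles are enumerated by natural numbers through [pickle]; [J k] has at most one element and
   may be empty. *)
pose J (k : nat) : set idx := [set j | JLc c j /\ pickle j = k].
pose T (k : nat) : set (borel_plane R) := \bigcup_(j in J k) tile n j.
have J1 k : J k = set0 \/ exists2 j, JLc c j & J k = [set j].
  have [[j [cj jk]]|nJ] := pselect (exists j, J k j); [right|left].
    exists j => //; apply/seteqP; split=> [i [ci ik]|_ ->//].
    by apply: (pcan_inj (@pickleK _)); rewrite ik jk.
  by apply/seteqP; split=> // j Jj; apply: nJ; exists j.
have mT k : measurable (T k).
  rewrite /T; case: (J1 k) => [->|[j _ ->]]; first by rewrite bigcup_set0.
  by rewrite bigcup_set1; exact: measurable_tile.
have -> : tilesc n c = \bigcup_k T k.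
  apply/seteqP; split=> [x [j cj tx]|x [k _ [j [cj _] tx]]]; last by exists j.
  by exists (pickle j) => //; exists j.
rewrite ge0_integral_bigcup//; last 2 first.
- exact: measurable_funTS.
- apply/trivIsetP => k l _ _ kl; apply/seteqP; split=> // x [].
  move=> [j [[Lj cj] jk] tj] [i [[Li ci] il] ti]; move/eqP: kl; apply.
  rewrite -jk -il (_ : j = i)//; apply: (@tile_color R n); first by rewrite cj ci.
  by exists x.
have -> : JLc c = \bigcup_k J k.
  by apply/seteqP; split=> [j cj|j [k _ [] //]]; exists (pickle j).
rewrite esum_bigcupT; last 2 first.
- apply/trivIsetP => k l _ _ kl; apply/seteqP; split=> // j [[_ jk] [_ jl]].
  by move/eqP: kl; apply; rewrite -jk -jl.
- by move=> j; exact: integral_ge0.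
rewrite nneseries_esumT; last by move=> k; exact: integral_ge0.
apply: eq_esum => k _; rewrite /T; case: (J1 k) => [->|[j _ ->]].
  by rewrite bigcup_set0 integral_set0 esum_set0.
by rewrite bigcup_set1 esum_set1//; exact: integral_ge0.
Qed.

Lemma measurable_tilesc n c : measurable (tilesc n c).
Proof.
rewrite /tilesc bigcup_mkcond; apply: countable_bigcupT_measurable => [|j].
  exact: countableP.
by case: ifP => // _; exact: measurable_tile.
Qed.

(** Every point of the gasket lies in a tile of some color; points in tiles of several colors only
    increase the right-hand side. *)
Lemma integral_colors mu n (g : borel_plane R -> \bar R) :
  measurable_fun setT g -> (forall x, 0 <= g x) ->
  (forall x, ~ inf_gasket x -> g x = 0) ->
  \int[mu]_x g x <= \sum_(c : bool * (bool * bool)) \int[mu]_(x in tilesc n c) g x.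
Proof.
move=> mg g0 gK.
under eq_bigr do rewrite integral_mkcond.
rewrite -ge0_integral_sum//; last 2 first.
- by move=> c; apply/(measurable_restrictT _ (measurable_tilesc n c)); exact: measurable_funTS.
- by move=> c x _; apply: erestrict_ge0.
apply: ge0_le_integral => //.
  apply: emeasurable_sum => c.
  by apply/(measurable_restrictT _ (measurable_tilesc n c)); exact: measurable_funTS.
move=> x _; have [Kx|/gK ->] := pselect (inf_gasket (x : plane R)); last first.
  by apply: sume_ge0 => c _; apply: erestrict_ge0.
have [j Lj tx] : tiling n (x : plane R) by rewrite -inf_gasketE.
rewrite (bigD1 (color j))//= patchE mem_set; last by exists j.
by rewrite leeDl// sume_ge0// => c _; apply: erestrict_ge0.
Qed.

End Colors.

(** * The interpolation inequality *)

Section Powers.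
Context {R : realType}.
Implicit Types (a b p q : R).

Lemma ler_powRl a b p : 0 <= p -> 0 <= a -> a <= b -> a `^ p <= b `^ p.
Proof.
by move=> p0 a0 ab; apply: ge0_ler_powR; rewrite ?nnegrE//; exact: le_trans ab.
Qed.

Lemma powR_inj_le a b p : 0 < p -> 0 <= a -> 0 <= b -> a `^ p <= b `^ p -> a <= b.
Proof.
move=> p0 a0 b0 h; rewrite -(powRr1 a0) -(powRr1 b0) -(mulfV (lt0r_neq0 p0)).
by rewrite !powRrM ler_powRl ?invr_ge0 ?powR_ge0// ltW.
Qed.

Lemma powR_split a p q : 0 < p -> p <= q -> a `^ q = a `^ p * a `^ (q - p).
Proof.
move=> p0 pq; rewrite -powRD; first by congr (_ `^ _); lra.
by rewrite (_ : p + (q - p) = q); [rewrite gt_eqF//|]; lra.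
Qed.

Lemma powR_superadd a b q : 1 <= q -> 0 <= a -> 0 <= b ->
  a `^ q + b `^ q <= (a + b) `^ q.
Proof.
move=> q1 a0 b0; rewrite !(@powR_split _ 1 q)// !powRr1 ?addr_ge0// mulrDl.
by apply: lerD; rewrite ler_wpM2l// ler_powRl ?subr_ge0 ?lerDl ?lerDr.
Qed.

Lemma norm_half a b (o : R) : 2 * o < `|a| -> `|a - b| <= o -> `|a| / 2 <= `|b|.
Proof. by move=> ? ?; have := lerB_dist a b; lra. Qed.

End Powers.

(** * Norm bounds at a fixed scale n *)

Section Scale.
Context {R : realType}.
Context (nu : probability (borel_plane R) R)
  (nuhat : {measure set (borel_plane R) -> \bar R}).
Context (nuP : is_hausdorff_gasket nu) (nuhatP : is_hausdorff_inf_gasket nu nuhat).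
Context (sigma : {measure set (borel_plane R) -> \bar R}) (u : plane R -> R) (n : int)
  (s : R).
Context (cu : {within inf_gasket, continuous u}) (uoo : (inf_energy u < +oo)%E).
Context (s0 : 0 < s)
  (sP : forall j, JL j -> (s%:E <= sigma (tile n j : set (borel_plane R)))%E).

Let w : borel_plane R -> R := u \_ inf_gasket.
(** A bound for the oscillation over every tile of size 2^n, see [tile_osc_le]. *)
Let A : R := 16 * Num.sqrt ((5 / 3) ^ n * fine (inf_energy u)).

Let wE x : inf_gasket (x : plane R) -> w x = u x.
Proof. by move=> Kx; rewrite /w patchE mem_set. Qed.

Let pw (p : R) (x : borel_plane R) : \bar R := (`|w x| `^ p)%:E.

Let mw : measurable_fun setT w. Proof. exact: measurable_inf_gasket_fun. Qed.

Let mpw p : measurable_fun setT (pw p).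
Proof.
apply/measurable_EFinP.
apply: (measurableT_comp (measurable_powR p)); exact: measurableT_comp.
Qed.

Let pw_ge0 p x : (0 <= pw p x)%E. Proof. by rewrite lee_fin powR_ge0. Qed.

Let A0 : 0 <= A. Proof. by rewrite mulr_ge0 ?sqrtr_ge0. Qed.

Lemma poweR_Lp_norm (mu : {measure set (borel_plane R) -> \bar R}) (p : R) : 0 < p ->
  (Lp_norm mu p%:E u `^ p = \int[mu]_x (pw p x))%E.
Proof. by move=> p0; rewrite /Lp_norm poweR_Lnorm// gt_eqF. Qed.

(** If |u(x)| exceeds twice the oscillation, then |u| >= |u(x)|/2 on the whole tile, whose mass is
    at least s. This replaces the comparison of u with its mean. *)
Lemma tile_dichotomy (p : R) j x : 1 <= p -> JL j -> tile n j x ->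
  `|u x| <= 2 * tile_osc n j u \/
  (((`|u x| / 2) `^ p * s)%:E <= \int[sigma]_(y in tile n j) pw p y)%E.
Proof.
move=> p1 Lj tx; have [|lt2] := leP `|u x| (2 * tile_osc n j u); [by left|right].
have h y : tile n j y -> `|u x| / 2 <= `|w y|.
  move=> ty; rewrite wE; last exact: tile_inf_gasket ty.
  exact: norm_half lt2 (tile_oscP Lj cu uoo tx ty).
rewrite EFinM.
apply: (@le_trans _ _ (\int[sigma]_(y in tile n j) (cst ((`|u x| / 2) `^ p)%:E) y)%E).
  rewrite integral_cst; last exact: measurable_tile.
  by rewrite lee_wpmul2l ?lee_fin ?powR_ge0// sP.
apply: ge0_le_integral.
- exact: measurable_tile.
- by move=> y _; rewrite lee_fin powR_ge0.
- exact: measurable_cst.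
- exact: measurable_funTS.
by move=> y ty; rewrite lee_fin ler_powRl ?divr_ge0 ?h//; lra.
Qed.

(** The case q = +oo of the scale bound. For p = +oo, a value with |u(x)|/2 > B would make |u| > B
    on a whole tile, a set of positive [sigma]-measure. *)
Lemma Lp_norm_sup (p : \bar R) (B : R) : (1 <= p)%E -> 0 <= B ->
  (Lp_norm sigma p u <= B%:E)%E ->
  forall x, inf_gasket x -> `|u x| <= 2 * (A + s `^ (- recip p) * B).
Proof.
move=> p1 B0 uB x; rewrite (inf_gasketE n) => -[j Lj tx].
have oA := tile_osc_le n Lj uoo; rewrite -/A in oA.
have Y0 : 0 <= s `^ (- recip p) * B by rewrite mulr_ge0 ?powR_ge0.
case: p p1 uB Y0 => [p||//] p1 uB Y0.
  rewrite lee_fin in p1; have p0 : 0 < p by lra.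
  have [?|h] := tile_dichotomy p1 Lj tx; first by lra.
  have {}h : (((`|u x| / 2) `^ p * s)%:E <= (B `^ p)%:E)%E.
    apply: le_trans h _; apply: (@le_trans _ _ (\int[sigma]_y pw p y)%E).
      by apply: ge0_subset_integral => //; exact: measurable_tile.
    rewrite -poweR_Lp_norm// -poweR_EFin; apply: gt0_ler_poweR; first exact: ltW.
    - by rewrite in_itv/= leey Lnorm_ge0.
    - by rewrite in_itv/= leey lee_fin B0.
    - exact: uB.
  have : `|u x| / 2 <= s `^ (- recip p%:E) * B.
    apply: (powR_inj_le p0); rewrite ?divr_ge0//.
    rewrite powRM ?powR_ge0// -powRrM /recip inver gt_eqF//= mulNr mulVf ?gt_eqF//.
    by rewrite powRN (powRr1 (ltW s0)) ler_pdivlMl// mulrC -lee_fin.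
  by have := A0; lra.
move: Y0; rewrite /recip invey/= oppr0 powRr0 mul1r => Y0.
have [?|lt2] := leP `|u x| (2 * tile_osc n j u); first by lra.
suff : `|u x| / 2 <= B by have := A0; lra.
rewrite leNgt; apply/negP => Bu.
have h y : tile n j y -> `|u x| / 2 <= `|w y|.
  move=> ty; rewrite wE; last exact: tile_inf_gasket ty.
  exact: norm_half lt2 (tile_oscP Lj cu uoo tx ty).
have tile0 : (0 < sigma (tile n j : set (borel_plane R)))%E.
  by apply: lt_le_trans (sP Lj); rewrite lte_fin.
(* For exponent +oo the norm is an essential supremum only if the measure is not zero; here the tile
   has positive mass. *)
move: uB; rewrite /Lp_norm unlock; case: ifPn => [_|]; last first.
  rewrite -leNgt => sT; exfalso; move: tile0; rewrite ltNge => /negP; apply.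
  apply: le_trans sT; rewrite le_measure ?inE//; exact: measurable_tile.
move=> /ess_supP [Z [mZ Z0 ZP]].
move: tile0; rewrite ltNge => /negP; apply; rewrite -Z0 le_measure ?inE//.
  exact: measurable_tile.
by move=> y ty; apply: ZP => /=; rewrite lee_fin; have := h y ty; lra.
Qed.

(** On a tile, (|u|/2)^q is at most osc^2 A^(q-2) or s^-1 I Y^(q-p), where I is the tile integral of
    |u|^p. The squares sum to the energy and the integrals to at most B^p. The factor 8 counts the
    colors, 3^n is the mass of a tile and 2^q comes from the halving. *)
Lemma Lq_norm_bound (p q : R) (B : R) : 1 <= p -> p <= q -> 2 <= q -> 0 <= B ->
  (Lp_norm sigma p%:E u <= B%:E)%E ->
  (\int[nuhat]_x pw q x <=
    (8 * (3 ^ n * (2 `^ q * (A `^ q + (s `^ (- p^-1) * B) `^ q))))%:E)%E.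
Proof.
move=> p1 pq q2 B0 uB; set Y := _ * B; have p0 : 0 < p by lra.
have q0 : 0 < q by lra.
have Y0 : 0 <= Y by rewrite mulr_ge0 ?powR_ge0.
have intB : (\int[sigma]_y pw p y <= (B `^ p)%:E)%E.
  rewrite -poweR_Lp_norm// -poweR_EFin; apply: gt0_ler_poweR; first exact: ltW.
  - by rewrite in_itv/= leey Lnorm_ge0.
  - by rewrite in_itv/= leey lee_fin B0.
  - exact: uB.
(* So [Y] bounds the p-th root of s^-1 I on every tile. *)
have YB : s^-1 * B `^ p = Y `^ p.
  by rewrite powRM ?powR_ge0// -powRrM mulNr mulVf ?gt_eqF// powRN (powRr1 (ltW s0)).
pose I j : \bar R := (\int[sigma]_(y in tile n j) pw p y)%E.
have I0 j : (0 <= I j)%E by exact: integral_ge0.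
have IB j : (I j <= (B `^ p)%:E)%E.
  apply: le_trans intB; apply: ge0_subset_integral => //; exact: measurable_tile.
pose c1 := 3 ^ n * 2 `^ q * A `^ (q - 2).
pose c2 := 3 ^ n * 2 `^ q * (s^-1 * Y `^ (q - p)).
have t0 : 0 <= (3 : R) ^ n by rewrite exprz_ge0.
have c10 : 0 <= c1 by rewrite !mulr_ge0 ?powR_ge0.
have c20 : 0 <= c2 by rewrite !mulr_ge0 ?powR_ge0 ?invr_ge0 ?(ltW s0).
have tileI j : JL j -> (\int[nuhat]_(y in tile n j) pw q y <=
    c1%:E * (tile_osc n j u ^+ 2)%:E + c2%:E * I j)%E.
  move=> Lj; have o0 := tile_osc_ge0 n j u; have oA := tile_osc_le n Lj uoo.
  have [r Ir] : exists r, I j = r%:E.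
    by exists (fine (I j)); rewrite fineK// ge0_fin_numE// (le_lt_trans (IB j)) ?ltry.
  have r0 : 0 <= r by rewrite -lee_fin -Ir.
  have rB : r <= B `^ p by rewrite -lee_fin -Ir.
  pose M := 2 `^ q * (tile_osc n j u ^+ 2 * A `^ (q - 2) + s^-1 * r * Y `^ (q - p)).
  apply: (@le_trans _ _ (\int[nuhat]_(y in tile n j) (cst M%:E) y)%E); last first.
    rewrite integral_cst; last exact: measurable_tile.
    rewrite (nuhat_tile nuP nuhatP)// Ir -!EFinM -EFinD lee_fin /M /c1 /c2.
    by rewrite le_eqVlt; apply/orP; left; apply/eqP; ring.
  apply: ge0_le_integral.
  - exact: measurable_tile.
  - by move=> y _; exact: pw_ge0.
  - exact: measurable_funTS.
  - exact: measurable_cst.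
  move=> y ty; rewrite lee_fin wE; last exact: tile_inf_gasket ty.
  rewrite -[`|u y|](divfK (_ : 2 != 0))// mulrC powRM ?divr_ge0//.
  rewrite ler_wpM2l ?powR_ge0//.
  have [h|h] := tile_dichotomy p1 Lj ty.
    apply: (@le_trans _ _ (tile_osc n j u `^ q)).
      by rewrite ler_powRl ?divr_ge0//; lra.
    rewrite (powR_split _ _ q2)// powR_mulrn// -[leLHS]addr0 lerD//.
      by rewrite ler_wpM2l ?sqr_ge0// ler_powRl//; lra.
    by rewrite !mulr_ge0 ?powR_ge0 ?invr_ge0// ltW.
  rewrite -/(I j) Ir lee_fin in h.
  have {}h : (`|u y| / 2) `^ p <= s^-1 * r by rewrite ler_pdivlMl// mulrC.
  have uY : `|u y| / 2 <= Y.
    apply: (powR_inj_le p0); rewrite ?divr_ge0//.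
    by rewrite -YB (le_trans h)// ler_wpM2l ?invr_ge0// ltW.
  rewrite (powR_split _ p0 pq) -[leLHS]add0r lerD//.
    by rewrite mulr_ge0 ?sqr_ge0 ?powR_ge0.
  by apply: ler_pM; rewrite ?powR_ge0// ler_powRl ?divr_ge0//; lra.
have colI c : (\int[nuhat]_(y in tilesc n c) pw q y <=
    (3 ^ n * (2 `^ q * (A `^ q + Y `^ q)))%:E)%E.
  rewrite integral_tilesc//.
  apply: (@le_trans _ _ (\esum_(j in JLc c)
      (c1%:E * (tile_osc n j u ^+ 2)%:E + c2%:E * I j))%E).
    by apply: le_esum => j [Lj _]; exact: tileI.
  have sq0 j : (0 <= (tile_osc n j u ^+ 2)%:E)%E by rewrite lee_fin sqr_ge0.
  rewrite esumD; last 2 first.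
  - by move=> j _; rewrite mule_ge0.
  - by move=> j _; rewrite mule_ge0.
  rewrite !esumZl//.
  (* The sums over one color will be bounded by A^2 and B^p, which completes the powers A^q and
     Y^q. *)
  rewrite (_ : _ * _ = c1 * A ^+ 2 + c2 * B `^ p); last first.
    rewrite /c1 /c2 [A `^ q](powR_split _ _ q2)// powR_mulrn// [Y `^ q](powR_split _ p0 pq) -YB.
    ring.
  rewrite EFinD (EFinM c1) (EFinM c2); apply: leeD; apply: lee_wpmul2l; rewrite ?lee_fin//.
    apply: (@le_trans _ _ (\esum_(j in JL) ((16 ^+ 2)%:E * energy (u \o phi n j))%E)).
      apply: (@le_trans _ _ (\esum_(j in JLc c) ((16 ^+ 2)%:E * energy (u \o phi n j))%E)).
        by apply: le_esum => j [Lj _]; rewrite tile_osc_sq.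
      by apply: esum_subset => j [].
    rewrite esumZl//; last by move=> j; exact: energy_ge0.
    rewrite -/(tile_energy n u) tile_energyE /A exprMn [leRHS]EFinM; apply: lee_wpmul2l => //.
    have := inf_energy_ge0 u; move: uoo; case: (inf_energy u) => // e _ e0.
    by rewrite sqr_sqrtr// mulr_ge0// exprz_ge0// divr_ge0.
  rewrite -integral_tilesc//; apply: le_trans intB.
  by apply: ge0_subset_integral => //; exact: measurable_tilesc.
apply: le_trans (integral_colors nuhat n (mpw q) (pw_ge0 q) _) _.
  by move=> x nK; rewrite /pw /w patchE memNset// normr0 powR0// gt_eqF.
apply: (@le_trans _ _ (\sum_(c : bool * (bool * bool))
    (3 ^ n * (2 `^ q * (A `^ q + Y `^ q)))%:E)%E).
  by apply: lee_sum => c _; exact: colI.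
rewrite sumEFin sumr_const card_prod card_bool [X in (2 * X)%N]card_prod !card_bool.
by rewrite lee_fin -[_ *+ _]mulr_natl.
Qed.

(** The q-th root of [Lq_norm_bound]: 16 = 8 * 2 with 8 <= 8^q, and A^q + Y^q <= (A + Y)^q. For q =
    +oo the constant 2 of [Lp_norm_sup] is enlarged to 16. *)
Lemma scale_bound (p q : \bar R) (B : R) : (1 <= p)%E -> (p <= q)%E -> (2%:E <= q)%E ->
  0 <= B -> (Lp_norm sigma p u <= B%:E)%E ->
  (Lp_norm nuhat q u <=
    (16 * ((3 ^ n) `^ recip q * (A + s `^ (- recip p) * B)))%:E)%E.
Proof.
move=> p1 pq q2 B0 uB.
have Y0 : 0 <= s `^ (- recip p) * B by rewrite mulr_ge0 ?powR_ge0.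
case: q pq q2 => [q||//] pq q2; last first.
  rewrite /recip invey/= powRr0 mul1r -/(recip p).
  rewrite /Lp_norm unlock; case: ifPn => _; last first.
    by rewrite lee_fin mulr_ge0// addr_ge0.
  apply/ess_supP; apply: nearW => x /=; rewrite lee_fin.
  have [Kx|nK] := pselect (inf_gasket (x : plane R)); last first.
    by rewrite patchE memNset// normr0 mulr_ge0// addr_ge0.
  rewrite -/(w x) wE//; apply: le_trans (Lp_norm_sup p1 B0 uB Kx) _.
  by rewrite ler_wpM2r ?addr_ge0// ler_nat.
case: p p1 pq uB Y0 => [p||//] p1 pq uB Y0; last by rewrite leye_eq in pq.
rewrite !lee_fin in p1 pq q2.
have p0 : 0 < p by lra.
have q0 : 0 < q by lra.
have := Lq_norm_bound p1 pq q2 B0 uB.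
move: Y0; rewrite /recip !inver !gt_eqF//=; set Y := _ * B => Y0 h.
have t0 : 0 <= (3 : R) ^ n by rewrite exprz_ge0.
have AY0 : 0 <= A + Y by rewrite addr_ge0.
have {}h : (Lp_norm nuhat q%:E u `^ q <=
    ((16 * ((3 ^ n) `^ q^-1 * (A + Y))) `^ q)%:E)%E.
  rewrite poweR_Lp_norm//; apply: le_trans h _; rewrite lee_fin.
  rewrite powRM// ?mulr_ge0 ?powR_ge0// powRM ?powR_ge0// -powRrM mulVf ?gt_eqF//.
  rewrite (powRr1 t0) (_ : 16 = 8 * 2); last by rewrite -natrM.
  rewrite powRM// -!mulrA; apply: ler_pM => //.
  - by rewrite !mulr_ge0 ?addr_ge0 ?powR_ge0.
  - rewrite -[leLHS]powRr1//; apply: ler_powR; [by rewrite ler1n|lra].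
  - rewrite mulrCA ler_wpM2l ?powR_ge0// ler_wpM2l// powR_superadd//; lra.
have b0 : 0 <= 16 * ((3 ^ n) `^ q^-1 * (A + Y)) by rewrite !mulr_ge0 ?powR_ge0.
have := h; have := Lnorm_ge0 nuhat q%:E (EFin \o (u \_ inf_gasket : borel_plane R -> R)).
rewrite -/(Lp_norm nuhat q%:E u); case: (Lp_norm nuhat q%:E u) => [r||//].
  by rewrite !lee_fin => r0; apply: powR_inj_le.
by rewrite poweRyr ?gt_eqF.
Qed.

End Scale.

(** * Choice of the scale *)

Section Optimize.
Context {R : realType}.
Implicit Types (L M a B K c : R).

Lemma ln3_gt0 : 0 < ln 3 :> R. Proof. by rewrite ln_gt0// ltr1n. Qed.

Lemma pow3_gt0 (x : R) : 0 < 3 `^ x. Proof. exact: powR_gt0. Qed.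

Lemma pow3D (x y : R) : 3 `^ (x + y) = 3 `^ x * 3 `^ y.
Proof. by rewrite powRD//; apply/implyP => _; rewrite gt_eqF. Qed.

Lemma pow3_ge (x : R) : 1 + x * ln 3 <= 3 `^ x.
Proof. by rewrite /powR gt_eqF//; exact: expR_ge1Dx. Qed.

(** Sends the scale to infinity in the degenerate cases of [optimize], in [zero_energy_L2_eq0] and
    in the optimality argument. The linear lower bound [pow3_ge] reduces it to the Archimedean
    property. *)
Lemma pow3_decay L M c : 0 < c -> (forall n : nat, L <= M * 3 `^ (- (n%:R * c))) ->
  L <= 0.
Proof.
move=> c0 h; rewrite leNgt; apply/negP => L0.
have d0 : 0 < L * c * ln 3 by rewrite !mulr_gt0 ?ln3_gt0.
have M0 : 0 <= M.
  by have := h 0%N; rewrite mul0r oppr0 powRr0 mulr1; lra.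
have [n Mn] : exists n : nat, M < n%:R * (L * c * ln 3).
  exists (Num.bound (M / (L * c * ln 3))); rewrite -ltr_pdivrMr//.
  exact: archi_boundP (divr_ge0 M0 (ltW d0)).
have := h n; rewrite powRN ler_pdivlMr ?pow3_gt0// => h1.
have := ler_wpM2l (ltW L0) (pow3_ge (n%:R * c)).
by nra.
Qed.

(* The exponent that balances [3 ^ (x beta) a] and [3 ^ (- x alpha) B]. *)
Definition expo (alpha beta : R) : R := Num.max (alpha / (alpha + beta)) 0.

(** One of the two terms always suffices. The balancing scale is <= 0 exactly when B <= a, and its
    sign decides which alpha governs. If that alpha is <= 0, the exponent is 0 and the term is B
    itself. The factor 4 = 3 + 1 comes from rounding up: one summand grows at most by 3, the other
    does not grow. *)
Lemma optimize L K a B alpha1 alpha2 beta :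
  0 <= a -> 0 <= B -> 0 <= K -> 0 < beta -> beta <= 1 ->
  alpha2 <= alpha1 -> 0 < alpha2 + beta ->
  (forall n : int, n <= 0 ->
    L <= K * (3 `^ (n%:~R * beta) * a + 3 `^ (- (n%:~R * alpha1)) * B)) ->
  (forall n : int, 0 <= n ->
    L <= K * (3 `^ (n%:~R * beta) * a + 3 `^ (- (n%:~R * alpha2)) * B)) ->
  L <= 4 * K * (a `^ expo alpha1 beta * B `^ (1 - expo alpha1 beta) +
                a `^ expo alpha2 beta * B `^ (1 - expo alpha2 beta)).
Proof.
move=> a0 B0 K0 b0 b1 a21 ab2 H1 H2.
have ab1 : 0 < alpha1 + beta by lra.
have T_ge0 x : 0 <= 4 * K * (a `^ x * B `^ (1 - x)).
  by rewrite !mulr_ge0 ?powR_ge0.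
suff [h|h] : L <= 4 * K * (a `^ expo alpha1 beta * B `^ (1 - expo alpha1 beta)) \/
    L <= 4 * K * (a `^ expo alpha2 beta * B `^ (1 - expo alpha2 beta)).
- by rewrite mulrDr (le_trans h)// lerDl.
- by rewrite mulrDr (le_trans h)// lerDr.
have expo0 alpha : alpha <= 0 -> 0 < alpha + beta -> expo alpha beta = 0.
  by move=> al0 ab; rewrite /expo max_r// ler_pdivrMr// mul0r.
have balance alpha t : 0 < alpha -> 0 < alpha + beta -> 0 < a -> 0 < B ->
    t = (ln B - ln a) / ((alpha + beta) * ln 3) ->
    L <= K * (3 `^ ((Num.ceil t)%:~R * beta) * a + 3 `^ (- ((Num.ceil t)%:~R * alpha)) * B) ->
    L <= 4 * K * (a `^ expo alpha beta * B `^ (1 - expo alpha beta)).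
  move=> al0 ab a_gt0 B_gt0 tE /le_trans; apply.
  have l3 := ln3_gt0.
  have eE : expo alpha beta = alpha / (alpha + beta).
    by rewrite /expo max_l// divr_ge0// ltW.
  have tl : t * ln 3 = (ln B - ln a) / (alpha + beta).
    by rewrite tE; field; rewrite !gt_eqF.
  set D := a `^ _ * _.
  (* At the scale [t] both summands equal [D]. *)
  have D1 : 3 `^ (t * beta) * a = D.
    rewrite /D eE /powR !gt_eqF//.
    transitivity (expR (t * beta * ln 3) * expR (ln a)); first by rewrite lnK.
    rewrite -!expRD mulrAC tl; congr expR.
    by field; rewrite gt_eqF.
  have D2 : 3 `^ (- (t * alpha)) * B = D.
    rewrite /D eE /powR !gt_eqF//.
    transitivity (expR (- (t * alpha) * ln 3) * expR (ln B)); first by rewrite lnK.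
    rewrite -!expRD mulNr mulrAC tl; congr expR.
    by field; rewrite gt_eqF.
  have /andP[c1 c2] := ceil_itv t.
  have t1 : 3 `^ ((Num.ceil t)%:~R * beta) <= 3 * 3 `^ (t * beta).
    have -> : 3 * 3 `^ (t * beta) = 3 `^ (1 + t * beta).
      by rewrite powRD ?powRr1//; apply/implyP => _; rewrite gt_eqF.
    apply: ler_powR; first by rewrite ler1n.
    rewrite intrB in c1; nra.
  have t2 : 3 `^ (- ((Num.ceil t)%:~R * alpha)) <= 3 `^ (- (t * alpha)).
    apply: ler_powR; first by rewrite ler1n.
    by rewrite lerN2 ler_wpM2r// ltW.
  have -> : 4 * K * D = K * (3 * D + D) by ring.
  rewrite ler_wpM2l// lerD//.
    by rewrite -{1}D1 mulrA ler_wpM2r.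
  by rewrite -D2 ler_wpM2r.
have KB0 : 0 <= K * B by rewrite mulr_ge0.
have Ka0 : 0 <= K * a by rewrite mulr_ge0.
have H0 : L <= K * a + K * B.
  by have := H2 0 (lexx _); rewrite !mul0r oppr0 !powRr0 !mul1r mulrDr.
(* For alpha1 <= 0, letting n tend to -oo removes the first summand, while the factor of B stays at
   most 1. *)
have to_neg : L <= K * B \/ 0 < alpha1.
  have [al0|] := leP alpha1 0; [left|by right].
  rewrite -subr_le0; apply: (pow3_decay (M := K * a) b0) => n.
  have := H1 (- n%:Z); rewrite oppr_le0 => /(_ isT).
  rewrite intrN mulNr mulNr opprK => h; rewrite lerBlDr (le_trans h)// mulrDr lerD//.
    by rewrite mulrAC mulrA.
  rewrite ler_wpM2l// -[leRHS]mul1r ler_wpM2r//.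
  apply: le_trans (_ : (3 : R) `^ 0 <= 1); last by rewrite powRr0.
  by apply: ler_powR; [rewrite ler1n|rewrite mulr_ge0_le0].
have : a = 0 \/ 0 < a by move: a0; rewrite le_eqVlt => /predU1P[<-|?]; [left|right].
(* No balancing scale exists if a = 0 or B = 0; n tends to +oo or -oo instead, except for a = 0 and
   alpha2 <= 0, where n = 0 is used. The convention 0^0 = 1 keeps the term equal to B there. *)
move=> [aE|a_gt0].
  right; have [al0|al0] := leP alpha2 0.
    rewrite expo0// powRr0 subr0 mul1r powRr1//.
    by rewrite aE mulr0 in H0; lra.
  apply: le_trans (T_ge0 _); apply: (pow3_decay (M := K * B) al0) => n.
  by have := H2 n isT; rewrite aE mulr0 add0r -mulrA [B * _]mulrC.
have : B = 0 \/ 0 < B by move: B0; rewrite le_eqVlt => /predU1P[<-|?]; [left|right].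
move=> [BE|B_gt0].
  right; apply: le_trans (T_ge0 _); apply: (pow3_decay (M := K * a) b0) => n.
  have := H1 (- n%:Z); rewrite oppr_le0 => /(_ isT).
  by rewrite intrN mulNr BE mulr0 addr0 mulrA mulrAC.
have l3 := ln3_gt0.
(* Rounding up preserves the sign of the scale, so the matching hypothesis [H1] or [H2] applies. *)
have [Ba|aB] := leP B a.
  left; have [al0|al0] := leP alpha1 0.
    rewrite expo0// powRr0 subr0 mul1r powRr1//.
    by case: to_neg => [|?]; lra.
  apply: (balance _ _ al0 ab1 a_gt0 B_gt0 erefl); apply: H1; rewrite ceil_le0.
  by rewrite ler_pdivrMr ?mulr_gt0// mul0r subr_le0 ler_ln.
right; have [al0|al0] := leP alpha2 0.
  rewrite expo0// powRr0 subr0 mul1r powRr1//.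
  by have := ler_wpM2l K0 (ltW aB); lra.
apply: (balance _ _ al0 ab2 a_gt0 B_gt0 erefl); apply: H2; rewrite ltW// ceil_gt0.
by rewrite divr_gt0 ?mulr_gt0// subr_gt0 ltr_ln.
Qed.

End Optimize.

(** * Finiteness and convergence in the completed domain *)

Section Domain.
Context {R : realType}.
Implicit Types (u v : plane R -> R) (n : int) (j : idx).

Lemma tile_small (x : plane R) (U : set (plane R)) : inf_gasket x -> nbhs x U ->
  exists n0 : nat, forall m : nat, (n0 <= m)%N -> exists j,
    [/\ JL j, tile (- m%:Z) j x & tile (- m%:Z) j `<=` U].
Proof.
move=> Kx /nbhs_ballP[e /= e0 eU].
have [n0 n0e] : exists n0 : nat, 2 / e < n0%:R.
  by exists (Num.bound (2 / e)); apply: archi_boundP; rewrite divr_ge0// ltW.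
exists n0 => m nm.
have [j Lj tx] : tiling (- m%:Z) x by rewrite -inf_gasketE.
exists j; split=> //; apply: subset_trans eU.
(* A difference of at most 2^-m in [cs] and [ct] gives at most 3/2 of it in the max-norm; 2 is
   ample. *)
have me : 2 * (2 : R) ^ (- m%:Z) < e.
  rewrite -exprnN ltr_pdivrMr ?exprn_gt0// -ltr_pdivrMl// mulrC (lt_le_trans n0e)//.
  apply: (@le_trans _ _ m%:R); first by rewrite ler_nat.
  by rewrite -natrX ler_nat ltnW// ltn_expl.
move: tx => [y gy <-] _ [z gz <-].
have [y1 y2 y3] := gasket_triangle gy; have [z1 z2 z3] := gasket_triangle gz.
set p := phi _ j y; set q := phi _ j z.
have h0 : 0 < (2 : R) ^ (- m%:Z) by exact: exp2z_gt0.
have hs : `|cs p - cs q| <= 2 ^ (- m%:Z).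
  rewrite /p /q !phiE !csZ -mulrBr !csD normrM normrM normr_sign mulr1 gtr0_norm//.
  by rewrite ler_piMr ?(ltW h0)// ler_norml; apply/andP; split; lra.
have ht : `|ct p - ct q| <= 2 ^ (- m%:Z).
  rewrite /p /q !phiE !ctZ -mulrBr !ctD normrM normrM normr_sign mulr1 gtr0_norm//.
  by rewrite ler_piMr ?(ltW h0)// ler_norml; apply/andP; split; lra.
have s3 : Num.sqrt 3 / 2 <= 1 :> R.
  by rewrite ler_pdivrMr// mul1r -ler_sqr ?nnegrE ?sqrtr_ge0// sqr_sqrtr//; lra.
suff [h1 h2] : `|p.1 - q.1| < e /\ `|p.2 - q.2| < e by [].
rewrite !fst_coord !snd_coord; split.
  rewrite ler_norml in hs; rewrite ler_norml in ht.
  by rewrite ltr_norml; apply/andP; split; lra.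
rewrite -mulrBl normrM [X in _ * X]ger0_norm ?divr_ge0// ?sqrtr_ge0//.
apply: le_lt_trans me; rewrite (le_trans (ler_pM _ _ ht s3))//; lra.
Qed.

Lemma cvge0_lt (f : nat -> \bar R) (e : R) : 0 < e -> (f k @[k --> \oo] --> 0)%E ->
  \forall k \near \oo, (f k < e%:E)%E.
Proof.
move=> e0 f0; apply: (f0 [set y | (y < e%:E)%E]); apply: open_nbhs_nbhs; split=> //.
exact: open_ereal_lt_ereal.
Qed.

Lemma withinB A u v : {within A, continuous u} -> {within A, continuous v} ->
  {within A, continuous (u \- v)}.
Proof. by move=> cu cv x; apply: continuousB; [exact: cu|exact: cv]. Qed.

Lemma patchB A u v : ((u \- v) \_ A = (u \_ A) \- (v \_ A)).
Proof. by apply/funext => x; rewrite /= !patchE; case: ifP => //; rewrite subr0. Qed.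

Local Open Scope ereal_scope.

Context (nu : probability (borel_plane R) R)
  (nuhat : {measure set (borel_plane R) -> \bar R}).
Context (nuP : is_hausdorff_gasket nu) (nuhatP : is_hausdorff_inf_gasket nu nuhat).

Lemma Lp2_tile_ge u n j (d : R) : {within inf_gasket, continuous u} -> JL j ->
  (0 <= d)%R -> (forall x, tile n j x -> (d <= `|u x|)%R) ->
  (d ^+ 2 * 3 ^ n)%:E <= Lp_norm nuhat 2%:E u `^ 2.
Proof.
move=> cu Lj d0 du; rewrite poweR_Lp_norm//.
have mw := measurable_inf_gasket_fun cu.
have mp : measurable_fun setT
    (fun x : borel_plane R => (`|(u \_ inf_gasket) x| `^ 2)%:E).
  apply/measurable_EFinP.
  by apply: (measurableT_comp (measurable_powR 2)); exact: measurableT_comp.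
apply: (@le_trans _ _ (\int[nuhat]_(x in tile n j)
    (`|(u \_ inf_gasket) x| `^ 2)%:E)); last first.
  by apply: ge0_subset_integral => //; exact: measurable_tile.
rewrite EFinM -(nuhat_tile nuP nuhatP n Lj) -integral_cst; last exact: measurable_tile.
apply: ge0_le_integral.
- exact: measurable_tile.
- by move=> x _; rewrite lee_fin sqr_ge0.
- exact: measurable_cst.
- exact: measurable_funTS.
move=> x tx; rewrite lee_fin patchE mem_set; last exact: (tile_inf_gasket Lj tx).
by rewrite powR_mulrn// ler_sqr ?nnegrE// du.
Qed.

Lemma domain_bounded u : domain nuhat u ->
  exists u_ : nat -> plane R -> R, exists M : R, exists N : nat,
  [/\ (0 <= M)%R, forall k, pre_domain nuhat (u_ k),
      forall k, (N <= k)%N -> inf_energy (u_ k) <= M%:E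
    & Lp_norm nuhat 2%:E (u_ k \- u)%R @[k --> \oo] --> 0].
Proof.
move=> [cu [u_ [pu cau L2]]]; exists u_.
have [N cauN] := cau 1%R ltr01.
have [_ _ EN] := pu N.
(* This is [inf_energyD] for u_k = (u_k - u_N) + u_N with the energy of the difference at most 1. *)
exists (2 + 2 * fine (inf_energy (u_ N)))%R, N; split=> //.
  by rewrite addr_ge0// mulr_ge0// fine_ge0// inf_energy_ge0.
move=> k Nk.
have h : inf_energy (u_ k \- u_ N)%R <= 1.
  rewrite leNgt; apply/negP => h1.
  have := cauN k N Nk (leqnn N); rewrite ltNge => /negP; apply.
  rewrite /domain_norm -[leLHS]adde0 leeD//; last exact: Lnorm_ge0.
  rewrite -[leLHS](poweR1r 2^-1); apply: gt0_ler_poweR; rewrite ?in_itv/= ?leey ?andbT//.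
  - exact: inf_energy_ge0.
  - exact: ltW.
have -> : u_ k = ((u_ k \- u_ N) \+ u_ N)%R by apply/funext => x /=; rewrite subrK.
apply: le_trans (inf_energyD _ _) _.
rewrite (EFinD 2) (EFinM 2) fineK; last by rewrite ge0_fin_numE// inf_energy_ge0.
by apply: leeD => //; rewrite -[leRHS]mule1 lee_wpmul2l.
Qed.

(** On a fixed small tile around x, u varies little by continuity and all u_k vary little by the
    common energy bound. If u_k stayed far from u on the whole tile, the L^2-distance would be
    bounded below by [Lp2_tile_ge]; so they are close at some y of the tile, hence at x. *)
Lemma domain_pointwise u (u_ : nat -> plane R -> R) (M : R) (N : nat) :
  {within inf_gasket, continuous u} -> (0 <= M)%R ->
  (forall k, pre_domain nuhat (u_ k)) ->
  (forall k, (N <= k)%N -> inf_energy (u_ k) <= M%:E) ->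
  Lp_norm nuhat 2%:E (u_ k \- u)%R @[k --> \oo] --> 0 ->
  forall x, inf_gasket x -> u_ k x @[k --> \oo] --> u x.
Proof.
move=> cu M0 pu uM L2 x Kx; apply/cvgrPdist_lt => e e0.
have e40 : (0 < e / 4)%R by rewrite divr_gt0.
have cux := (within_continuousP _ _).1 cu x Kx (e / 4)%R e40.
have [n0 n0P] := tile_small Kx cux.
have [m1 m1P] : exists m1 : nat, forall m, (m1 <= m)%N ->
    (16 * Num.sqrt ((5 / 3) ^ (- m%:Z) * M) < e / 4)%R.
  (* Here 64 = 4 * 16, so that 16 times the root of a number below (e/64)^2 is below e/4. *)
  have c0 : (0 < (e / 64) ^+ 2)%R by rewrite exprn_gt0// divr_gt0.
  have : ((3 / 5) ^+ m * M @[m --> \oo] --> (0 * M : R))%R.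
    apply: cvgM; last exact: cvg_cst.
    by apply: cvg_expr; rewrite ger0_norm ?divr_ge0//; lra.
  rewrite mul0r => /cvgrPdist_lt /(_ _ c0) [m1 _ m1P].
  exists m1 => m /m1P; rewrite /= sub0r normrN ger0_norm ?mulr_ge0 ?exprn_ge0 ?divr_ge0//.
  rewrite (_ : (3 / 5) ^+ m = (5 / 3) ^ (- m%:Z))%R; last first.
    by rewrite -exprnN -exprVn invf_div.
  by rewrite -(ltr_sqrt _ c0) sqrtr_sqr ger0_norm ?divr_ge0 ?ltW//; lra.
have [j [Lj tx tU]] := n0P (maxn n0 m1) (leq_maxl _ _).
have {m1P} := m1P (maxn n0 m1) (leq_maxr _ _); set m := maxn _ _ in Lj tx tU * => hosc.
have t0 : (0 < (e / 4) ^+ 2 * 3 ^ (- m%:Z))%R by rewrite mulr_gt0 ?exprn_gt0// exprz_gt0.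
have L2small : \forall k \near \oo,
    Lp_norm nuhat 2%:E (u_ k \- u)%R `^ 2 < ((e / 4) ^+ 2 * 3 ^ (- m%:Z))%:E.
  have d0 : (0 < Num.sqrt ((e / 4) ^+ 2 * 3 ^ (- m%:Z)))%R by rewrite sqrtr_gt0.
  apply: filterS (cvge0_lt d0 L2) => k.
  have := Lnorm_ge0 nuhat 2%:E
    (EFin \o ((u_ k \- u)%R \_ inf_gasket : borel_plane R -> R)).
  rewrite -/(Lp_norm nuhat 2%:E _); case: (Lp_norm _ _ _) => // r.
  rewrite lee_fin !lte_fin => r0 rd; rewrite powR_mulrn//.
  by rewrite -[ltRHS]sqr_sqrtr ?ltW// ltr_sqr ?nnegrE// ltW.
near=> k.
have Nk : (N <= k)%N by near: k; exact: nbhs_infty_ge.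
have small : Lp_norm nuhat 2%:E (u_ k \- u)%R `^ 2 < ((e / 4) ^+ 2 * 3 ^ (- m%:Z))%:E.
  by near: k.
have [cuk _ Ek] := pu k.
have [y ty uy] : exists2 y, tile (- m%:Z) j y & (`|u_ k y - u y| < e / 4)%R.
  apply: contrapT => h; move: small; rewrite ltNge => /negP; apply.
  apply: (Lp2_tile_ge (j := j)) => //; first exact: withinB.
    exact: ltW.
  by move=> y ty; rewrite leNgt; apply/negP => ?; apply: h; exists y.
have h1 := tile_oscP Lj cuk Ek tx ty.
have h2 : (tile_osc (- m%:Z) j (u_ k) <= 16 * Num.sqrt ((5 / 3) ^ (- m%:Z) * M))%R.
  apply: le_trans (tile_osc_le _ Lj Ek) _; rewrite ler_wpM2l// ler_wsqrtr//.
  rewrite ler_wpM2l ?exprz_ge0 ?divr_ge0//.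
  by rewrite -lee_fin fineK ?uM// ge0_fin_numE ?inf_energy_ge0.
have h3 := tU y ty (tile_inf_gasket Lj ty).
rewrite distrC; move: uy h1 h3.
rewrite !ltr_norml ler_norml => /andP[? ?] /andP[? ?] /andP[? ?].
by apply/andP; split; lra.
Unshelve. all: by end_near.
Qed.

(** Pointwise convergence with bounded energies allows [inf_energy_fatou]. *)
Lemma domain_energy_lty u : domain nuhat u -> inf_energy u < +oo.
Proof.
move=> du; have [cu _] := du.
have [u_ [M [N [M0 pu uM L2]]]] := domain_bounded du.
apply: le_lt_trans (ltry M); apply: (inf_energy_fatou (u_ := u_)).
  exact: (domain_pointwise cu M0 pu uM L2).
by exists N => // k /= Nk; exact: uM.
Qed.

Lemma domain_L2_lty u : domain nuhat u -> Lp_norm nuhat 2%:E u < +oo.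
Proof.
move=> [cu [u_ [pu _ L2]]].
have [k Lk] : exists k, Lp_norm nuhat 2%:E (u_ k \- u)%R < +oo.
  have [k0 _ k0P] := cvge0_lt ltr01 L2; exists k0.
  by apply: lt_trans (k0P k0 (leqnn _)) _; rewrite ltry.
have [cuk Luk _] := pu k.
rewrite /Lp_norm (_ : u \_ inf_gasket =
    (u_ k \_ inf_gasket) \+ (\- ((u_ k \- u) \_ inf_gasket)))%R; last first.
  by apply/funext => x; rewrite patchB /=; ring.
have mk := measurable_inf_gasket_fun cuk.
have mku := measurable_inf_gasket_fun (withinB cuk cu).
apply: le_lt_trans (minkowski_EFin _ _ _ _) _ => //.
- exact: measurable_funN.
- by rewrite ler1n.
rewrite lte_add_pinfty//.
by rewrite [X in 'N[_]__[X]](_ : _ = \- (EFin \o ((u_ k \- u) \_ inf_gasket)%R)) ?oppe_Lnorm.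
Qed.

End Domain.

Section Exponents.
Context {R : realType}.

Lemma half_inv_delta_s : (2 * delta_s)^-1 = (ln 5 / ln 3 - 1) / 2 :> R.
Proof. by rewrite invfM /delta_s invrK mulrC. Qed.

Lemma sqrt53E (n : int) : Num.sqrt ((5 / 3) ^ n) = 3 `^ (n%:~R * (2 * delta_s)^-1) :> R.
Proof.
have E : 5 / 3 = 3 `^ (ln 5 / ln 3 - 1) :> R.
  rewrite /powR gt_eqF// mulrBl mul1r divfK ?gt_eqF ?ln3_gt0//.
  by rewrite expRB !lnK// posrE.
rewrite -powR12_sqrt ?exprz_ge0// {1}E -powR_intmul ?powR_ge0// -!powRrM half_inv_delta_s.
by congr (_ `^ _); ring.
Qed.

Lemma half_inv_delta_s_gt0 : 0 < (2 * delta_s)^-1 :> R.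
Proof.
rewrite half_inv_delta_s divr_gt0// subr_gt0 ltr_pdivlMr ?ln3_gt0// mul1r.
by rewrite ltr_ln ?posrE// ltr_nat.
Qed.

(** Amounts to ln 5 <= ln 9. Together with 1/q <= 1/2 it gives beta <= 1, so that rounding the scale
    costs at most 3. *)
Lemma half_inv_delta_s_le : (2 * delta_s)^-1 <= 2^-1 :> R.
Proof.
rewrite half_inv_delta_s ler_pdivrMr// mulVf// lerBlDr ler_pdivrMr ?ln3_gt0//.
have -> : (1 + 1) * ln 3 = ln 9 :> R.
  by rewrite mulrDl mul1r -lnM ?posrE// -natrM.
by rewrite ler_ln ?posrE// ler_nat.
Qed.

Lemma recip_ge0 (p : \bar R) : (1 <= p)%E -> 0 <= recip p.
Proof.
case: p => [p||//] p1; rewrite /recip ?invey// inver; case: ifP => //= _.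
by rewrite invr_ge0 (le_trans ler01).
Qed.

Lemma recip_le (p : \bar R) (r : R) : 0 < r -> (r%:E <= p)%E -> recip p <= r^-1.
Proof.
move=> r0; case: p => [p||//] pr; rewrite /recip ?invey/= ?invr_ge0 ?(ltW r0)//.
rewrite lee_fin in pr; have p0 : 0 < p by exact: lt_le_trans pr.
by rewrite inver gt_eqF//= lef_pV2 ?posrE.
Qed.

End Exponents.

(** * The inequality with a constant depending on Csigma only *)

Section Interpolation.
Context {R : realType}.
Context (nu : probability (borel_plane R) R)
  (nuhat : {measure set (borel_plane R) -> \bar R}).
Context (nuP : is_hausdorff_gasket nu) (nuhatP : is_hausdorff_inf_gasket nu nuhat).
Implicit Types (sigma : {measure set (borel_plane R) -> \bar R}) (u : plane R -> R).
Local Open Scope ereal_scope.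

Lemma scale_bound_pow sigma (Cs d : R) (n : int) (p q : \bar R) u (B : R) :
  (1 <= Cs)%R -> (0 < d)%R ->
  (forall j, JL j -> (Cs^-1)%:E * nuhat (tile n j) `^ d^-1 <=
                     sigma (tile n j : set (borel_plane R))) ->
  1 <= p -> p <= q -> 2%:E <= q -> {within inf_gasket, continuous u} ->
  inf_energy u < +oo -> (0 <= B)%R -> Lp_norm sigma p u <= B%:E ->
  Lp_norm nuhat q u <= (16 * (16 + Cs) *
    (3 `^ (n%:~R * (recip q + (2 * delta_s)^-1)) * Num.sqrt (fine (inf_energy u)) +
     3 `^ (- (n%:~R * (recip p / d - recip q))) * B))%:E.
Proof.
move=> Cs1 d0 sP p1 pq q2 cu uoo B0 uB.
have Cs0 : (0 < Cs)%R by rewrite (lt_le_trans ltr01).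
(* The assumed lower bound for [sigma] on tiles of mass 3^n. *)
pose s : R := (Cs^-1 * 3 `^ (n%:~R / d))%R.
have s0 : (0 < s)%R by rewrite mulr_gt0 ?invr_gt0 ?pow3_gt0.
have {}sP j : JL j -> s%:E <= sigma (tile n j : set (borel_plane R)).
  move=> Lj; apply: le_trans (sP j Lj); rewrite (nuhat_tile nuP nuhatP)//.
  by rewrite /s EFinM powRrM powR_intmul.
apply: le_trans (scale_bound nuP nuhatP cu uoo s0 sP p1 pq q2 B0 uB) _.
have rp0 := recip_ge0 p1; have rp1 : (recip p <= 1)%R.
  by rewrite -invr1; apply: recip_le.
rewrite lee_fin sqrtrM ?exprz_ge0 ?divr_ge0// sqrt53E.
set a := Num.sqrt (fine _); have a0 : (0 <= a)%R by exact: sqrtr_ge0.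
have -> : ((3 ^ n) `^ recip q = 3 `^ (n%:~R * recip q) :> R)%R.
  by rewrite powRrM powR_intmul.
have -> : (s `^ (- recip p) = Cs `^ recip p * 3 `^ (- (n%:~R * (recip p / d))))%R.
  rewrite /s powRM ?powR_ge0 ?invr_ge0 ?(ltW Cs0)// -powRrM; congr (_ * _)%R.
    by rewrite -(powR_inv1 (ltW Cs0)) -powRrM mulN1r opprK.
  by congr (_ `^ _)%R; ring.
(* Removes p from the constant, as 1/p <= 1 <= Cs. *)
have CC : (Cs `^ recip p <= Cs)%R.
  by rewrite -[leRHS](powRr1 (ltW Cs0)); exact: (ler_powR Cs1).
rewrite [(n%:~R * (_ + _^-1))%R]mulrDr pow3D.
have -> : (n%:~R * (recip p / d - recip q) =
           n%:~R * (recip p / d) - n%:~R * recip q)%R by rewrite mulrBr.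
rewrite opprB pow3D.
set x := (3 `^ (n%:~R * recip q))%R; set y := (3 `^ (n%:~R * (2 * delta_s)^-1))%R.
set z := (3 `^ (- _))%R.
have x0 : (0 < x)%R by exact: pow3_gt0.
have y0 : (0 < y)%R by exact: pow3_gt0.
have z0 : (0 < z)%R by exact: pow3_gt0.
rewrite -!mulrA ler_pM2l// [leRHS](_ : _ =
   x * ((16 + Cs) * (y * a) + (16 + Cs) * (z * B)))%R; last by ring.
rewrite ler_pM2l// lerD//.
  by rewrite ler_wpM2r ?mulr_ge0 ?(ltW y0)//; lra.
by rewrite ler_wpM2r ?mulr_ge0 ?(ltW z0)//; lra.
Qed.

(** Apply [Lp_norm_sup] with sigma = nuhat and p = 2: as tiles grow, |u(x)| <= 2 * 3^(-n/2) |u|_2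
    tends to 0. This settles the case of zero energy and infinite L^p(sigma)-norm, where the
    convention 0 * oo = 0 may make the right-hand side vanish. *)
Lemma zero_energy_L2_eq0 u : domain nuhat u -> inf_energy u = 0 ->
  forall x, inf_gasket x -> u x = 0%R.
Proof.
move=> du E0 x Kx; have [cu _] := du.
have L2 := domain_L2_lty du.
have L20 : 0 <= Lp_norm nuhat 2%:E u by exact: Lnorm_ge0.
pose B := fine (Lp_norm nuhat 2%:E u).
have uB : Lp_norm nuhat 2%:E u <= B%:E by rewrite fineK// ge0_fin_numE.
have B0 : (0 <= B)%R by exact: fine_ge0.
apply/eqP; rewrite -normr_le0; apply/eqP/eqP.
apply: (@pow3_decay R _ (2 * B) 2^-1) => // n.
have s0 : (0 < (3 : R) ^ n%:Z)%R by rewrite exprz_gt0.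
have sP j : JL j -> (3 ^ n%:Z)%:E <= nuhat (tile n%:Z j : set (borel_plane R)).
  by move=> Lj; rewrite (nuhat_tile nuP nuhatP).
have uoo : inf_energy u < +oo by rewrite E0.
have p1 : 1 <= 2%:E :> \bar R by rewrite lee_fin ler1n.
have := Lp_norm_sup (n := n%:Z) cu uoo s0 sP p1 B0 uB Kx.
rewrite E0 /= mulr0 sqrtr0 mulr0 add0r /recip inver gt_eqF//=.
by rewrite -powR_intmul// -powRrM mulrN mulrA mulrAC.
Qed.

Lemma interpolation_inequality (Cs : R) : (1 <= Cs)%R ->
  forall (p q : \bar R) (dl du : R) sigma,
     1 <= p -> p <= q -> 2%:E <= q -> (0 < dl)%R -> (dl <= du)%R ->
     volume_lower_bound nuhat sigma Cs dl du ->
     forall u : plane R -> R, domain nuhat u ->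
       Lp_norm nuhat q u <= (4 * (16 * (16 + Cs)))%:E *
        (inf_energy u `^ (interp_exponent p q dl / 2) *
           Lp_norm sigma p u `^ (1 - interp_exponent p q dl)
       + inf_energy u `^ (interp_exponent p q du / 2) *
           Lp_norm sigma p u `^ (1 - interp_exponent p q du)).
Proof.
move=> Cs1 p q dl du sigma p1 pq q2 dl0 dldu vlb u domu.
have du0 : (0 < du)%R by exact: lt_le_trans dldu.
have [cu _] := domu.
have uoo := domain_energy_lty nuP nuhatP domu.
have rp0 := recip_ge0 p1.
have rq0 : (0 <= recip q)%R by apply: recip_ge0; exact: le_trans pq.
have rq2 : (recip q <= 2^-1)%R by apply: recip_le.
have hs0 := @half_inv_delta_s_gt0 R; have hs1 := @half_inv_delta_s_le R.
have pd0 d : (0 < d)%R -> (0 <= recip p / d)%R by move=> ?; rewrite divr_ge0// ltW.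
have vlt0 n : (n < 0)%R -> forall j, JL j ->
    (Cs^-1)%:E * nuhat (tile n j) `^ dl^-1 <= sigma (tile n j : set (borel_plane R)).
  move=> n0 j Lj; have [|h _] := vlb (tile n j) _ (tile_inf_gasket Lj).
    by apply/dyadic_triangleP; exists n, j.
  apply: h; rewrite diam_tile exp2z_gt0/=.
  by move: n0; case: n => // n _; rewrite NegzE -exprnN invf_lt1 ?exprn_gt0// exprn_egt1 ?ltr1n.
have vge0 n : (0 <= n)%R -> forall j, JL j ->
    (Cs^-1)%:E * nuhat (tile n j) `^ du^-1 <= sigma (tile n j : set (borel_plane R)).
  move=> n0 j Lj; have [|_ h] := vlb (tile n j) _ (tile_inf_gasket Lj).
    by apply/dyadic_triangleP; exists n, j.
  by apply: h; rewrite diam_tile; move: n0; case: n => // n _; rewrite exprn_ege1// ler1n.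
have ieE d : interp_exponent p q d =
    expo (recip p / d - recip q) (recip q + (2 * delta_s)^-1).
  by rewrite /interp_exponent /expo; congr (Num.max (_ / _) _)%R; ring.
have ie_ge0 d : (0 <= interp_exponent p q d)%R by rewrite /interp_exponent le_max lexx orbT.
have ie_lt1 d : (0 < d)%R -> (interp_exponent p q d < 1)%R.
  move=> d0; have := pd0 d d0 => pdd.
  by rewrite /interp_exponent gt_max ltr01 andbT ltr_pdivrMr; lra.
have K0 : (0 <= 16 * (16 + Cs))%R by rewrite mulr_ge0// addr_ge0// (le_trans ler01).
set a1 := interp_exponent p q dl; set a2 := interp_exponent p q du.
have N0 : 0 <= Lp_norm sigma p u by exact: Lnorm_ge0.
have E0 := inf_energy_ge0 u.
have T0 x : 0 <= inf_energy u `^ (x / 2) * Lp_norm sigma p u `^ (1 - x).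
  by rewrite mule_ge0 ?poweR_ge0.
(* An infinite norm makes the right-hand side infinite if the energy is positive, because 1 - a1 >
   0. *)
have [Noo|Nfin] := eqVneq (Lp_norm sigma p u) +oo.
  have [Ez|Ez] := eqVneq (inf_energy u) 0.
    have u0 := zero_energy_L2_eq0 domu Ez.
    rewrite [leLHS](_ : _ = 0); last first.
      rewrite /Lp_norm (_ : EFin \o _ = cst 0).
        by rewrite Lnorm0// gt_eqF// (lt_le_trans _ q2).
      by apply/funext => x /=; rewrite patchE; case: ifPn => // /set_mem /u0 ->.
    by rewrite mule_ge0 ?adde_ge0// lee_fin mulr_ge0.
  have Ep : 0 < inf_energy u by rewrite lt_def Ez E0.
  rewrite (_ : inf_energy u `^ (a1 / 2) * _ = +oo); last first.
    rewrite Noo poweRyr ?gt0_muley ?poweR_gt0//.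
    by rewrite subr_eq0 gt_eqF// ie_lt1.
  rewrite addye; last by rewrite -ltNye (lt_le_trans _ (T0 _)).
  by rewrite gt0_muley ?leey// lte_fin mulr_gt0// mulr_gt0// addr_gt0// (lt_le_trans ltr01).
pose B := fine (Lp_norm sigma p u).
have BE : Lp_norm sigma p u = B%:E by rewrite fineK// ge0_fin_numE// ltey.
have B0 : (0 <= B)%R by exact: fine_ge0.
pose e := fine (inf_energy u).
have eE : inf_energy u = e%:E by rewrite fineK// ge0_fin_numE.
have e0 : (0 <= e)%R by exact: fine_ge0.
have uB : Lp_norm sigma p u <= B%:E by rewrite BE.
have bound d n : (0 < d)%R -> (forall j, JL j -> (Cs^-1)%:E * nuhat (tile n j) `^ d^-1 <=
                     sigma (tile n j : set (borel_plane R))) ->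
   Lp_norm nuhat q u <= (16 * (16 + Cs) *
    (3 `^ (n%:~R * (recip q + (2 * delta_s)^-1)) * Num.sqrt e +
     3 `^ (- (n%:~R * (recip p / d - recip q))) * B))%:E.
  by move=> d0 sP; apply: scale_bound_pow uB.
have [L LE] : exists L : R, Lp_norm nuhat q u = L%:E.
  exists (fine (Lp_norm nuhat q u)); rewrite fineK// ge0_fin_numE; last exact: Lnorm_ge0.
  by apply: le_lt_trans (bound du 0%R du0 (vge0 0%R isT)) _; rewrite ltry.
rewrite LE eE BE !poweR_EFin -!(EFinM (e `^ _)) -EFinD -EFinM lee_fin.
have sqE x : (e `^ (x / 2) = Num.sqrt e `^ x)%R.
  by rewrite -powR12_sqrt// -powRrM mulrC.
rewrite !sqE /a1 /a2 !ieE; apply: optimize => //.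
- exact: ltr_wpDl.
- by lra.
- by rewrite lerD2r ler_wpM2l// lef_pV2 ?posrE.
- by have := pd0 du du0; lra.
(* Tiles of diameter 1 are governed by [du], but at n = 0 the two exponents give the same bound. *)
- move=> n; rewrite le_eqVlt => /predU1P[->|n0].
    rewrite -lee_fin -LE; apply: le_trans (bound du 0%R du0 (vge0 0%R isT)) _.
    by rewrite !mul0r.
  by rewrite -lee_fin -LE; apply: bound (vlt0 n n0).
- by move=> n n0; rewrite -lee_fin -LE; apply: bound (vge0 n n0).
Qed.

End Interpolation.

(** * Test functions and optimality *)

Section Harmonic.
Context {R : realType}.
Implicit Types (x y : plane R) (i j : 'I_3) (v : 'I_3 -> R) (f : 'I_3 -> plane R -> R).

Definition Finv i x : plane R := 2 *: x - corner i.

Lemma FK i : cancel (@F R i) (Finv i).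
Proof. by move=> x; rewrite /Finv /F scalerA mulfV// scale1r addrK. Qed.

Lemma Finv_continuous i : continuous (Finv i).
Proof.
rewrite (_ : Finv i = fun x => 2 *: (x + - (2^-1 *: corner i))).
  exact: continuous_affine.
by apply/funext => x; rewrite /Finv scalerDr scalerN scalerA mulfV// scale1r.
Qed.

(** Glues functions given on the three cells. The cells are told apart by half-plane tests; a shared
    midpoint may pass several of them, and [paste_F] shows that the choice is immaterial if the
    values match there. *)
Definition paste f x : R :=
  if cs x + ct x <= 2^-1 then f i0 (Finv i0 x)
  else if 2^-1 <= cs x then f i1 (Finv i1 x) else f i2 (Finv i2 x).

Lemma paste_F f i x : (forall i j, f i (corner j) = f j (corner i)) ->
  gasket x -> paste f (F i x) = f i x.
Proof.
move=> match_ /gasket_triangle[x1 x2 x3].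
have x0 : cs x + ct x <= 0 -> x = corner i0.
  by move=> ?; apply: coord_inj; rewrite ?cs_corner ?ct_corner /es /et/=; lra.
have x1' : 1 <= cs x -> x = corner i1.
  by move=> ?; apply: coord_inj; rewrite ?cs_corner ?ct_corner /es /et/=; lra.
rewrite /paste cs_F ct_F; elim/ord3P: i; rewrite /es /et/=.
- by rewrite ifT ?FK//; lra.
- case: ifPn => h.
    have -> : x = corner i0 by apply: x0; lra.
    by rewrite F_corner_sym FK match_.
  by rewrite ifT ?FK//; lra.
- case: ifPn => h.
    have -> : x = corner i0 by apply: x0; lra.
    by rewrite F_corner_sym FK match_.
  case: ifPn => h'; last by rewrite FK.
  have -> : x = corner i1 by apply: x1'; lra.
  by rewrite F_corner_sym FK match_.
Qed.

Lemma paste_continuous f : (forall i j, f i (corner j) = f j (corner i)) ->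
  (forall i, {within gasket, continuous (f i)}) -> {within gasket, continuous (paste f)}.
Proof.
move=> match_ cf.
have cell_cont i : {within F i @` gasket, continuous (paste f)}.
  apply/within_continuousP => _ [x gx <-] e e0.
  have := (within_continuousP _ _).1 (cf i) x gx e e0.
  rewrite -{1}(FK i x) => /(Finv_continuous (i := i)) N.
  apply: (@filterS _ (nbhs (F i x)) _ _ _ _ N) => z /= + [y gy yz].
  by rewrite -yz !paste_F// !FK; apply.
have closedF i : closed (F i @` @gasket R).
  by apply: closed_affine; [rewrite invr_neq0|exact: closed_gasket].
rewrite (_ : gasket = F i0 @` gasket `|` F i1 @` gasket `|` F i2 @` gasket).
  apply: withinU_continuous => //; first exact: closedU.
  exact: withinU_continuous.
apply/seteqP; split=> x.
  by move=> /gasketP[i [y [gy ->]]]; elim/ord3P: i; [left; left|left; right|right]; exists y.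
by move=> [[|]|] [y gy <-]; exact: F_gasket.
Qed.

(* Corner values on the cell [F i] of the harmonic extension of [v]. *)
Definition harm i v j : R := if i == j then v i else (v i + v j + \sum_k v k) / 5.

Lemma harm_sym i j v : harm i v j = harm j v i.
Proof. by rewrite /harm eq_sym; case: eqP => [->//|_]; rewrite [v i + v j]addrC. Qed.

Lemma harm_ge i v (lo : R) : (forall j, lo <= v j) -> forall j, lo <= harm i v j.
Proof.
move=> lov j; have := lov i0; have := lov i1; have := lov i2.
by rewrite /harm sum3E; elim/ord3P: i; elim/ord3P: j => /=; lra.
Qed.

Lemma harm_le i v (hi : R) : (forall j, v j <= hi) -> forall j, harm i v j <= hi.
Proof.
move=> vhi j; have := vhi i0; have := vhi i1; have := vhi i2.
by rewrite /harm sum3E; elim/ord3P: i; elim/ord3P: j => /=; lra.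
Qed.

(** This contraction makes the approximations converge uniformly. *)
Lemma harm_osc i v (d : R) : (forall j k, v j - v k <= d) ->
  forall j k, harm i v j - harm i v k <= d * (3 / 5).
Proof.
move=> vd j k.
have := vd i0 i1; have := vd i0 i2; have := vd i1 i2.
have := vd i1 i0; have := vd i2 i0; have := vd i2 i1.
by rewrite /harm sum3E; elim/ord3P: i; elim/ord3P: j; elim/ord3P: k => /=; lra.
Qed.

(** n harmonic subdivisions followed by affine interpolation in the cells. As a uniform limit of
    such functions, the harmonic function needs no extension from the vertices. *)
Fixpoint harmonic_approx n v : plane R -> R :=
  if n is m.+1 then paste (fun i => harmonic_approx m (harm i v))
  else fun x => v i0 + cs x * (v i1 - v i0) + ct x * (v i2 - v i0).

Lemma harmonic_approx_corner n v i : harmonic_approx n v (corner i) = v i.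
Proof.
elim: n v i => [|n IH] v i /=.
  by rewrite cs_corner ct_corner; elim/ord3P: i; rewrite /es /et/=; ring.
rewrite -{1}F_corner paste_F//; last exact: corner_gasket.
  by rewrite IH /harm eqxx.
by move=> j k; rewrite !IH harm_sym.
Qed.

Lemma harmonic_approx_match n v i j :
  harmonic_approx n (harm i v) (corner j) = harmonic_approx n (harm j v) (corner i).
Proof. by rewrite !harmonic_approx_corner harm_sym. Qed.

Lemma harmonic_approx_F n v i x : gasket x ->
  harmonic_approx n.+1 v (F i x) = harmonic_approx n (harm i v) x.
Proof. by move=> gx /=; rewrite paste_F// => j k; exact: harmonic_approx_match. Qed.

Lemma harmonic_approx_continuous n v : {within gasket, continuous (harmonic_approx n v)}.
Proof.
elim: n v => [|n IH] v /=; last first.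
  by apply: paste_continuous => // i j; exact: harmonic_approx_match.
apply: continuous_subspaceT => x.
apply: (@continuousD _ _ _ (fun x => v i0 + cs x * (v i1 - v i0))).
  apply: continuousD; first exact: cvg_cst.
  by apply: (@continuousM R _ cs (cst _)); [exact: continuous_cs|exact: cvg_cst].
by apply: (@continuousM R _ ct (cst _)); [exact: continuous_ct|exact: cvg_cst].
Qed.

Lemma harmonic_approx_ge n v (lo : R) x : gasket x -> (forall j, lo <= v j) ->
  lo <= harmonic_approx n v x.
Proof.
elim: n v x => [|n IH] v x gx lov.
  have [x1 x2 x3] := gasket_triangle gx; rewrite -subr_ge0 /=.
  have := (lov i0, lov i1, lov i2) => -[[? ?] ?].
  rewrite [X in 0 <= X](_ : _ = (1 - cs x - ct x) * (v i0 - lo) +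
    cs x * (v i1 - lo) + ct x * (v i2 - lo)); last by ring.
  by apply: addr_ge0; [apply: addr_ge0|]; apply: mulr_ge0; lra.
have [i [y [gy ->]]] := gasketP gx; rewrite harmonic_approx_F//.
by apply: IH => //; exact: harm_ge.
Qed.

Lemma harmonic_approx_le n v (hi : R) x : gasket x -> (forall j, v j <= hi) ->
  harmonic_approx n v x <= hi.
Proof.
elim: n v x => [|n IH] v x gx vhi.
  have [x1 x2 x3] := gasket_triangle gx; rewrite -subr_ge0 /=.
  have := (vhi i0, vhi i1, vhi i2) => -[[? ?] ?].
  rewrite [X in 0 <= X](_ : _ = (1 - cs x - ct x) * (hi - v i0) +
    cs x * (hi - v i1) + ct x * (hi - v i2)); last by ring.
  by apply: addr_ge0; [apply: addr_ge0|]; apply: mulr_ge0; lra.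
have [i [y [gy ->]]] := gasketP gx; rewrite harmonic_approx_F//.
by apply: IH => //; exact: harm_le.
Qed.

Lemma argmin3 v : exists k, forall j, v k <= v j.
Proof.
have [h01|/ltW h01] := leP (v i0) (v i1); have [h02|/ltW h02] := leP (v i0) (v i2);
  have [h12|/ltW h12] := leP (v i1) (v i2).
all: try by exists i0; elim/ord3P; rewrite ?lexx//; lra.
all: try by exists i1; elim/ord3P; rewrite ?lexx//; lra.
all: by exists i2; elim/ord3P; rewrite ?lexx//; lra.
Qed.

(** On a cell of level n both functions stay between the extreme corner values of that cell, whose
    spread is at most d (3/5)^n. *)
Lemma harmonic_approx_cauchy n k v (d : R) x : gasket x ->
  (forall i j, v i - v j <= d) ->
  `|harmonic_approx n v x - harmonic_approx (n + k) v x| <= d * (3 / 5) ^+ n.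
Proof.
elim: n v x d => [|n IH] v x d gx vd.
  have [m mv] := argmin3 v; have [l lv] := argmin3 (fun i => - v i).
  have lv' j : v j <= v l by have := lv j; lra.
  have := harmonic_approx_ge 0 gx mv; have := harmonic_approx_le 0 gx lv'.
  have := harmonic_approx_ge (0 + k) gx mv; have := harmonic_approx_le (0 + k) gx lv'.
  have := vd l m; rewrite expr0 mulr1 ler_norml => *; apply/andP; split; lra.
have [i [y [gy ->]]] := gasketP gx; rewrite addSn !harmonic_approx_F//.
by rewrite exprS mulrA; apply: IH => //; exact: harm_osc.
Qed.

Definition harmonic v x : R := lim (harmonic_approx n v x @[n --> \oo]).

Definition osc3 v : R := \sum_i \sum_j `|v i - v j|.

Lemma osc3_ge0 v : 0 <= osc3 v.
Proof. by rewrite sumr_ge0// => i _; rewrite sumr_ge0. Qed.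

Lemma osc3P v i j : v i - v j <= osc3 v.
Proof.
apply: le_trans (ler_norm _) _; rewrite /osc3 (bigD1 i)//= (bigD1 j)//= -addrA.
by rewrite lerDl addr_ge0// sumr_ge0// => k _; rewrite sumr_ge0.
Qed.

Lemma pow35_cvg (d : R) : d * (3 / 5) ^+ n @[n --> \oo] --> 0.
Proof.
rewrite -[X in _ --> X](mulr0 d); apply: cvgM; first exact: cvg_cst.
by apply: cvg_expr; rewrite ger0_norm ?divr_ge0//; lra.
Qed.

Lemma harmonic_cvg v x : gasket x ->
  harmonic_approx n v x @[n --> \oo] --> harmonic v x.
Proof.
move=> gx; apply/cauchy_cvgP/cauchy_exP => e e0.
have /cvgrPdist_lt /(_ e e0) [n _ nP] := pow35_cvg (osc3 v).
exists (harmonic_approx n v x); exists n => // m /= nm.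
have := nP n (leqnn n); rewrite /= sub0r normrN ger0_norm ?mulr_ge0 ?osc3_ge0 ?exprn_ge0//.
by apply: le_lt_trans; rewrite -(subnKC nm); apply: harmonic_approx_cauchy => //; exact: osc3P.
Qed.

Lemma harmonic_dist n v x : gasket x ->
  `|harmonic_approx n v x - harmonic v x| <= osc3 v * (3 / 5) ^+ n.
Proof.
move=> gx; apply: (@cvgr_to_le _ \oo _ _
    (fun m => `|harmonic_approx n v x - harmonic_approx m v x|)).
  apply: cvg_norm; apply: cvgB; first exact: cvg_cst.
  exact: harmonic_cvg.
exists n => // m /= nm; rewrite -(subnKC nm).
by apply: harmonic_approx_cauchy => //; exact: osc3P.
Qed.

Lemma harmonic_corner v i : harmonic v (corner i) = v i.
Proof.
apply: cvg_lim => //; rewrite (_ : (fun n => _) = cst (v i)); first exact: cvg_cst.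
by apply/funext => n; rewrite harmonic_approx_corner.
Qed.

Lemma harmonic_F v i x : gasket x -> harmonic v (F i x) = harmonic (harm i v) x.
Proof.
move=> gx; have h := @harmonic_cvg v _ (F_gasket (i := i) gx).
rewrite -cvg_shiftS in h; apply: (cvg_unique _ h) => //.
rewrite [X in X @ _](_ : _ = fun n => harmonic_approx n (harm i v) x).
  exact: harmonic_cvg.
by apply/funext => n /=; rewrite -harmonic_approx_F.
Qed.

Lemma harmonic_ge v (lo : R) x : gasket x -> (forall j, lo <= v j) -> lo <= harmonic v x.
Proof.
move=> gx lov; apply: (cvgr_to_ge (harmonic_cvg gx)).
by apply: nearW => n; exact: harmonic_approx_ge.
Qed.

Lemma harmonic_le v (hi : R) x : gasket x -> (forall j, v j <= hi) -> harmonic v x <= hi.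
Proof.
move=> gx vhi; apply: (cvgr_to_le (harmonic_cvg gx)).
by apply: nearW => n; exact: harmonic_approx_le.
Qed.

Lemma harmonic_continuous v : {within gasket, continuous (harmonic v)}.
Proof.
apply/within_continuousP => x gx e e0.
have e30 : 0 < e / 3 by rewrite divr_gt0.
have /cvgrPdist_lt /(_ _ e30) [n _ nP] := pow35_cvg (osc3 v).
have {nP} := nP n (leqnn n).
rewrite /= sub0r normrN ger0_norm ?mulr_ge0 ?osc3_ge0 ?exprn_ge0// => ne.
have N := (within_continuousP _ _).1 (@harmonic_approx_continuous n v) x gx _ e30.
apply: (@filterS _ (nbhs x) _ _ _ _ N) => y h gy.
have := h gy; have := harmonic_dist n v gx; have := harmonic_dist n v gy.
move=> /le_lt_trans /(_ ne) + /le_lt_trans /(_ ne).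
rewrite !ltr_norml => /andP[? ?] /andP[? ?] /andP[? ?].
by apply/andP; split; lra.
Qed.

(** The equality case of [energy_approx01]: [harm] gives the minimizing midpoint values, so
    subdivision leaves the energy unchanged. *)
Lemma energy_approx_harmonic m v :
  energy_approx m (harmonic v) = 2^-1 * \sum_i \sum_j (v i - v j) ^+ 2.
Proof.
elim: m v => [|m IH] v.
  rewrite energy_approx0; congr (_ * _); apply: eq_bigr => i _; apply: eq_bigr => j _.
  by rewrite !harmonic_corner.
have E i : energy_approx m (harmonic v \o F i) = energy_approx m (harmonic (harm i v)).
  by apply: eq_energy_approx => x; rewrite inE => gx /=; rewrite harmonic_F.
by rewrite energy_approxS sum3E !E !IH !sum3E /harm !sum3E /=; field.
Qed.

Lemma energy_harmonic v : (energy (harmonic v) < +oo)%E.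
Proof.
apply: (@le_lt_trans _ _ (2^-1 * \sum_i \sum_j (v i - v j) ^+ 2)%:E); last exact: ltry.
by apply: energy_le => m; rewrite energy_approx_harmonic.
Qed.

(** Value 0 at the corners and 1 at the three midpoints, harmonic in each half-size cell. *)
Definition tent : plane R -> R := paste (fun i => harmonic (fun j => (i != j)%:R)).

Lemma tent_match i j : harmonic (fun k => (i != k)%:R) (corner j) =
  harmonic (fun k => (j != k)%:R) (corner i).
Proof. by rewrite !harmonic_corner eq_sym. Qed.

Lemma tent_F i x : gasket x -> tent (F i x) = harmonic (fun j => (i != j)%:R) x.
Proof. by move=> gx; rewrite /tent paste_F//; exact: tent_match. Qed.

Lemma tent_continuous : {within gasket, continuous tent}.
Proof.
by apply: paste_continuous => *; [exact: tent_match|exact: harmonic_continuous].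
Qed.

Lemma tent_corner i : tent (corner i) = 0.
Proof.
by rewrite -F_corner tent_F ?harmonic_corner ?eqxx//; exact: corner_gasket.
Qed.

Lemma tent_range x : gasket x -> 0 <= tent x <= 1.
Proof.
move=> /gasketP[i [y [gy ->]]]; rewrite tent_F//; apply/andP; split.
  by apply: harmonic_ge => // j; rewrite ler0n.
by apply: harmonic_le => // j; rewrite lern1 leq_b1.
Qed.

(** The corner values on this cell are 3/5, 1 and 4/5. *)
Lemma tent_ge x : gasket x -> 3 / 5 <= tent (F i0 (F i1 x)).
Proof.
move=> gx; rewrite tent_F ?harmonic_F//; last exact: F_gasket.
by apply: harmonic_ge => //; elim/ord3P; rewrite /harm !sum3E /=; lra.
Qed.

Lemma tent_energy : (energy tent < +oo)%E.
Proof.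
rewrite energy_self.
have E i : energy (tent \o F i) = energy (harmonic (fun j => (i != j)%:R)).
  by apply: eq_energy => x; rewrite inE => gx /=; rewrite tent_F.
rewrite sum3E !E lte_mul_pinfty ?lee_fin ?divr_ge0//.
by rewrite !lte_add_pinfty ?energy_harmonic.
Qed.

End Harmonic.

(** * Copies of the tent on tiles *)

Section Bump.
Context {R : realType}.
Implicit Types (x y : plane R) (n : int) (j k : idx) (u : plane R -> R).

Definition tau_inv j x : plane R := (-1) ^+ j.1 *: x - nvec j.2.

Lemma tauK j : cancel (@tau R j) (tau_inv j).
Proof. by move=> x; rewrite /tau_inv /tau scalerA -expr2 sqrr_sign scale1r addrK. Qed.

Lemma tau_inv_continuous j : continuous (tau_inv j).
Proof.
rewrite (_ : tau_inv j = fun x => (-1) ^+ j.1 *: (x + - ((-1) ^+ j.1 *: nvec j.2))).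
  exact: continuous_affine.
by apply/funext => x; rewrite scalerDr scalerN scalerA -expr2 sqrr_sign scale1r.
Qed.

Definition unit_bump j x : R := if x \in tile 0 j then tent (tau_inv j x) else 0.

Lemma unit_bump_tau j y : gasket y -> unit_bump j (tau j y) = tent y.
Proof.
move=> gy; rewrite /unit_bump mem_set ?tauK//.
by exists y => //; rewrite phi0.
Qed.

Lemma unit_bump_out j x : ~ tile 0 j x -> unit_bump j x = 0.
Proof. by move=> nx; rewrite /unit_bump memNset. Qed.

Lemma unit_bump_range j x : 0 <= unit_bump j x <= 1.
Proof.
have [[y gy <-]|nx] := pselect (tile 0 j x); last by rewrite unit_bump_out// lexx ler01.
by rewrite phi0 unit_bump_tau// tent_range.
Qed.

(** Off the closed tile the function is locally 0; at a corner the tent vanishes and agrees with the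
    value 0 outside; at any other point of the tile, the tile is a neighborhood within the infinite
    gasket by [unit_tile_nbhs]. *)
Lemma unit_bump_continuous j : {within inf_gasket, continuous (unit_bump j)}.
Proof.
apply/within_continuousP => x Kx e e0.
have [tx|nx] := pselect (tile 0 j x); last first.
  have : nbhs x (~` tile 0 j).
    by apply: open_nbhs_nbhs; split=> //; rewrite openC; exact: closed_tile.
  by apply: filterS => y ny _; rewrite !unit_bump_out// subrr normr0.
have cont_tile : \forall y \near x, tile 0 j y -> `|unit_bump j x - unit_bump j y| < e.
  case: tx => z gz; rewrite phi0 => zx; rewrite -zx unit_bump_tau//.
  have := (within_continuousP _ _).1 tent_continuous z gz e e0.
  rewrite -{1}(tauK j z) => /(tau_inv_continuous (j := j)) N.
  apply: (@filterS _ (nbhs (tau j z)) _ _ _ _ N) => w /= + [v gv vw].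
  by rewrite -vw phi0 unit_bump_tau// tauK; apply.
case: j tx cont_tile => e' [a b] [z gz zx] cont_tile.
have xz : (-1) ^+ e' *: x = z + nvec (a, b).
  by rewrite -zx phi0 /tau scalerA -expr2 sqrr_sign scale1r.
have [[s1 t1] st0] : (cs ((-1) ^+ e' *: x) = cs z + a%:R /\
   ct ((-1) ^+ e' *: x) = ct z + b%:R) /\ True.
  by rewrite xz csD ctD cs_vec ct_vec.
have [z1 z2 z3] := gasket_triangle gz.
have [corner_z|ncorner_z] := pselect (range corner z).
  have bx : unit_bump (e', (a, b)) x = 0.
    by rewrite -zx phi0 unit_bump_tau//; case: corner_z => i _ <-; exact: tent_corner.
  move: cont_tile; apply: filterS => y h _.
  have [ty|ny] := pselect (tile 0 (e', (a, b)) y); first exact: h.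
  by rewrite bx unit_bump_out// subrr normr0.
have nc i : ~ (cs z = es i /\ ct z = et i).
  move=> [cz cz']; apply: ncorner_z; exists i => //.
  by apply: coord_inj; rewrite ?cs_corner ?ct_corner.
have c1 : cs z < 1.
  rewrite ltNge; apply/negP => ?; apply: (nc i1).
  by rewrite /es /et/=; split; lra.
have c2 : ct z < 1.
  rewrite ltNge; apply/negP => ?; apply: (nc i2).
  by rewrite /es /et/=; split; lra.
have c3 : 0 < cs z + ct z.
  rewrite ltNge; apply/negP => ?; apply: (nc i0).
  by rewrite /es /et/=; split; lra.
have sgn_cont : continuous (fun y : plane R => (-1) ^+ e' *: y).
  rewrite (_ : (fun _ => _) = fun y : plane R => (-1) ^+ e' *: (y + 0)).
    exact: continuous_affine.
  by apply/funext => y; rewrite addr0.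
have ccs : continuous (fun y : plane R => cs ((-1) ^+ e' *: y)).
  by move=> y; apply: continuous_comp; [exact: sgn_cont|exact: continuous_cs].
have cct : continuous (fun y : plane R => ct ((-1) ^+ e' *: y)).
  by move=> y; apply: continuous_comp; [exact: sgn_cont|exact: continuous_ct].
have n1 : \forall y \near x, cs ((-1) ^+ e' *: y) < a%:R + 1.
  by apply: (cvgr_lt _ (ccs x)); rewrite s1; lra.
have n2 : \forall y \near x, ct ((-1) ^+ e' *: y) < b%:R + 1.
  by apply: (cvgr_lt _ (cct x)); rewrite t1; lra.
have n3 : \forall y \near x, a%:R + b%:R < cs ((-1) ^+ e' *: y) + ct ((-1) ^+ e' *: y).
  apply: (cvgr_gt _ (cvgD (ccs x) (cct x))).
  by rewrite s1 t1; lra.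
near=> y => Ky.
have hc : tile 0 (e', (a, b)) y -> `|unit_bump (e', (a, b)) x - unit_bump (e', (a, b)) y| < e.
  by near: y.
by apply: hc; apply: unit_tile_nbhs => //; near: y.
Unshelve. all: by end_near.
Qed.

(** Other tiles meet tile j only at its corners, where the tent vanishes, so the bump is zero on
    them. *)
Lemma unit_bump_energy j : JL j -> inf_energy (unit_bump j) = energy (@tent R).
Proof.
move=> Lj; rewrite inf_energyE /tile_energy.
have other k : k <> j -> energy (unit_bump j \o phi 0 k) = 0%E.
  move=> kj; rewrite -(energy_cst 0); apply: eq_energy => x; rewrite inE => gx /=.
  have [[y gy yx]|] := pselect (tile 0 j (phi 0 k x)); last exact: unit_bump_out.
  have yx' : tau k x = tau j y by rewrite -!phi0.
  have [_ [i _ iy]] := tau_meet kj (gasket_triangle gx) (gasket_triangle gy) yx'.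
  by rewrite phi0 yx' unit_bump_tau// -iy tent_corner.
transitivity (\esum_(k in JL) if k \in [set j] then energy (unit_bump j \o phi 0 k) else 0)%E.
  by apply: eq_esum => k _; case: ifPn => //; rewrite notin_setE => /other.
rewrite -esum_mkcondr (_ : JL `&` [set j] = [set j]); last first.
  by apply/seteqP; split=> k; [case|move=> ->].
rewrite esum_set1 ?energy_ge0//; apply: eq_energy => x; rewrite inE => gx /=.
by rewrite phi0 unit_bump_tau.
Qed.

Definition bump n j x : R := unit_bump j (2 ^ (- n) *: x).

Lemma bump_phi n j y : gasket y -> bump n j (phi n j y) = tent y.
Proof.
by move=> gy; rewrite /bump /phi scalerA -expfzDr// addNr scale1r unit_bump_tau.
Qed.

Lemma bump_out n j x : ~ tile n j x -> bump n j x = 0.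
Proof.
move=> nx; apply: unit_bump_out => -[y gy yx]; apply: nx; exists y => //.
by rewrite phi_tau yx scalerA -expfzDr// subrr scale1r.
Qed.

Lemma bump_range n j x : 0 <= bump n j x <= 1.
Proof. exact: unit_bump_range. Qed.

Lemma bump_continuous n j : {within inf_gasket, continuous (bump n j)}.
Proof.
apply/within_continuousP => x Kx e e0.
have := (within_continuousP _ _).1 (@unit_bump_continuous j) _ (inf_gasket_scale (- n) Kx) e e0.
have sc : continuous (fun y : plane R => 2 ^ (- n) *: y).
  rewrite (_ : (fun _ => _) = fun y : plane R => 2 ^ (- n) *: (y + 0)).
    exact: continuous_affine.
  by apply/funext => y; rewrite addr0.
move=> /sc N; apply: (@filterS _ (nbhs x) _ _ _ _ N) => y /= h Ky.
by apply: h; exact: inf_gasket_scale.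
Qed.

Lemma bump_energy n j : JL j ->
  inf_energy (bump n j) = (((5 / 3) ^ (- n))%:E * energy (@tent R))%E.
Proof.
move=> Lj; rewrite -(unit_bump_energy Lj) -tile_energyE inf_energyE.
apply: eq_esum => k _; congr energy; apply/funext => x /=.
by rewrite /bump phi0.
Qed.

Local Open Scope ereal_scope.
Implicit Types (mu : {measure set (borel_plane R) -> \bar R}).

Lemma Lp_norm_le_tile mu (p : \bar R) u n j : {within inf_gasket, continuous u} ->
  1 <= p -> (forall x, 0 <= u x <= 1)%R -> (forall x, ~ tile n j x -> u x = 0%R) ->
  Lp_norm mu p u <= mu (tile n j : set (borel_plane R)) `^ recip p.
Proof.
move=> cu p1 u01 u0.
have w01 x : (0 <= (u \_ inf_gasket) x <= 1)%R.
  by rewrite patchE; case: ifP => _; rewrite ?u01// lexx ler01.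
have w0 x : ~ tile n j x -> (u \_ inf_gasket) x = 0%R.
  by move=> nx; rewrite patchE; case: ifP => // _; exact: u0.
case: p p1 => [p||//] p1; last first.
  rewrite /recip invey/= poweRe0 /Lp_norm unlock; case: ifPn => // _.
  apply/ess_supP; apply: nearW => x /=; rewrite lee_fin.
  by have /andP[? ?] := w01 x; rewrite ger0_norm.
rewrite lee_fin in p1; have p0 : (0 < p)%R by exact: lt_le_trans p1.
rewrite /recip inver gt_eqF//= /Lp_norm unlock.
apply: gt0_ler_poweR; rewrite ?invr_ge0 ?(ltW p0)//.
- by rewrite in_itv/= leey integral_ge0// => x _; exact: poweR_ge0.
- by rewrite in_itv/= leey measure_ge0.
rewrite -[leRHS]mul1e -integral_cst; last exact: measurable_tile.
rewrite [leRHS]integral_mkcond.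
have mw := measurable_inf_gasket_fun cu.
apply: ge0_le_integral => //.
- by move=> x _; exact: poweR_ge0.
- apply: (@eq_measurable_fun _ _ _ _ setT
    (fun x : borel_plane R => (`|(u \_ inf_gasket) x| `^ p)%:E)) => //.
  apply/measurable_EFinP.
  by apply: (measurableT_comp (measurable_powR p)); exact: measurableT_comp.
- apply/(measurable_restrictT _ (measurable_tile n j)); exact: measurable_cst.
move=> x _; rewrite patchE; case: ifPn => [_|].
  have /andP[? ?] := w01 x; rewrite /= lee_fin.
  apply: (@le_trans _ _ (1 `^ p)%R); last by rewrite powR1.
  by rewrite ler_powRl ?(ltW p0)// ger0_norm.
by rewrite notin_setE => /w0 /= ->; rewrite normr0 powR0// gt_eqF.
Qed.

Context (nu : probability (borel_plane R) R)
  (nuhat : {measure set (borel_plane R) -> \bar R}).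
Context (nuP : is_hausdorff_gasket nu) (nuhatP : is_hausdorff_inf_gasket nu nuhat).

Lemma Lp_norm_ge_tile (q : \bar R) u n j (c : R) : {within inf_gasket, continuous u} ->
  JL j -> 1 <= q -> (0 <= c)%R -> (forall x, tile n j x -> (c <= u x)%R) ->
  (c * (3 ^ n) `^ recip q)%:E <= Lp_norm nuhat q u.
Proof.
move=> cu Lj q1 c0 cx.
have wx x : tile n j x -> (c <= `|(u \_ inf_gasket) x|)%R.
  move=> tx; rewrite patchE mem_set; last exact: (tile_inf_gasket Lj tx).
  by rewrite (le_trans (cx x tx))// ler_norm.
have t0 : (0 < (3 : R) ^ n)%R by rewrite exprz_gt0.
have tile0 : 0 < nuhat (tile n j : set (borel_plane R)).
  by rewrite (nuhat_tile nuP nuhatP)// lte_fin.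
case: q q1 => [q||//] q1; last first.
  rewrite /recip invey/= powRr0 mulr1 /Lp_norm unlock ifT; last first.
    apply: lt_le_trans tile0 _; rewrite le_measure ?inE//; exact: measurable_tile.
  rewrite leNgt; apply/negP => lt_c.
  have [Z [mZ Z0 ZP]] := ess_sup_ge nuhat
    (abse \o (EFin \o (u \_ inf_gasket : borel_plane R -> R))).
  move: tile0; rewrite ltNge => /negP; apply; rewrite -Z0 le_measure ?inE//.
    exact: measurable_tile.
  move=> x tx; apply: ZP => /= h; have := le_lt_trans h lt_c.
  by rewrite lte_fin ltNge wx.
rewrite lee_fin in q1; have q0 : (0 < q)%R by exact: lt_le_trans q1.
rewrite /recip inver gt_eqF//= /Lp_norm unlock.
have -> : (c * (3 ^ n) `^ q^-1)%:E = (c `^ q * 3 ^ n)%:E `^ q^-1.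
  by rewrite poweR_EFin powRM ?powR_ge0 ?(ltW t0)// -powRrM mulfV ?gt_eqF// powRr1.
apply: gt0_ler_poweR; rewrite ?invr_ge0 ?(ltW q0)//.
- by rewrite in_itv/= leey lee_fin mulr_ge0 ?powR_ge0// ltW.
- by rewrite in_itv/= leey integral_ge0// => x _; exact: poweR_ge0.
have mw := measurable_inf_gasket_fun cu.
have mp : measurable_fun setT (fun x : borel_plane R => (`|(u \_ inf_gasket) x| `^ q)%:E).
  apply/measurable_EFinP.
  by apply: (measurableT_comp (measurable_powR q)); exact: measurableT_comp.
apply: (@le_trans _ _ (\int[nuhat]_(x in tile n j) (`|(u \_ inf_gasket) x| `^ q)%:E)).
  rewrite EFinM -(nuhat_tile nuP nuhatP n Lj) -integral_cst; last exact: measurable_tile.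
  apply: ge0_le_integral.
  - exact: measurable_tile.
  - by move=> x _; rewrite lee_fin powR_ge0.
  - exact: measurable_cst.
  - exact: measurable_funTS.
  by move=> x tx; rewrite lee_fin ler_powRl ?(ltW q0)// wx.
by apply: ge0_subset_integral => //; exact: measurable_tile.
Qed.

Lemma bump_domain n j : JL j -> domain nuhat (bump n j).
Proof.
move=> Lj; have cb := @bump_continuous n j.
have pre : pre_domain nuhat (bump n j).
  split=> //.
    have p1 : 1 <= 2%:E :> \bar R by rewrite lee_fin ler1n.
    have := Lp_norm_le_tile nuhat cb p1 (bump_range n j) (@bump_out n j).
    by move=> /le_lt_trans; apply; rewrite (nuhat_tile nuP nuhatP)// ltry.
  by rewrite bump_energy// lte_mul_pinfty ?tent_energy// lee_fin exprz_ge0// divr_ge0.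
have subE : (bump n j \- bump n j)%R = (fun=> 0%R) by apply/funext => x /=; rewrite subrr.
have L0 : Lp_norm nuhat 2%:E (fun=> 0%R : R) = 0.
  rewrite /Lp_norm (_ : EFin \o _ = cst 0) ?Lnorm0//.
  by apply/funext => x /=; rewrite patchE; case: ifP.
split=> //; exists (fun=> bump n j); split=> //.
  move=> e e0; exists 0%N => m k _ _; rewrite subE /domain_norm L0 inf_energy_cst.
  by rewrite poweR0r ?invr_neq0// adde0 lte_fin.
by rewrite subE L0; exact: cvg_cst.
Qed.

(** The bump is at least 3/5 on the tile of size 2^(n-2) given by [tent_ge]. The mass factor 1/9
    raised to 1/q <= 1 is at least 1/9, and 3/5 * 1/9 = 1/15. *)
Lemma Lp_norm_bump_ge (q : \bar R) n j : JL j -> 1 <= q ->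
  (15^-1 * (3 ^ n) `^ recip q)%:E <= Lp_norm nuhat q (bump n j).
Proof.
move=> Lj q1.
pose k := sub (sub j i0) i1.
have Lk : JL k by do 2 apply: JL_sub.
have ge35 x : tile (n - 2) k x -> (3 / 5 <= bump n j x)%R.
  move=> [y gy <-]; rewrite -phi_F (_ : n - 2 + 1 = n - 1)%R; last by ring.
  rewrite -phi_F subrK bump_phi; first exact: tent_ge.
  by do 2 apply: F_gasket.
apply: le_trans (Lp_norm_ge_tile (@bump_continuous n j) Lk q1 _ ge35).
  rewrite lee_fin expfzDr// powRM ?exprz_ge0//.
  have r0 := recip_ge0 q1; have r1 : (recip q <= 1)%R by rewrite -invr1; apply: recip_le.
  have h : (9^-1 <= (3 ^ (- 2%:Z)) `^ recip q :> R)%R.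
    rewrite -exprnN -natrX -[leLHS]powRr1 ?invr_ge0//.
    by apply: ger_powR => //; rewrite invr_gt0 ltr0n/= invf_le1// ler1n.
  by have := ler_wpM2l (powR_ge0 (3 ^ n) (recip q)) h; lra.
lra.
Qed.

End Bump.

(** * Necessary conditions on the exponents *)

Section Optimality.
Context {R : realType}.
Context (nu : probability (borel_plane R) R)
  (nuhat : {measure set (borel_plane R) -> \bar R}).
Context (nuP : is_hausdorff_gasket nu) (nuhatP : is_hausdorff_inf_gasket nu nuhat).

Let h : R := (2 * delta_s)^-1.

(** Zero and +oo have infinite logarithms, so a finite ratio excludes them. Hence convergence of the
    ratios forces the masses of the test triangles to be positive and finite eventually. *)
Lemma lne_ratio (x : \bar R) (n : int) : (0 <= x)%E -> n != 0 ->
  (lne x / (n%:~R * ln 3)%:E)%E \is a fin_num ->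
  x = (3 `^ (n%:~R * fine (lne x / (n%:~R * ln 3)%:E)%E))%:E.
Proof.
move=> x0 n0; have c0 : n%:~R * ln 3 != 0 :> R.
  by rewrite mulf_neq0 ?intr_eq0// gt_eqF// ln3_gt0.
have nfin (y : \bar R) : y = +oo%E \/ y = -oo%E ->
    (y * ((n%:~R * ln 3)^-1)%:E)%E \is a fin_num -> False.
  have : (n%:~R * ln 3)^-1 < 0 :> R \/ 0 < (n%:~R * ln 3)^-1 :> R.
    by apply/orP; rewrite -neq_lt invr_eq0.
  by move=> [c1|c1] [->|->];
    [rewrite lt0_mulye|rewrite lt0_mulNye|rewrite gt0_mulye|rewrite gt0_mulNye].
rewrite inver (negbTE c0); case: x x0 => [r|_|//]; last first.
  by move=> /nfin; case; left.
rewrite lee_fin le_eqVlt => /predU1P[<-|r0] /=.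
  by rewrite lexx => /nfin; case; right.
rewrite leNgt r0 /= => _; congr _%:E; rewrite /powR gt_eqF//.
rewrite (_ : _ * _ * _ = ln r); first by rewrite lnK.
by rewrite mulrAC mulrCA mulrA mulfK.
Qed.

Lemma bump_test (sigma : {measure set (borel_plane R) -> \bar R}) (p q : \bar R)
    (N : nat) (b : 'I_N.+1 -> R) (C : R) n j (k : R) :
  (1 <= p)%E -> (1 <= q)%E -> (forall i, 0 <= b i <= 1) -> 0 < C -> JL j ->
  sigma (tile n j : set (borel_plane R)) = (3 `^ (n%:~R * k))%:E ->
  (forall u : plane R -> R, domain nuhat u ->
    Lp_norm nuhat q u <= C%:E * \sum_(i < N.+1)
      (inf_energy u `^ (b i / 2) * Lp_norm sigma p u `^ (1 - b i)))%E ->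
  1 <= 15 * C * (1 + fine (energy (@tent R))) *
    \sum_(i < N.+1) 3 `^ (n%:~R * (k * recip p * (1 - b i) - h * b i - recip q)).
Proof.
move=> p1 q1 b01 C0 Lj sE H.
set e0 := fine (energy (@tent R)).
have e00 : 0 <= e0 by rewrite fine_ge0// energy_ge0.
have tE : energy (@tent R) = e0%:E.
  by rewrite fineK// ge0_fin_numE ?energy_ge0// tent_energy.
have := le_trans (Lp_norm_bump_ge nuP nuhatP n Lj q1) (H _ (bump_domain nuP nuhatP n Lj)).
have term i : (inf_energy (bump n j) `^ (b i / 2) *
      Lp_norm sigma p (bump n j) `^ (1 - b i) <=
    ((1 + e0) * 3 `^ (n%:~R * (k * recip p * (1 - b i) - h * b i)))%:E)%E.
  have /andP[b0 b1] := b01 i.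
  rewrite mulrBr pow3D mulrCA mulrC EFinM muleC; apply: lee_pmul; rewrite ?poweR_ge0//.
    apply: (@le_trans _ _ ((sigma (tile n j : set (borel_plane R)) `^ recip p) `^ (1 - b i))%E).
      apply: gt0_ler_poweR; first by rewrite subr_ge0.
      - by rewrite in_itv/= leey Lnorm_ge0.
      - by rewrite in_itv/= leey poweR_ge0.
      apply: Lp_norm_le_tile => //; [exact: bump_continuous|exact: bump_range|].
      exact: bump_out.
    rewrite sE -!poweRrM poweR_EFin lee_fin -powRrM.
    by rewrite (_ : _ * _ * (_ * _) = n%:~R * (k * recip p * (1 - b i)))//; ring.
  rewrite (bump_energy n Lj) tE -EFinM poweR_EFin lee_fin.
  rewrite powRM ?exprz_ge0 ?divr_ge0// [leRHS]mulrC.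
  apply: ler_pM; rewrite ?powR_ge0//.
    rewrite powRrM powR12_sqrt ?exprz_ge0 ?divr_ge0// sqrt53E -powRrM.
    rewrite (_ : _ * b i = - (n%:~R * (h * b i)))//.
    by rewrite intrN /h; ring.
  (* Raising the base to 1 + e0 >= 1 lets the exponent in [0, 1] be replaced by 1, so the constant
     does not involve b. *)
  apply: (@le_trans _ _ ((1 + e0) `^ (2^-1 * b i))).
    by apply: ler_powRl; rewrite ?mulr_ge0// lerDr.
  rewrite -[leRHS]powRr1 ?addr_ge0//; apply: ler_powR; first by rewrite lerDl.
  by lra.
move=> /le_trans => /(_ (C * \sum_(i < N.+1)
  ((1 + e0) * 3 `^ (n%:~R * (k * recip p * (1 - b i) - h * b i))))%:E).
have -> : (C%:E * \sum_(i < N.+1) (inf_energy (bump n j) `^ (b i / 2) *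
      Lp_norm sigma p (bump n j) `^ (1 - b i)) <= (C * \sum_(i < N.+1)
  ((1 + e0) * 3 `^ (n%:~R * (k * recip p * (1 - b i) - h * b i))))%:E)%E.
  rewrite EFinM lee_pmul2l ?lte_fin// -sumEFin; apply: lee_sum => i _; exact: term.
move=> /(_ isT); rewrite lee_fin -powR_intmul// -powRrM -mulr_sumr => main.
have -> : \sum_(i < N.+1) 3 `^ (n%:~R * (k * recip p * (1 - b i) - h * b i - recip q)) =
    3 `^ (- (n%:~R * recip q)) *
    \sum_(i < N.+1) 3 `^ (n%:~R * (k * recip p * (1 - b i) - h * b i)).
  rewrite mulr_sumr; apply: eq_bigr => i _; rewrite -pow3D; congr (_ `^ _); ring.
rewrite powRN; have := pow3_gt0 (n%:~R * recip q : R).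
move: main; set X := 3 `^ _; set S := \sum_(i < _) _ => main X0.
rewrite [leRHS](_ : _ = (15 * (C * ((1 + e0) * S))) / X); last by ring.
by rewrite ler_pdivlMr// mul1r; lra.
Qed.

(** The sign s = 1 treats diameters tending to infinity and s = -1 those tending to 0. If all these
    numbers were negative, every term in [bump_test] would decay along the sequence, against the
    lower bound 1. *)
Lemma exponent_obstruction (sigma : {measure set (borel_plane R) -> \bar R})
    (p q : \bar R) (N : nat) (b : 'I_N.+1 -> R) (C d s : R)
    (n_ : nat -> int) (j_ : nat -> idx) :
  (1 <= p)%E -> (1 <= q)%E -> (forall i, 0 <= b i <= 1) -> 0 < C ->
  (forall k, JL (j_ k)) -> s ^+ 2 = 1 ->
  (forall A : R, \forall k \near \oo, A <= s * (n_ k)%:~R) ->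
  (lne (sigma (tile (n_ k) (j_ k))) / lne (nuhat (tile (n_ k) (j_ k))) @[k --> \oo]
     --> (d^-1)%:E)%E ->
  (forall u : plane R -> R, domain nuhat u ->
    Lp_norm nuhat q u <= C%:E * \sum_(i < N.+1)
      (inf_energy u `^ (b i / 2) * Lp_norm sigma p u `^ (1 - b i)))%E ->
  exists i, 0 <= s * (recip p / d * (1 - b i) - h * b i - recip q).
Proof.
move=> p1 q1 b01 C0 Lj s2 n_oo cvg_ratio H.
apply: contrapT => /forallNP neg.
have {}neg i : s * (recip p / d * (1 - b i) - h * b i - recip q) < 0.
  by rewrite ltNge; apply/negP; exact: neg.
have lnE k : lne (nuhat (tile (n_ k) (j_ k))) = ((n_ k)%:~R * ln 3)%:E.
  rewrite (nuhat_tile nuP nuhatP)// lne_EFin ?exprz_gt0// -powR_intmul//.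
  by rewrite ln_powR.
pose r k := (lne (sigma (tile (n_ k) (j_ k))) / ((n_ k)%:~R * ln 3)%:E)%E.
have rcvg : r k @[k --> \oo] --> (d^-1)%:E.
  by move: cvg_ratio; under eq_cvg do rewrite lnE.
have [rfin rlim] := (fine_cvgP _ _).1 rcvg.
pose psi i := s * (recip p / d * (1 - b i) - h * b i - recip q).
pose D := 15 * C * (1 + fine (energy (@tent R))).
have D0 : 0 <= D by rewrite !mulr_ge0 ?addr_ge0 ?fine_ge0 ?energy_ge0 ?(ltW C0).
have rp0 := recip_ge0 p1; have rp1 : recip p <= 1 by rewrite -invr1; apply: recip_le.
have: (1 : R) <= 0; last by rewrite ler10.
apply: (@pow3_decay R _ (D * N.+1%:R) 1) => // m.
have nearP : \forall k \near \oo, forall i,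
    (n_ k)%:~R * (fine (r k) * recip p * (1 - b i) - h * b i - recip q) <= - m%:R.
  apply: filter_forall => i; have /andP[b0 b1] := b01 i.
  (* Half of the gap absorbs the error of the ratio, leaving an exponent of at most s n psi/2. *)
  have c0 : 0 < - psi i / 2 by rewrite divr_gt0// oppr_gt0 neg.
  have /cvgrPdist_lt /(_ _ c0) rnear := rlim.
  near=> k.
  have h1 : `|d^-1 - fine (r k)| < - psi i / 2 by near: k.
  have h2 : m%:R / (- psi i / 2) <= s * (n_ k)%:~R by near: k; exact: n_oo.
  have h2' : m%:R <= s * (n_ k)%:~R * (- psi i / 2) by rewrite -ler_pdivrMr.
  have sn0 : 0 <= s * (n_ k)%:~R by apply: le_trans h2; rewrite divr_ge0// ltW.
  set w := _ - h * b i - recip q.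
  have sw : s * w <= psi i / 2.
    have -> : s * w = psi i + s * (fine (r k) - d^-1) * (recip p * (1 - b i)).
      by rewrite /w /psi; ring.
    suff : s * (fine (r k) - d^-1) * (recip p * (1 - b i)) <= - psi i / 2 by lra.
    apply: le_trans (ler_norm _) _; rewrite normrM normrM.
    have -> : `|s| = 1 by apply/eqP; rewrite -sqr_norm_eq1 s2.
    rewrite mul1r distrC; apply: le_trans (_ : `|d^-1 - fine (r k)| * 1 <= _).
      rewrite ler_wpM2l// ger0_norm ?mulr_ge0 ?subr_ge0//.
      by rewrite mulr_ile1 ?subr_ge0// gerBl.
    by rewrite mulr1 ltW.
  have -> : (n_ k)%:~R * w = (s * (n_ k)%:~R) * (s * w).
    by rewrite mulrACA -expr2 s2 mul1r.
  have := ler_wpM2l sn0 sw; move: h2'; lra.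
(* A single k suffices for each m; [n_ k != 0] and a finite ratio are what [lne_ratio] requires. *)
have [k [kP [kn kfin]]] : exists k, (forall i,
    (n_ k)%:~R * (fine (r k) * recip p * (1 - b i) - h * b i - recip q) <= - m%:R)
    /\ n_ k != 0 /\ r k \is a fin_num.
  near \oo => k; exists k; split; first by near: k.
  split; last by near: k.
  have : 1 <= s * (n_ k)%:~R by near: k; exact: n_oo.
  by apply: contraTneq => ->; rewrite mulr0 ler10.
have := bump_test p1 q1 b01 C0 (Lj k) (lne_ratio (measure_ge0 _ _) kn kfin) H.
move=> /le_trans; apply; rewrite -/D -mulrA ler_wpM2l// mulr1.
apply: (@le_trans _ _ (\sum_(i < N.+1) 3 `^ (- m%:R))).
  by apply: ler_sum => i _; apply: ler_powR; [rewrite ler1n|exact: kP].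
by rewrite sumr_const card_ord mulr_natl.
Unshelve. all: by end_near.
Qed.

End Optimality.

(** The map x -> (x - 1/q) / (x + h) is nondecreasing for x >= 0, because h + 1/q >= 0 and h > 0;
    and 1/(p du) <= 1/(p dl). *)
Lemma interp_exponent_le (R : realType) (p q : \bar R) (dl du : R) :
  (1 <= p)%E -> (1 <= q)%E -> 0 < dl -> dl <= du ->
  interp_exponent p q du <= interp_exponent p q dl.
Proof.
move=> p1 q1 dl0 dldu; have du0 : 0 < du by exact: lt_le_trans dldu.
have rp0 := recip_ge0 p1; have rq0 := recip_ge0 q1.
have h0 := @half_inv_delta_s_gt0 R.
have xl : 0 <= recip p / du by rewrite divr_ge0// ltW.
have xy : recip p / du <= recip p / dl by rewrite ler_wpM2l// lef_pV2 ?posrE.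
rewrite /interp_exponent; set x := recip p / du in xl xy *.
set y := recip p / dl in xy *; set h := (2 * delta_s)^-1 in h0 *.
rewrite ge_max le_max le_max lexx orbT andbT; apply/orP; left.
rewrite ler_pdivrMr; last by lra.
rewrite mulrAC ler_pdivlMr; last by lra.
have : 0 <= (y - x) * (h + recip q) by rewrite mulr_ge0 ?subr_ge0// addr_ge0// ltW.
lra.
Qed.

Lemma scale_to_oo (R : realType) (s : R) (n_ : nat -> int) :
  (s = 1 /\ ((2 : R) ^ n_ k @[k --> \oo] --> +oo)) \/
  (s = -1 /\ ((2 : R) ^ n_ k @[k --> \oo] --> (0 : R))) ->
  forall A : R, \forall k \near \oo, A <= s * (n_ k)%:~R.
Proof.
move=> h A; pose a := Num.bound `|A|.
have Aa : A <= a%:R.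
  by apply: le_trans (ler_norm A) _; apply/ltW/archi_boundP.
case: h => [[-> /cvgryPgt /(_ (2 ^ a%:Z))]|[-> /cvgrPdist_lt]].
  apply: filterS => k; rewrite mul1r; case: (leP (n_ k) a%:Z) => [ka|ak _].
    by rewrite ltNge ler_weXz2l// ler1n.
  by apply: le_trans Aa _; rewrite -[a%:R]/((a%:Z)%:~R) ler_int ltW.
move=> /(_ (2 ^ (- a%:Z)) (exp2z_gt0 _)); apply: filterS => k.
rewrite sub0r normrN (ger0_norm (ltW (exp2z_gt0 _))) mulN1r.
case: (leP (- a%:Z) (n_ k)) => [ka|ak _].
  by rewrite ltNge ler_weXz2l// ler1n.
by apply: le_trans Aa _; rewrite -[a%:R]/((a%:Z)%:~R) -intrN ler_int lerNr ltW.
Qed.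

Local Open Scope ereal_scope.

Theorem theorem3p11 (R : realType)
    (nu : probability (borel_plane R) R)
    (nuhat : {measure set (borel_plane R) -> \bar R})
    (nuP : is_hausdorff_gasket nu)
    (nuhatP : is_hausdorff_inf_gasket nu nuhat) :
  (forall Csigma : R, (1 <= Csigma)%R ->
   exists C : R, (0 < C)%R /\
   forall (p q : \bar R) (dl du : R)
     (sigma : {measure set (borel_plane R) -> \bar R}),
     1 <= p -> p <= q -> 2%:E <= q ->
     (0 < dl)%R -> (dl <= du)%R ->
     concentrated sigma ->
     volume_lower_bound nuhat sigma Csigma dl du ->
     let a1 := interp_exponent p q dl in
     let a2 := interp_exponent p q du in
     forall u : plane R -> R, domain nuhat u ->
       Lp_norm nuhat q u <=
       C%:E * (inf_energy u `^ (a1 / 2) * Lp_norm sigma p u `^ (1 - a1)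
             + inf_energy u `^ (a2 / 2) * Lp_norm sigma p u `^ (1 - a2)))
  /\
  (forall (p q : \bar R) (dl du Csigma : R)
     (sigma : {measure set (borel_plane R) -> \bar R}),
     1 <= p -> p <= q -> 2%:E <= q ->
     (1 <= Csigma)%R -> (0 < dl)%R -> (dl <= du)%R ->
     concentrated sigma ->
     volume_lower_bound nuhat sigma Csigma dl du ->
     forall S : int -> set (plane R),
     (forall m : int, dyadic_triangle (S m)) ->
     diam (S (- n%:Z)%R) @[n --> \oo] --> (0 : R)%R ->
     diam (S n%:Z) @[n --> \oo] --> +oo%R ->
     lne (sigma (S (- n%:Z)%R)) / lne (nuhat (S (- n%:Z)%R)) @[n --> \oo]
       --> (dl^-1)%:E ->
     lne (sigma (S n%:Z)) / lne (nuhat (S n%:Z)) @[n --> \oo]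
       --> (du^-1)%:E ->
     let a1 := interp_exponent p q dl in
     let a2 := interp_exponent p q du in
     forall (N : nat) (b : 'I_N.+1 -> R) (C : R),
       (forall i, 0 <= b i <= 1)%R -> (0 < C)%R ->
       (forall u : plane R -> R, domain nuhat u ->
          Lp_norm nuhat q u <=
          C%:E * \sum_(i < N.+1)
            (inf_energy u `^ (b i / 2) * Lp_norm sigma p u `^ (1 - b i))) ->
       (\big[Num.min/b ord0]_(i < N.+1) b i <= a2)%R /\
       (a2 <= a1)%R /\
       (a1 <= \big[Num.max/b ord0]_(i < N.+1) b i)%R).
Proof.
split=> [Cs Cs1|p q dl du Cs sigma p1 pq q2 Cs1 dl0 dldu cs vlb S dS diam0 diamoo
  rl ru a1 a2 N b C b01 C0 H].
  exists (4 * (16 * (16 + Cs)))%R; split.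
    by rewrite !mulr_gt0// addr_gt0// (lt_le_trans ltr01).
  move=> p q dl du sigma p1 pq q2 dl0 dldu _ vlb a1 a2 u domu.
  exact: (interpolation_inequality nuP nuhatP Cs1 p1 pq q2 dl0 dldu vlb domu).
have q1 : 1 <= q by exact: le_trans pq.
have du0 : (0 < du)%R by exact: lt_le_trans dldu.
have [nj njP] := choice (fun m => (dyadic_triangleP (S m)).1 (dS m)).
have [j_ jP] := choice njP.
have h0 := @half_inv_delta_s_gt0 R.
have rp0 := recip_ge0 p1.
have pd0 d : (0 < d)%R -> (0 <= recip p / d)%R by move=> ?; rewrite divr_ge0// ltW.
have SE m : S m = tile (nj m) (j_ m) by case: (jP m).
have JLj m : JL (j_ m) by case: (jP m).
have dE m : diam (S m) = (2 ^ nj m)%R by rewrite SE diam_tile.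
split; last split.
(* Large triangles: solved for [b i], the condition says that [b i] is at most the fraction in
   [a2]. *)
- have [i hi] : exists i, (0 <= 1 * (recip p / du * (1 - b i) -
      (2 * delta_s)^-1 * b i - recip q))%R.
    apply: (exponent_obstruction nuP nuhatP (sigma := sigma) (n_ := fun k => nj k%:Z)
      (j_ := fun k => j_ k%:Z) p1 q1 b01 C0 _ (expr1n _ _) _ _ H) => //.
      apply: scale_to_oo; left; split=> //.
      by move: diamoo; under eq_cvg do rewrite dE.
    by move: ru; under eq_cvg do rewrite SE.
  apply: (@le_trans _ _ (b i)); first exact: bigmin_le.
  rewrite /a2 /interp_exponent le_max; apply/orP; left.
  have := pd0 du du0 => pdd; rewrite ler_pdivlMr; last by lra.
  by lra.
- exact: interp_exponent_le.
(* Small triangles reverse the sign, so [b i] is at least the fraction in [a1]; the positive part is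
   covered by b i >= 0. *)
- have [i hi] : exists i, (0 <= (-1) * (recip p / dl * (1 - b i) -
      (2 * delta_s)^-1 * b i - recip q))%R.
    apply: (exponent_obstruction nuP nuhatP (sigma := sigma) (n_ := fun k => nj (- k%:Z)%R)
      (j_ := fun k => j_ (- k%:Z)%R) p1 q1 b01 C0 _ _ _ _ H) => //.
    + by rewrite sqrrN expr1n.
    + apply: scale_to_oo; right; split=> //.
      by move: diam0; under eq_cvg do rewrite dE.
    + by move: rl; under eq_cvg do rewrite SE.
  apply: (@le_trans _ _ (b i)); last exact: le_bigmax.
  rewrite /a1 /interp_exponent ge_max; apply/andP; split; last by case/andP: (b01 i).
  have := pd0 dl dl0 => pdd; rewrite ler_pdivrMr; last by lra.
  by lra.
Qed.
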